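(* Let $M=\mathbb{R}\times\mathbb{S}^1$ be the topological cylinder with the Riemannian metric $h=dr^2+m^2(r)\,d\theta^2$, and let $\widetilde W=A(r)\frac{\partial}{\partial r}+B\frac{\partial}{\partial\theta}$, where $A=A(r)$ is a smooth function on $\mathbb{R}$ and $B$ is a constant, with $A^2(r)+B^2m^2(r)<1$. Let $\widetilde F=\widetilde\alpha+\widetilde\beta$ be the solution of Zermelo's navigation problem for $(M,h)$ and $\widetilde W$, and let $F=\alpha+\beta$ be the solution of Zermelo's navigation problem for $(M,h)$ and wind $V=A(r)\frac{\partial}{\partial r}$. Then the following are true. (i) The $\widetilde F$-unit speed geodesics $\mathcal P(t)$ are given by $$\mathcal P(t)=\big(r(s(t)),\ \theta(s(t))+B\cdot t\big),$$ where $\rho(s)=(r(s),\theta(s))$ is an $\alpha$-unit speed geodesic and $s=s(t)$ is the parameter change given by $t=\int_0^sF(\rho(\tau),\dot\rho(\tau))\,d\tau$. (ii) The point $q=\mathcal P(l)$ is conjugate to $\mathcal P(0)=p$ along $\mathcal P$ if and only if $\widehat q=(r(q),\theta(q)-Bl)$ is conjugate to $p$ with respect to $\alpha$ along the corresponding $\alpha$-geodesic $\rho$ from $p$ to $\widehat q$. (iii) The point $\widehat q\in Cut_\alpha(p)$ is an $\alpha$-cut point of $p$ if and only if $q=(r(\widehat q),\theta(\widehat q)+Bl)\in Cut_{\widetilde F}(p)$, where $l=d_{\widetilde F}(p,q)$.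
   Context: Coordinates on $M$ are $(r,\theta)$, $r\in\mathbb{R}$, $\theta\in[0,2\pi)$, and all $\theta$-values are understood mod $2\pi$; $r(q),\theta(q)$ denote the coordinates of a point $q$. Standing assumptions: the warping function $m:\mathbb{R}\to\mathbb{R}$ is smooth, positive and even, and is not a linear function (the Gaussian curvature $G_h=-m''/m$ is not identically zero). The solution of Zermelo's navigation problem for $(M,h)$ and a wind $U$ with $\|U\|_h<1$ is the Randers metric $G$ (norm of a Riemannian metric plus a 1-form) characterized by $G(y)=1$ iff $\|y-U\|_h=1$. For $U=V=A(r)\frac{\partial}{\partial r}$ this gives $F=\alpha+\beta$ where, with $\lambda=1-A^2(r)$, $\alpha$ is the norm of the Riemannian metric $\frac{1}{\lambda^2}dr^2+\frac{m^2(r)}{\lambda}d\theta^2$ (this Riemannian metric is also denoted $\alpha$) and $\beta=-\frac{A(r)}{\lambda}dr$. The distance $d_{\widetilde F}(p,q)$ is the infimum of $\int\widetilde F(\gamma,\dot\gamma)\,dt$ over piecewise $C^\infty$ curves from $p$ to $q$. A point $q$ on a geodesic emanating from $p$ is a cut point of $p$ if the geodesic is globally minimizing from $p$ up to $q$ but not beyond; $Cut(p)$ (with subscript the metric) is the set of all cut points of $p$. *)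

(* Defs.v *)
(* Standard library reals with Coquelicot.

   Points of the cylinder R x S^1 are coordinate pairs (r, theta) with theta
   understood mod 2 PI (see [same_point]).  Functions on the cylinder are
   functions of (r, theta) that are 2 PI-periodic in theta.  A continuous curve
   in the cylinder is given by a continuous lift R -> R * R, so its coordinate
   functions can be differentiated. *)
From Stdlib Require Import Reals ZArith.
From Coquelicot Require Import Coquelicot.
Open Scope R_scope.

Definition point : Type := (R * R)%type.

Definition same_point (p q : point) : Prop :=
  fst p = fst q /\ exists k : Z, snd p = snd q + 2 * PI * IZR k.

(** * Smoothness *)

Definition smooth_on (a b : Rbar) (f : R -> R) : Prop :=
  forall (n : nat) (t : R), Rbar_lt a t -> Rbar_lt t b -> ex_derive_n f n t.

Definition smooth (f : R -> R) : Prop := smooth_on m_infty p_infty f.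

(* Class C^n on the open set D. *)
Fixpoint Cn2_on (n : nat) (D : R -> R -> Prop) (f : R -> R -> R) : Prop :=
  (forall x y, D x y -> continuity_2d_pt f x y) /\
  match n with
  | O => True
  | S k =>
      (forall x y, D x y ->
         ex_derive (fun z => f z y) x /\ ex_derive (fun z => f x z) y) /\
      Cn2_on k D (fun x y => Derive (fun z => f z y) x) /\
      Cn2_on k D (fun x y => Derive (fun z => f x z) y)
  end.

Definition smooth2_on (D : R -> R -> Prop) (f : R -> R -> R) : Prop :=
  forall n : nat, Cn2_on n D f.

Definition smooth_function (f : R -> R -> R) : Prop :=
  smooth2_on (fun _ _ => True) f /\
  forall r th, f r (th + 2 * PI) = f r th.

(** * Metrics *)

(* [F r th u v] is the value of F at the tangent vector
   u d/dr + v d/dtheta based at (r, th). *)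
Definition metric : Type := R -> R -> R -> R -> R.

Definition is_riemannian_norm (a : metric) : Prop :=
  exists g11 g12 g22 : R -> R -> R,
    smooth_function g11 /\ smooth_function g12 /\ smooth_function g22 /\
    (forall r th u v, (u, v) <> (0, 0) ->
       0 < g11 r th * u ^ 2 + 2 * g12 r th * u * v + g22 r th * v ^ 2) /\
    forall r th u v,
      a r th u v =
      sqrt (g11 r th * u ^ 2 + 2 * g12 r th * u * v + g22 r th * v ^ 2).

Definition is_one_form (b : metric) : Prop :=
  exists b1 b2 : R -> R -> R,
    smooth_function b1 /\ smooth_function b2 /\
    forall r th u v, b r th u v = b1 r th * u + b2 r th * v.

Definition is_randers (G a b : metric) : Prop :=
  is_riemannian_norm a /\ is_one_form b /\
  forall r th u v, G r th u v = a r th u v + b r th u v.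

(* G = a + b solves Zermelo's navigation problem for the norm [h] and the wind
   U1 d/dr + U2 d/dtheta. *)
Definition zermelo_solution (h : metric) (U1 U2 : R -> R -> R)
    (G a b : metric) : Prop :=
  is_randers G a b /\
  forall r th u v,
    G r th u v = 1 <-> h r th (u - U1 r th) (v - U2 r th) = 1.

(* The norm of dr^2 + m(r)^2 dtheta^2. *)
Definition warped_norm (m : R -> R) : metric :=
  fun r _ u v => sqrt (u ^ 2 + (m r) ^ 2 * v ^ 2).

(** * Curves, length and distance *)

Definition curve : Type := R -> point.

Definition rc (c : curve) (t : R) : R := fst (c t).
Definition thc (c : curve) (t : R) : R := snd (c t).

Definition along (L : metric) (c : curve) (t : R) : R :=
  L (rc c t) (thc c t) (Derive (rc c) t) (Derive (thc c) t).

Definition curve_length (F : metric) (c : curve) (a b : R) : R :=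
  RInt (along F c) a b.

(* Smoothness on a closed subinterval means having a smooth extension. *)
Definition piecewise_smooth (c : curve) (a b : R) : Prop :=
  a < b /\
  exists (n : nat) (t : nat -> R),
    t O = a /\ t n = b /\
    forall i, (i < n)%nat ->
      t i < t (S i) /\
      exists e1 e2 : R -> R,
        smooth e1 /\ smooth e2 /\
        forall x, t i <= x <= t (S i) -> c x = (e1 x, e2 x).

Definition finsler_dist (F : metric) (p q : point) : R :=
  real (Glb_Rbar (fun L : R =>
    exists (c : curve) (a b : R),
      piecewise_smooth c a b /\ same_point (c a) p /\ same_point (c b) q /\
      L = curve_length F c a b)).

(** * Geodesics *)

Definition energy (F : metric) : metric := fun r th u v => (F r th u v) ^ 2 / 2.

Definition D_r (L : metric) : metric :=
  fun r th u v => Derive (fun x => L x th u v) r.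
Definition D_th (L : metric) : metric :=
  fun r th u v => Derive (fun x => L r x u v) th.
Definition D_u (L : metric) : metric :=
  fun r th u v => Derive (fun x => L r th x v) u.
Definition D_v (L : metric) : metric :=
  fun r th u v => Derive (fun x => L r th u x) v.

(* Constant speed geodesics on the open interval (a, b): the Euler-Lagrange
   equations of F^2 / 2. *)
Definition geodesic_on (F : metric) (a b : Rbar) (c : curve) : Prop :=
  smooth_on a b (rc c) /\ smooth_on a b (thc c) /\
  forall t : R, Rbar_lt a t -> Rbar_lt t b ->
    is_derive (along (D_u (energy F)) c) t (along (D_r (energy F)) c t) /\
    is_derive (along (D_v (energy F)) c) t (along (D_th (energy F)) c t).

Definition unit_geodesic_on (F : metric) (a b : Rbar) (c : curve) : Prop :=
  geodesic_on F a b c /\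
  forall t : R, Rbar_lt a t -> Rbar_lt t b -> along F c t = 1.

(** * Conjugate points and cut points *)

(* J1 d/dr + J2 d/dtheta is a Jacobi field along c on (a, b): the variation
   field of a smooth variation of c through geodesics. *)
Definition jacobi_field (F : metric) (a b : R) (c : curve) (J1 J2 : R -> R)
    : Prop :=
  exists (d : R) (G : R -> curve),
    0 < d /\
    smooth2_on (fun e t => Rabs e < d /\ a < t < b) (fun e t => fst (G e t)) /\
    smooth2_on (fun e t => Rabs e < d /\ a < t < b) (fun e t => snd (G e t)) /\
    (forall t, a < t < b -> G 0 t = c t) /\
    (forall e, Rabs e < d -> geodesic_on F a b (G e)) /\
    (forall t, a < t < b ->
       J1 t = Derive (fun e => fst (G e t)) 0 /\
       J2 t = Derive (fun e => snd (G e t)) 0).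

(* q = c l is conjugate to p = c 0 along the geodesic c.  The Jacobi field lives
   on some open interval around [0, l], on which c is then a geodesic. *)
Definition conjugate_along (F : metric) (c : curve) (l : R) (p q : point)
    : Prop :=
  same_point (c 0) p /\ same_point (c l) q /\
  exists (a b : R) (J1 J2 : R -> R),
    a < 0 /\ l < b /\
    jacobi_field F a b c J1 J2 /\
    (J1 0, J2 0) = (0, 0) /\ (J1 l, J2 l) = (0, 0) /\
    exists t, a < t < b /\ (J1 t, J2 t) <> (0, 0).

Definition minimizing (F : metric) (c : curve) (t : R) : Prop :=
  curve_length F c 0 t = finsler_dist F (c 0) (c t).

(* The geodesic has to be defined beyond its cut point, at parameter l < b. *)
Definition cut (F : metric) (p q : point) : Prop :=
  exists (a b : Rbar) (c : curve) (l : R),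
    Rbar_lt a 0 /\ 0 < l /\ Rbar_lt l b /\
    unit_geodesic_on F a b c /\
    same_point (c 0) p /\ same_point (c l) q /\
    (forall t, 0 <= t <= l -> minimizing F c t) /\
    (forall t, l < t -> Rbar_lt t b -> ~ minimizing F c t).

(** * The correspondence between geodesics *)

(* rho is an alpha-unit speed geodesic on (c, d), s is the parameter change
   from (a, b) onto (c, d) with t = int_0^{s(t)} F(rho, rho'), and
   P(t) = (r(s(t)), theta(s(t)) + B t). *)
Definition corresponds (F alpha : metric) (B : R)
    (a b : Rbar) (P : curve) (c d : Rbar) (rho : curve) (s : R -> R) : Prop :=
  Rbar_lt c 0 /\ Rbar_lt 0 d /\
  unit_geodesic_on alpha c d rho /\
  (forall t : R, Rbar_lt a t -> Rbar_lt t b ->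
     Rbar_lt c (s t) /\ Rbar_lt (s t) d /\
     t = curve_length F rho 0 (s t) /\
     P t = (rc rho (s t), thc rho (s t) + B * t)) /\
  (forall x : R, Rbar_lt c x -> Rbar_lt x d ->
     exists t : R, Rbar_lt a t /\ Rbar_lt t b /\ s t = x).

(* Main.v *)
(* The navigation metric for the wind A d/dr + B d/dtheta has as indicatrix the unit
   sphere of h translated by the wind.  The rotational part B d/dtheta is a Killing
   field: the Euler-Lagrange momenta of Ft along a curve (r, theta + B t) are those
   of F along (r, theta), divided by 1 + B k with k the Clairaut constant, so
   unit speed geodesics correspond by adding B t to theta.  For the radial part, F
   differs from alpha by the exact form - d f, where f' = A / (1 - A^2), so F and
   alpha have the same extremals up to parametrization.

   A variation through geodesics is normalized to unit speed; this keeps its variation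
   field J, since by the first variation formula the speed is stationary when J
   vanishes at both ends.  Passing from F to alpha then changes J by a multiple of the
   velocity that vanishes together with J.  Unique continuation of Jacobi fields allows
   the interval of definition to be shrunk.

   For the distances, a curve carried by an additional wind for the time given by its
   length keeps its length, so d_F(p, q) = l if and only if
   d_Ft(p, q + B l d/dtheta) = l, while d_F and d_alpha differ by the variation of f.
   Minimizing and non-minimizing parameters therefore correspond. *)

(* [jacobi_field] asks for a variation through geodesics, not for a solution of a differential
   equation, so no field can be produced by solving one. The transformations act on whole variations
   and may lose part of the interval and of the range of the variation parameter; compactness keeps
   what remains uniform. The time at which the field is nonzero may be lost as well. It is recovered
   in the smaller interval by unique continuation, proved for alpha alone, where Hamilton's
   equations are explicit.

   The metrics are not smooth at zero velocity, and the curves competing for the distance may stop.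
   Their carried versions are therefore built from a smooth upper bound of the speed. The error is
   absorbed by drifting along a parallel: the drift by the difference of the winds costs less than
   the time it takes, because it differs from the second wind by a vector shorter than 1.

   The Randers data are abstract and are first made explicit: homogeneity and the indicatrix
   determine [F], and the even part of [F] is alpha. *)
Require Import Defs.
From Stdlib Require Import Reals ZArith Lra Lia Psatz.
From Stdlib Require Import FunctionalExtensionality ClassicalEpsilon Classical.
From Coquelicot Require Import Coquelicot.
Open Scope R_scope.
Set Bullet Behavior "Strict Subproofs".

(** * Smooth functions of two variables *)

(* [ring] and [field] only recognize equations in [R] itself. *)
Ltac R_eq := match goal with |- @eq _ ?a ?b => change (@eq R a b) end.

Lemma ball_Rabs (x : R) (e : posreal) (y : R) : ball x e y <-> Rabs (y - x) < e.
Proof. reflexivity. Qed.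

Definition dx (f : R -> R -> R) : R -> R -> R :=
  fun x y => Derive (fun z => f z y) x.
Definition dy (f : R -> R -> R) : R -> R -> R :=
  fun x y => Derive (fun z => f x z) y.

Definition open2 (D : R -> R -> Prop) : Prop :=
  forall x y, D x y -> locally_2d D x y.

Lemma open2_locally_x D x y :
  open2 D -> D x y -> locally x (fun z => D z y).
Proof. intros o d; exact (locally_2d_1d_const_y D x y (o x y d)). Qed.

Lemma open2_locally_y D x y :
  open2 D -> D x y -> locally y (fun z => D x z).
Proof. intros o d; exact (locally_2d_1d_const_x D x y (o x y d)). Qed.

Lemma locally_2d_mono (P Q : R -> R -> Prop) x y :
  (forall u v, P u v -> Q u v) -> locally_2d P x y -> locally_2d Q x y.
Proof. intros H [d Hd]; exists d; auto. Qed.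

Lemma Cn2_continuity n D f x y : Cn2_on n D f -> D x y -> continuity_2d_pt f x y.
Proof. destruct n; intros [H _]; auto. Qed.

Lemma Cn2_pred n D f : Cn2_on (S n) D f -> Cn2_on n D f.
Proof.
  revert f; induction n as [|n IH]; intros f [C [E [Hx Hy]]].
  - split; auto.
  - split; auto.
Qed.

Lemma Cn2_mono n (D D' : R -> R -> Prop) f :
  (forall x y, D' x y -> D x y) -> Cn2_on n D f -> Cn2_on n D' f.
Proof.
  intros H; revert f; induction n as [|n IH]; intros f [C E]; split; auto.
  destruct E as [E [Hx Hy]]; auto.
Qed.

Lemma Cn2_ext n D f g :
  open2 D -> (forall x y, D x y -> f x y = g x y) -> Cn2_on n D f -> Cn2_on n D g.
Proof.
  intros o; revert f g; induction n as [|n IH]; intros f g e [C E]; split; auto.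
  1, 2: intros x y d; apply continuity_2d_pt_ext_loc with f; auto;
    apply locally_2d_mono with D; auto.
  destruct E as [E [Hx Hy]]. repeat split.
  - apply ex_derive_ext_loc with (fun z => f z y); [|exact (proj1 (E x y H))].
    generalize (open2_locally_x D x y o H); apply filter_imp; auto.
  - apply ex_derive_ext_loc with (fun z => f x z); [|exact (proj2 (E x y H))].
    generalize (open2_locally_y D x y o H); apply filter_imp; auto.
  - apply IH with (2 := Hx). intros x y d. apply Derive_ext_loc.
    generalize (open2_locally_x D x y o d); apply filter_imp; auto.
  - apply IH with (2 := Hy). intros x y d. apply Derive_ext_loc.
    generalize (open2_locally_y D x y o d); apply filter_imp; auto.
Qed.

(** One continuous partial derivative, together with the existence of the other, gives total
    differentiability. *)
Lemma partials_differentiable D f f1 f2 x y :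
  open2 D ->
  (forall x y, D x y -> is_derive (fun z => f z y) x (f1 x y) /\
                        is_derive (fun z => f x z) y (f2 x y)) ->
  (forall x y, D x y -> continuity_2d_pt f1 x y) ->
  D x y -> differentiable_pt_lim f x y (f1 x y) (f2 x y).
Proof.
  intros o H C d. apply filterdiff_differentiable_pt_lim.
  apply (is_derive_filterdiff f x y f1 (f2 x y)).
  - generalize (proj1 (locally_2d_locally _ _ _) (o x y d)).
    apply filter_imp. intros [u v] h; apply H; auto.
  - apply H; auto.
  - apply continuity_2d_pt_filterlim; auto.
Qed.

(** [Cn2_on] speaks of the partials as [Derive] terms; here they may be any formulas that agree with
    them on the open set [D]. Closure properties can then be proved by exhibiting derivatives. *)
Lemma Cn2_intro n D f f1 f2 :
  open2 D ->
  (forall x y, D x y -> is_derive (fun z => f z y) x (f1 x y) /\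
                        is_derive (fun z => f x z) y (f2 x y)) ->
  Cn2_on n D f1 -> Cn2_on n D f2 -> Cn2_on (S n) D f.
Proof.
  intros o H H1 H2. split; [|repeat split].
  - intros x y d. apply differentiable_continuity_pt.
    exists (f1 x y), (f2 x y). apply partials_differentiable with D; auto.
    intros; apply Cn2_continuity with n D; auto.
  - exists (f1 x y); apply H; auto.
  - exists (f2 x y); apply H; auto.
  - apply Cn2_ext with f1; auto. intros x y d; symmetry; apply is_derive_unique, H, d.
  - apply Cn2_ext with f2; auto. intros x y d; symmetry; apply is_derive_unique, H, d.
Qed.

Lemma Cn2_is_derive n D f x y :
  Cn2_on (S n) D f -> D x y ->
  is_derive (fun z => f z y) x (dx f x y) /\ is_derive (fun z => f x z) y (dy f x y).
Proof.
  intros [C [E _]] d; split; apply Derive_correct; [exact (proj1 (E x y d)) | exact (proj2 (E x y d))].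
Qed.

Lemma Cn2_dx n D f : Cn2_on (S n) D f -> Cn2_on n D (dx f).
Proof. intros [C [E [Hx Hy]]]; exact Hx. Qed.

Lemma Cn2_dy n D f : Cn2_on (S n) D f -> Cn2_on n D (dy f).
Proof. intros [C [E [Hx Hy]]]; exact Hy. Qed.

Lemma Cn2_differentiable n D f x y :
  open2 D -> Cn2_on (S n) D f -> D x y ->
  differentiable_pt_lim f x y (dx f x y) (dy f x y).
Proof.
  intros o H d. apply partials_differentiable with D; auto.
  - intros; apply Cn2_is_derive with n D; auto.
  - intros; apply Cn2_continuity with n D; auto. apply Cn2_dx, H.
Qed.

Lemma Cn2_const n D c : open2 D -> Cn2_on n D (fun _ _ => c).
Proof.
  intros o; revert c; induction n as [|n IH]; intros c.
  - split; auto; intros; apply continuity_2d_pt_const.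
  - apply Cn2_intro with (fun _ _ => 0) (fun _ _ => 0); auto.
    intros x y d; split; apply @is_derive_const.
Qed.

Lemma Cn2_id1 n D : open2 D -> Cn2_on n D (fun x _ => x).
Proof.
  intros o; destruct n as [|n].
  - split; auto; intros; apply continuity_2d_pt_id1.
  - apply Cn2_intro with (fun _ _ => 1) (fun _ _ => 0); auto using Cn2_const.
    intros x y d; split; [apply @is_derive_id | apply @is_derive_const].
Qed.

Lemma Cn2_id2 n D : open2 D -> Cn2_on n D (fun _ y => y).
Proof.
  intros o; destruct n as [|n].
  - split; auto; intros; apply continuity_2d_pt_id2.
  - apply Cn2_intro with (fun _ _ => 0) (fun _ _ => 1); auto using Cn2_const.
    intros x y d; split; [apply @is_derive_const | apply @is_derive_id].
Qed.

Lemma Cn2_plus n D f g : open2 D -> Cn2_on n D f -> Cn2_on n D g ->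
  Cn2_on n D (fun x y => f x y + g x y).
Proof.
  intros o; revert f g; induction n as [|n IH]; intros f g Hf Hg.
  - split; auto; intros; apply continuity_2d_pt_plus;
      apply Cn2_continuity with 0%nat D; auto.
  - apply Cn2_intro with (fun x y => dx f x y + dx g x y)
      (fun x y => dy f x y + dy g x y); auto using Cn2_dx, Cn2_dy.
    intros x y d. destruct (Cn2_is_derive _ _ _ _ _ Hf d), (Cn2_is_derive _ _ _ _ _ Hg d).
    split; apply @is_derive_plus; auto.
Qed.

Lemma Cn2_mult n D f g : open2 D -> Cn2_on n D f -> Cn2_on n D g ->
  Cn2_on n D (fun x y => f x y * g x y).
Proof.
  intros o; revert f g; induction n as [|n IH]; intros f g Hf Hg.
  - split; auto; intros; apply continuity_2d_pt_mult;
      apply Cn2_continuity with 0%nat D; auto.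
  - apply Cn2_intro with (fun x y => dx f x y * g x y + f x y * dx g x y)
      (fun x y => dy f x y * g x y + f x y * dy g x y); auto.
    + intros x y d. destruct (Cn2_is_derive _ _ _ _ _ Hf d), (Cn2_is_derive _ _ _ _ _ Hg d).
      split; [apply (is_derive_mult (fun z => f z y) (fun z => g z y)) |
              apply (is_derive_mult (fun z => f x z) (fun z => g x z))]; auto;
      intros; apply Rmult_comm.
    + apply Cn2_plus; auto; apply IH; auto using Cn2_dx, Cn2_pred.
    + apply Cn2_plus; auto; apply IH; auto using Cn2_dy, Cn2_pred.
Qed.

Lemma Cn2_opp n D f : open2 D -> Cn2_on n D f -> Cn2_on n D (fun x y => - f x y).
Proof.
  intros o H. apply Cn2_ext with (fun x y => -1 * f x y); auto.
  - intros; ring.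
  - apply Cn2_mult; auto using Cn2_const.
Qed.

Lemma Cn2_minus n D f g : open2 D -> Cn2_on n D f -> Cn2_on n D g ->
  Cn2_on n D (fun x y => f x y - g x y).
Proof. intros; apply Cn2_plus; auto using Cn2_opp. Qed.

(** The induction runs over all three functions at once: the chain rule expresses the partials by
    compositions of the partials of [f] with the same inner functions, at one order less. *)
Lemma Cn2_comp n D D' f p q :
  open2 D -> open2 D' -> Cn2_on n D' f -> Cn2_on n D p -> Cn2_on n D q ->
  (forall x y, D x y -> D' (p x y) (q x y)) ->
  Cn2_on n D (fun x y => f (p x y) (q x y)).
Proof.
  intros o o'; revert f p q; induction n as [|n IH]; intros f p q Hf Hp Hq H.
  - split; auto. intros x y d.
    assert (Cf := Cn2_continuity _ _ _ _ _ Hf (H x y d)).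
    assert (Cp := Cn2_continuity _ _ _ _ _ Hp d).
    assert (Cq := Cn2_continuity _ _ _ _ _ Hq d).
    rewrite continuity_2d_pt_filterlim in *.
    apply (filterlim_comp_2 (G := locally (p x y)) (H := locally (q x y))
             (fun z => p (fst z) (snd z)) (fun z => q (fst z) (snd z)) f); auto.
    eapply filterlim_filter_le_1; [|exact Cf].
    intros P [e He]. exists (ball (p x y) e) (ball (q x y) e).
    1, 2: apply locally_ball.
    intros u v Hu Hv; apply (He (u, v)); split; auto.
  - apply Cn2_intro with
      (fun x y => dx f (p x y) (q x y) * dx p x y + dy f (p x y) (q x y) * dx q x y)
      (fun x y => dx f (p x y) (q x y) * dy p x y + dy f (p x y) (q x y) * dy q x y);
      auto.
    + intros x y d. destruct (Cn2_is_derive _ _ _ _ _ Hp d), (Cn2_is_derive _ _ _ _ _ Hq d).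
      assert (Df := Cn2_differentiable _ _ _ _ _ o' Hf (H x y d)).
      split; apply is_derive_Reals.
      * apply (derivable_pt_lim_comp_2d f (fun z => p z y) (fun z => q z y)); auto;
          apply is_derive_Reals; auto.
      * apply (derivable_pt_lim_comp_2d f (fun z => p x z) (fun z => q x z)); auto;
          apply is_derive_Reals; auto.
    + apply Cn2_plus; auto; apply Cn2_mult; auto using Cn2_dx;
        apply IH; auto using Cn2_dx, Cn2_dy, Cn2_pred.
    + apply Cn2_plus; auto; apply Cn2_mult; auto using Cn2_dy;
        apply IH; auto using Cn2_dx, Cn2_dy, Cn2_pred.
Qed.

Lemma open2_halfplane (P : R -> Prop) :
  (forall x, P x -> locally x P) -> open2 (fun x _ => P x).
Proof.
  intros H x y d. destruct (H x d) as [e He]. exists e. intros u v Hu Hv.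
  apply He; exact Hu.
Qed.

Lemma locally_neq0 x : x <> 0 -> locally x (fun z => z <> 0).
Proof.
  intros H. assert (h := Rabs_pos_lt _ H). exists (mkposreal _ h).
  intros y By E. rewrite ball_Rabs in By. subst y.
  rewrite Rabs_minus_sym, Rminus_0_r in By. simpl in By. lra.
Qed.

Lemma locally_pos x : 0 < x -> locally x (fun z => 0 < z).
Proof. intros H; apply (open_gt 0 x H). Qed.

(** Reciprocal and square root are treated as functions of two variables that are constant in the
    second, so that [Cn2_comp] yields the general cases. The induction closes because the derivative
    of [/ x] is a polynomial in [/ x]. *)
Lemma Cn2_inv0 n : Cn2_on n (fun x _ => x <> 0) (fun x _ => / x).
Proof.
  assert (o : open2 (fun x _ => x <> 0)) by exact (open2_halfplane _ locally_neq0).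
  induction n as [|n IH].
  - split; auto. intros x y d.
    apply (continuity_2d_pt_inv (fun x _ => x)); auto. apply continuity_2d_pt_id1.
  - apply Cn2_intro with (fun x _ => - (/ x * / x)) (fun _ _ => 0);
      auto using Cn2_const, Cn2_opp, Cn2_mult.
    intros x y d; split; auto_derive; auto; field; auto.
Qed.

Lemma Cn2_sqrt0 n : Cn2_on n (fun x _ => 0 < x) (fun x _ => sqrt x).
Proof.
  assert (o : open2 (fun x _ => 0 < x)) by exact (open2_halfplane _ locally_pos).
  induction n as [|n IH].
  - split; auto. intros x y d.
    apply (continuity_1d_2d_pt_comp sqrt (fun x _ => x)); auto.
    + apply continuity_pt_sqrt; lra.
    + apply continuity_2d_pt_id1.
  - apply Cn2_intro with (fun x _ => / 2 * / sqrt x) (fun _ _ => 0);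
      auto using Cn2_const.
    + intros x y d; split; auto_derive; auto. field.
      assert (h := sqrt_lt_R0 _ d); lra.
    + apply Cn2_mult; auto using Cn2_const.
      apply Cn2_comp with (D' := fun x _ => x <> 0) (f := fun x _ => / x)
        (p := fun x _ => sqrt x) (q := fun _ y => y); auto using Cn2_id2, Cn2_inv0.
      * exact (open2_halfplane _ locally_neq0).
      * intros x y d; assert (h := sqrt_lt_R0 _ d); lra.
Qed.

Lemma Cn2_inv n D f : open2 D -> (forall x y, D x y -> f x y <> 0) ->
  Cn2_on n D f -> Cn2_on n D (fun x y => / f x y).
Proof.
  intros o H Hf.
  apply Cn2_comp with (D' := fun x _ => x <> 0) (f := fun x _ => / x)
        (p := f) (q := fun _ y => y); auto using Cn2_id2, Cn2_inv0.
  exact (open2_halfplane _ locally_neq0).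
Qed.

Lemma Cn2_sqrt n D f : open2 D -> (forall x y, D x y -> 0 < f x y) ->
  Cn2_on n D f -> Cn2_on n D (fun x y => sqrt (f x y)).
Proof.
  intros o H Hf.
  apply Cn2_comp with (D' := fun x _ => 0 < x) (f := fun x _ => sqrt x)
        (p := f) (q := fun _ y => y); auto using Cn2_id2, Cn2_sqrt0.
  exact (open2_halfplane _ locally_pos).
Qed.

Lemma Cn2_div n D f g : open2 D -> (forall x y, D x y -> g x y <> 0) ->
  Cn2_on n D f -> Cn2_on n D g -> Cn2_on n D (fun x y => f x y / g x y).
Proof. intros; apply Cn2_mult; auto using Cn2_inv. Qed.

Lemma Cn2_pow n D f k : open2 D -> Cn2_on n D f -> Cn2_on n D (fun x y => f x y ^ k).
Proof.
  intros o H; induction k as [|k IH]; simpl; auto using Cn2_const, Cn2_mult.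
Qed.

Ltac Cn2_arith :=
  repeat first [ assumption | apply Cn2_minus | apply Cn2_plus | apply Cn2_opp
               | apply Cn2_mult | apply Cn2_pow | apply Cn2_const ]; auto.

(** * Smooth functions of one variable *)

Lemma locally_open_interval (a b : Rbar) (t : R) :
  Rbar_lt a t -> Rbar_lt t b -> locally t (fun x : R => Rbar_lt a x /\ Rbar_lt x b).
Proof.
  intros Ha Hb. apply filter_and; [apply (open_Rbar_gt a t Ha) | apply (open_Rbar_lt b t Hb)].
Qed.

(** A function of one variable on an interval is viewed as a function of two variables that is
    constant in the first; the calculus of [Cn2_on] then also covers [smooth_on]. *)
Definition strip (a b : Rbar) : R -> R -> Prop := fun _ t => Rbar_lt a t /\ Rbar_lt t b.

Lemma open2_strip a b : open2 (strip a b).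
Proof.
  intros x y [Ha Hb]. destruct (locally_open_interval a b y Ha Hb) as [e He].
  exists e. intros u v Hu Hv. apply He; exact Hv.
Qed.

Lemma smooth_on_Derive a b f : smooth_on a b f -> smooth_on a b (Derive f).
Proof.
  intros H n t Ha Hb. assert (h := H (S n) t Ha Hb).
  destruct n as [|n]; simpl; auto.
  simpl in h. apply ex_derive_ext with (Derive_n f (S n)); auto.
  intros s. transitivity (Derive_n f (n + 1) s).
  - now rewrite Nat.add_1_r.
  - symmetry; exact (Derive_n_comp f n 1 s).
Qed.

Lemma smooth_on_is_derive (a b : Rbar) f (t : R) :
  smooth_on a b f -> Rbar_lt a t -> Rbar_lt t b -> is_derive f t (Derive f t).
Proof. intros H Ha Hb; apply Derive_correct; apply (H 1%nat t Ha Hb). Qed.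

Lemma smooth_on_Cn2_y a b f n : smooth_on a b f -> Cn2_on n (strip a b) (fun _ t => f t).
Proof.
  revert f; induction n as [|n IH]; intros f H.
  - split; auto. intros x y [Ha Hb].
    apply (continuity_1d_2d_pt_comp f (fun _ v => v)); [|apply continuity_2d_pt_id2].
    apply continuity_pt_filterlim.
    apply (ex_derive_continuous f). exists (Derive f y); apply smooth_on_is_derive with a b; auto.
  - apply Cn2_intro with (fun _ _ => 0) (fun _ t => Derive f t);
      auto using Cn2_const, open2_strip, smooth_on_Derive.
    intros x y [Ha Hb]; split; [apply @is_derive_const|].
    apply smooth_on_is_derive with a b; auto.
Qed.

Lemma Cn2_smooth_on (a b : Rbar) f :
  (forall n, Cn2_on n (strip a b) (fun _ t => f t)) -> smooth_on a b f.
Proof.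
  intros H n t Ha Hb.
  assert (K : forall k m, Cn2_on m (strip a b) (fun _ t => Derive_n f k t)).
  { induction k as [|k IH]; intros m; [exact (H m)|].
    exact (Cn2_dy m (strip a b) (fun _ t => Derive_n f k t) (IH (S m))). }
  destruct n as [|n]; [exact I|].
  destruct (Cn2_is_derive 0 _ (fun _ t => Derive_n f n t) 0 t (K n 1%nat) (conj Ha Hb))
    as [_ h].
  eexists; exact h.
Qed.

Lemma smooth2_const D c : open2 D -> smooth2_on D (fun _ _ => c).
Proof. intros o n; auto using Cn2_const. Qed.

Lemma smooth_comp2 D a b f p : open2 D -> smooth_on a b f -> smooth2_on D p ->
  (forall x y, D x y -> Rbar_lt a (p x y) /\ Rbar_lt (p x y) b) ->
  smooth2_on D (fun x y => f (p x y)).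
Proof.
  intros o H Hp HD n.
  apply Cn2_comp with (D' := strip a b) (f := fun _ t => f t) (p := fun _ _ => 0) (q := p);
    auto using open2_strip, smooth_on_Cn2_y, Cn2_const.
Qed.

Lemma smooth_comp D f p : open2 D -> smooth f -> smooth2_on D p ->
  smooth2_on D (fun x y => f (p x y)).
Proof. intros; apply smooth_comp2 with m_infty p_infty; simpl; auto. Qed.

Lemma smooth_on_subset (a b a' b' : Rbar) f :
  Rbar_le a a' -> Rbar_le b' b -> smooth_on a b f -> smooth_on a' b' f.
Proof.
  intros Ha Hb H n t Ha' Hb'. apply H.
  - eapply Rbar_le_lt_trans; eauto.
  - eapply Rbar_lt_le_trans; eauto.
Qed.

Lemma smooth_is_derive f t : smooth f -> is_derive f t (Derive f t).
Proof. intros H; apply smooth_on_is_derive with m_infty p_infty; simpl; auto. Qed.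

Lemma smooth2_slice D a b f e :
  open2 D -> smooth2_on D f -> (forall t, strip a b e t -> D e t) ->
  smooth_on a b (fun t => f e t).
Proof.
  intros o H HD. apply Cn2_smooth_on. intros n.
  apply Cn2_comp with (D' := D) (f := f) (p := fun _ _ => e) (q := fun _ t => t);
    auto using open2_strip, Cn2_const, Cn2_id2.
Qed.

Lemma smooth_on_ext (a b : Rbar) f g : (forall t : R, Rbar_lt a t -> Rbar_lt t b -> f t = g t) ->
  smooth_on a b f -> smooth_on a b g.
Proof.
  intros e H. apply Cn2_smooth_on. intros n.
  apply Cn2_ext with (fun _ t => f t); auto using open2_strip, smooth_on_Cn2_y.
  intros x y [Ha Hb]; auto.
Qed.

(** * Inverse functions depending on a parameter *)

Lemma derive_pos_lt f df a b :
  a < b -> (forall x, a <= x <= b -> is_derive f x (df x)) ->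
  (forall x, a <= x <= b -> 0 < df x) -> f a < f b.
Proof.
  intros ab H P.
  destruct (MVT_gen f a b df) as [c [Hc E]]; rewrite ?Rmin_left, ?Rmax_right in * by lra.
  - intros x Hx; apply H; lra.
  - intros x Hx. apply continuity_pt_filterlim.
    apply (ex_derive_continuous f). exists (df x); apply H; lra.
  - assert (h := P c Hc). nra.
Qed.

(** The derivative in the implicit function theorem, for a [psi] already known to be continuous.
    Differentiability gives [a h + b w = o(|h| + |w|)] for the increment [w] of [psi]; this first
    forces [w = O(h)], and then [w / h] tends to [- a / b]. *)
Lemma implicit_derive (Phi : R -> R -> R) (psi : R -> R) s0 a b :
  differentiable_pt_lim Phi s0 (psi s0) a b -> b <> 0 -> continuous psi s0 ->
  locally s0 (fun s => Phi s (psi s) = 0) -> is_derive psi s0 (- a / b).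
Proof.
  intros HD Hb Hc [d0 Hz]. apply is_derive_Reals. intros eps Heps.
  assert (Bp := Rabs_pos_lt _ Hb).
  (* [K] bounds [|w| / |h|]: once the relative error [et] is at most [|b| / 2], the term in [|w|]
     can be absorbed on the left. The second bound on [et] leaves a final error of at most half of
     [eps]. *)
  set (K := 2 * (Rabs a + Rabs b) / Rabs b).
  assert (Kp : 0 <= K).
  { apply Rmult_le_pos; [assert (h := Rabs_pos a); lra | left; apply Rinv_0_lt_compat; auto]. }
  set (et := Rmin (Rabs b / 2) (eps * Rabs b / (2 * (1 + K)))).
  assert (Hc2 : 0 < eps * Rabs b / (2 * (1 + K))).
  { apply Rdiv_lt_0_compat; nra. }
  assert (Het : 0 < et) by (apply Rmin_glb_lt; lra).
  assert (E1 : et <= Rabs b / 2) by apply Rmin_l.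
  assert (E2 : et * (2 * (1 + K)) <= eps * Rabs b).
  { assert (h : et <= eps * Rabs b / (2 * (1 + K))) by apply Rmin_r.
    apply Rmult_le_compat_r with (r := 2 * (1 + K)) in h; [|lra].
    field_simplify in h; lra. }
  destruct (HD (mkposreal et Het)) as [d1 Hd1]; simpl in Hd1.
  destruct (proj1 (filterlim_locally psi (psi s0)) Hc d1) as [d2 Hd2].
  assert (Hd : 0 < Rmin d0 (Rmin d1 d2)).
  { repeat apply Rmin_glb_lt; apply cond_pos. }
  exists (mkposreal _ Hd). simpl. intros h Hh Hlt.
  assert (L0 := Rmin_l d0 (Rmin d1 d2)). assert (L1 := Rmin_r d0 (Rmin d1 d2)).
  assert (L2 := Rmin_l d1 d2). assert (L3 := Rmin_r d1 d2).
  assert (Bh : forall d : posreal, Rabs h < d -> ball s0 d (s0 + h)).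
  { intros d k. rewrite ball_Rabs. now replace (s0 + h - s0) with h by ring. }
  assert (Z1 := Hz (s0 + h) (Bh d0 ltac:(lra))).
  assert (Z0 := locally_singleton _ _ (ex_intro _ d0 Hz)). simpl in Z0.
  assert (C := Hd2 (s0 + h) (Bh d2 ltac:(lra))).
  rewrite ball_Rabs in C. set (w := psi (s0 + h) - psi s0) in *.
  assert (M : Rabs (a * h + b * w) <= et * Rmax (Rabs h) (Rabs w)).
  { assert (m := Hd1 (s0 + h) (psi (s0 + h))).
    replace (s0 + h - s0) with h in m by ring. fold w in m.
    rewrite Z1, Z0 in m.
    rewrite <- Rabs_Ropp. replace (- (a * h + b * w)) with (0 - 0 - (a * h + b * w)) by ring.
    apply m; [lra | exact C]. }
  assert (hp := Rabs_pos_lt _ Hh). assert (wp := Rabs_pos w). assert (ap := Rabs_pos a).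
  assert (M2 : Rmax (Rabs h) (Rabs w) <= Rabs h + Rabs w) by (apply Rmax_lub; lra).
  assert (W : Rabs w <= K * Rabs h).
  { assert (T : Rabs b * Rabs w <= Rabs a * Rabs h + Rabs (a * h + b * w)).
    { rewrite <- !Rabs_mult. replace (b * w) with (- (a * h) + (a * h + b * w)) at 1 by ring.
      eapply Rle_trans; [apply Rabs_triang|]. rewrite Rabs_Ropp; lra. }
    assert (T2 : Rabs b * Rabs w <= 2 * (Rabs a + Rabs b) * Rabs h) by nra.
    unfold K. apply Rmult_le_reg_l with (Rabs b); auto. field_simplify; lra. }
  replace (w / h - - a / b) with ((a * h + b * w) / (b * h)) by (field; auto).
  unfold Rdiv; rewrite Rabs_mult, Rabs_inv, Rabs_mult.
  apply Rmult_lt_reg_r with (Rabs b * Rabs h); [nra|].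
  rewrite Rmult_assoc, Rinv_l, Rmult_1_r by nra.
  assert (T3 : et * Rmax (Rabs h) (Rabs w) <= et * ((1 + K) * Rabs h)) by (apply Rmult_le_compat_l; nra).
  assert (T4 : et * (2 * (1 + K)) * Rabs h <= eps * Rabs b * Rabs h) by (apply Rmult_le_compat_r; lra).
  assert (0 < eps * Rabs b * Rabs h) by (apply Rmult_lt_0_compat; nra).
  nra.
Qed.

(** [phi e] increases on each fibre of [D], which is an interval. Continuity of [psi] comes from
    trapping it between two values, its derivatives from [implicit_derive], and higher smoothness by
    induction, since these derivatives contain only partials of [phi] composed with [psi]. *)
Lemma smooth_inverse (D D' : R -> R -> Prop) (phi psi : R -> R -> R) :
  open2 D -> open2 D' ->
  (forall e t1 t t2, D e t1 -> D e t2 -> t1 <= t <= t2 -> D e t) ->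
  smooth2_on D phi ->
  (forall e t, D e t -> 0 < dy phi e t) ->
  (forall e x, D' e x -> D e (psi e x) /\ phi e (psi e x) = x) ->
  smooth2_on D' psi /\
  forall e x, D' e x -> is_derive (fun z => psi z x) e (- dx phi e (psi e x) / dy phi e (psi e x)) /\
    is_derive (fun z => psi e z) x (/ dy phi e (psi e x)).
Proof.
  intros o o' Hs Hphi Hpos Hpsi.
  assert (Mono : forall e t1 t2, D e t1 -> D e t2 -> t1 < t2 -> phi e t1 < phi e t2).
  { intros e t1 t2 d1 d2 lt.
    apply derive_pos_lt with (fun t => dy phi e t); auto; intros x Hx.
    - apply (Cn2_is_derive 0 D); eauto.
    - eauto. }
  assert (C0 : forall e x, D' e x -> continuity_2d_pt psi e x).
  { intros e0 x0 d0 eps. destruct (Hpsi e0 x0 d0) as [d E]. set (t0 := psi e0 x0) in *.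
    destruct (o e0 t0 d) as [dl Hdl].
    set (h := Rmin (eps / 2) (dl / 2)).
    assert (hp : 0 < h) by (apply Rmin_glb_lt; [assert (k := cond_pos eps) | assert (k := cond_pos dl)]; lra).
    assert (h1 : h <= eps / 2) by apply Rmin_l. assert (h2 : h <= dl / 2) by apply Rmin_r.
    assert (k1 := cond_pos eps). assert (k2 := cond_pos dl).
    assert (da : D e0 (t0 - h)).
    { apply Hdl; [rewrite Rminus_diag, Rabs_R0; lra|].
      replace (t0 - h - t0) with (- h) by ring; rewrite Rabs_Ropp, Rabs_pos_eq; lra. }
    assert (db : D e0 (t0 + h)).
    { apply Hdl; [rewrite Rminus_diag, Rabs_R0; lra|].
      replace (t0 + h - t0) with h by ring; rewrite Rabs_pos_eq; lra. }
    assert (ma := Mono _ _ _ da d ltac:(lra)). assert (mb := Mono _ _ _ d db ltac:(lra)).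
    rewrite E in ma, mb.
    (* Half of the smaller gap: when [e] and [x] are close, [phi e (t0 - h)], [phi e (t0 + h)] and
       [x] each move by less than [g], so [x] stays between the two values. *)
    set (g := Rmin (x0 - phi e0 (t0 - h)) (phi e0 (t0 + h) - x0) / 2).
    assert (g1 : g <= (x0 - phi e0 (t0 - h)) / 2)
      by (unfold g; assert (k := Rmin_l (x0 - phi e0 (t0 - h)) (phi e0 (t0 + h) - x0)); lra).
    assert (g2 : g <= (phi e0 (t0 + h) - x0) / 2)
      by (unfold g; assert (k := Rmin_r (x0 - phi e0 (t0 - h)) (phi e0 (t0 + h) - x0)); lra).
    assert (gp : 0 < g) by (unfold g; apply Rdiv_lt_0_compat; [apply Rmin_glb_lt|]; lra).
    destruct (Cn2_continuity _ _ _ _ _ (Hphi 0%nat) da (mkposreal g gp)) as [ea Ha].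
    destruct (Cn2_continuity _ _ _ _ _ (Hphi 0%nat) db (mkposreal g gp)) as [eb Hb].
    destruct (o' e0 x0 d0) as [e' He']. simpl in Ha, Hb.
    destruct (o e0 (t0 - h) da) as [fa Hfa]. destruct (o e0 (t0 + h) db) as [fb Hfb].
    assert (rp : 0 < Rmin (Rmin ea eb) (Rmin (Rmin e' g) (Rmin fa fb))).
    { repeat apply Rmin_glb_lt; auto; apply cond_pos. }
    exists (mkposreal _ rp). simpl. intros e x He Hx.
    assert (Rabs (e - e0) < ea /\ Rabs (e - e0) < eb /\ Rabs (e - e0) < e' /\
            Rabs (x - x0) < e' /\ Rabs (x - x0) < g /\ Rabs (e - e0) < fa /\
            Rabs (e - e0) < fb) as (q1 & q2 & q3 & q4 & q5 & q6 & q7).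
    { repeat match goal with
        K : _ < Rmin _ _ |- _ => apply Rmin_Rgt_l in K; destruct K; unfold Rgt in * end.
      repeat split; assumption. }
    assert (D1 : D' e x) by auto. destruct (Hpsi e x D1) as [d1 E1].
    assert (V : forall y, Rabs (y - y) = 0) by (intros; rewrite Rminus_diag; apply Rabs_R0).
    assert (A1 := Ha e (t0 - h) q1 ltac:(rewrite V; apply cond_pos)).
    assert (B1 := Hb e (t0 + h) q2 ltac:(rewrite V; apply cond_pos)).
    assert (D2 : D e (t0 - h)) by (apply Hfa; auto; rewrite V; apply cond_pos).
    assert (D3 : D e (t0 + h)) by (apply Hfb; auto; rewrite V; apply cond_pos).
    apply Rabs_def2 in A1, B1, q5.
    apply Rabs_def1.
    - destruct (Rlt_le_dec (psi e x) (t0 + h)); [lra|].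
      assert (phi e (t0 + h) <= phi e (psi e x)).
      { destruct r; [left; apply Mono; auto | right; now f_equal]. } lra.
    - destruct (Rlt_le_dec (t0 - h) (psi e x)); [lra|].
      assert (phi e (psi e x) <= phi e (t0 - h)).
      { destruct r; [left; apply Mono; auto | right; now f_equal]. } lra. }
  assert (Der : forall e x, D' e x ->
    is_derive (fun z => psi z x) e (- dx phi e (psi e x) / dy phi e (psi e x)) /\
    is_derive (fun z => psi e z) x (/ dy phi e (psi e x))).
  { intros e x d. destruct (Hpsi e x d) as [d1 E].
    assert (p := Hpos _ _ d1).
    assert (DP := Cn2_differentiable 0 D phi e (psi e x) o (Hphi 1%nat) d1).
    assert (C := C0 _ _ d). rewrite continuity_2d_pt_filterlim in C. split.
    - apply (implicit_derive (fun s t => phi s t - x) (fun z => psi z x)); auto.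
      + apply filterdiff_differentiable_pt_lim. apply filterdiff_differentiable_pt_lim in DP.
        eapply filterdiff_ext_lin; [apply (filterdiff_minus_fct (fun u : R * R => phi (fst u) (snd u)) (fun _ => x)); [exact DP | apply filterdiff_const]|].
        intros [u v]; simpl. unfold minus, plus, opp, zero; simpl. ring.
      + lra.
      + apply (continuous_comp_2 (fun z => z) (fun _ => x) psi); auto.
        apply continuous_id. apply continuous_const.
      + generalize (open2_locally_x _ _ _ o' d); apply filter_imp.
        intros s h. destruct (Hpsi s x h); lra.
    - replace (/ dy phi e (psi e x)) with (- - 1 / dy phi e (psi e x)) by (field; lra).
      apply (implicit_derive (fun s t => phi e t - s) (fun z => psi e z)); auto.
      + apply (partials_differentiable (fun _ t => D e t) (fun s t => phi e t - s)
                 (fun _ _ => - 1) (fun _ t => dy phi e t)); auto.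
        * intros s t dt. destruct (open2_locally_y _ _ _ o dt) as [h Hh].
          exists h; intros u v _ Hv; apply Hh; exact Hv.
        * intros s t dt. split; [auto_derive; auto; ring|].
          replace (dy phi e t) with (dy phi e t - 0) by ring.
          apply (is_derive_minus (fun z => phi e z) (fun _ => s)); [|apply @is_derive_const].
          apply (Cn2_is_derive 0 D phi e t (Hphi 1%nat) dt).
        * intros; apply continuity_2d_pt_const.
      + lra.
      + apply (continuous_comp_2 (fun _ => e) (fun z => z) psi); auto.
        apply continuous_const. apply continuous_id. 
      + generalize (open2_locally_y _ _ _ o' d); apply filter_imp.
        intros s h. destruct (Hpsi e s h); lra. }
  split; [|exact Der].
  intros n; induction n as [|n IH].
  - split; auto.
  - assert (Cx : Cn2_on n D' (fun e x => dx phi e (psi e x))).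
    { apply Cn2_comp with (D' := D) (f := dx phi) (p := fun e _ => e); auto using Cn2_id1, Cn2_dx.
      intros; apply Hpsi; auto. }
    assert (Cy : Cn2_on n D' (fun e x => dy phi e (psi e x))).
    { apply Cn2_comp with (D' := D) (f := dy phi) (p := fun e _ => e); auto using Cn2_id1, Cn2_dy.
      intros; apply Hpsi; auto. }
    assert (N : forall x y, D' x y -> dy phi x (psi x y) <> 0).
    { intros x y d; apply Rgt_not_eq, Hpos, Hpsi; auto. }
    eapply Cn2_intro; [auto | exact Der | |].
    + apply Cn2_div; auto. apply Cn2_opp; auto.
    + apply Cn2_inv; auto.
Qed.

Lemma smooth_inverse1 (a b c d : Rbar) (phi psi : R -> R) :
  smooth_on a b phi ->
  (forall t : R, Rbar_lt a t -> Rbar_lt t b -> 0 < Derive phi t) ->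
  (forall x : R, Rbar_lt c x -> Rbar_lt x d ->
     Rbar_lt a (psi x) /\ Rbar_lt (psi x) b /\ phi (psi x) = x) ->
  smooth_on c d psi /\
  forall x : R, Rbar_lt c x -> Rbar_lt x d -> is_derive psi x (/ Derive phi (psi x)).
Proof.
  intros Hphi Hpos Hpsi.
  destruct (smooth_inverse (strip a b) (strip c d) (fun _ t => phi t) (fun _ x => psi x))
    as [S DS]; auto using open2_strip.
  - intros e t1 t t2 [h1 _] [_ h2] [l1 l2]; split.
    + exact (Rbar_lt_le_trans a t1 t h1 l1).
    + exact (Rbar_le_lt_trans t t2 b l2 h2).
  - intros n; apply smooth_on_Cn2_y, Hphi.
  - intros e t [h1 h2]; apply Hpos; auto.
  - intros e x [h1 h2]. unfold strip; destruct (Hpsi x h1 h2) as (? & ? & ?); auto.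
  - split.
    + apply Cn2_smooth_on, S.
    + intros x h1 h2. apply (DS 0 x (conj h1 h2)).
Qed.

Ltac smooth_arith :=
  apply Cn2_smooth_on; intros ?;
  repeat first [ apply Cn2_minus | apply Cn2_plus | apply Cn2_opp | apply Cn2_mult
               | apply Cn2_const | apply Cn2_id2 | apply smooth_on_Cn2_y ];
  auto using open2_strip.

Lemma smooth_RInt f a : smooth f -> smooth (RInt f a) /\ forall x, is_derive (RInt f a) x (f x).
Proof.
  intros H.
  assert (C : forall x, continuous f x).
  { intros x; apply (ex_derive_continuous f). exists (Derive f x); now apply smooth_is_derive. }
  assert (E : forall x, is_derive (RInt f a) x (f x)).
  { intros x. apply (is_derive_RInt f (RInt f a) a x); auto.
    exists (mkposreal 1 Rlt_0_1). intros y _.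
    apply (RInt_correct f a y), (ex_RInt_continuous f); auto. }
  split; auto.
  apply Cn2_smooth_on. intros [|n].
  - split; auto. intros x y _.
    apply (continuity_1d_2d_pt_comp (RInt f a) (fun _ v => v)); [|apply continuity_2d_pt_id2].
    apply continuity_pt_filterlim, (ex_derive_continuous (RInt f a)). exists (f y); auto.
  - apply Cn2_intro with (fun _ _ => 0) (fun _ t => f t);
      auto using open2_strip, Cn2_const, smooth_on_Cn2_y.
    intros x y _; split; [apply @is_derive_const | apply E].
Qed.

(** * Finsler metrics that do not depend on theta *)

Definition rotational (F : R -> R -> R -> R) : metric := fun r _ u v => F r u v.

(* [Fr], [Fu], [Fv] are the partial derivatives of F away from the zero
   section. *)
Record regular (F Fr Fu Fv : R -> R -> R -> R) : Prop := {
  reg_chain : forall (r u v : R -> R) t r' u' v',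
    is_derive r t r' -> is_derive u t u' -> is_derive v t v' ->
    (u t, v t) <> (0, 0) ->
    is_derive (fun t => F (r t) (u t) (v t)) t
      (Fr (r t) (u t) (v t) * r' + Fu (r t) (u t) (v t) * u' + Fv (r t) (u t) (v t) * v');
  reg_zero : forall r, F r 0 0 = 0;
  reg_pos : forall r u v, (u, v) <> (0, 0) -> 0 < F r u v;
  reg_homog : forall k r u v, 0 < k -> F r (k * u) (k * v) = k * F r u v;
  reg_homog_r : forall k r u v, 0 < k -> Fr r (k * u) (k * v) = k * Fr r u v;
  reg_homog_u : forall k r u v, 0 < k -> Fu r (k * u) (k * v) = Fu r u v;
  reg_homog_v : forall k r u v, 0 < k -> Fv r (k * u) (k * v) = Fv r u v;
  reg_euler : forall r u v, (u, v) <> (0, 0) ->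
    u * Fu r u v + v * Fv r u v = F r u v;
  reg_smooth : forall D r u v, open2 D -> smooth2_on D r -> smooth2_on D u ->
    smooth2_on D v -> (forall x y, D x y -> (u x y, v x y) <> (0, 0)) ->
    smooth2_on D (fun x y => F (r x y) (u x y) (v x y)) }.

Arguments reg_chain {F Fr Fu Fv} _.
Arguments reg_zero {F Fr Fu Fv} _.
Arguments reg_pos {F Fr Fu Fv} _.
Arguments reg_homog {F Fr Fu Fv} _.
Arguments reg_homog_r {F Fr Fu Fv} _.
Arguments reg_homog_u {F Fr Fu Fv} _.
Arguments reg_homog_v {F Fr Fu Fv} _.
Arguments reg_euler {F Fr Fu Fv} _.
Arguments reg_smooth {F Fr Fu Fv} _.

Lemma pair_neq0 (u v : R) : (u, v) <> (0, 0) -> 0 < u ^ 2 + v ^ 2.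
Proof.
  intros H. destruct (Req_dec u 0) as [->|hu]; [destruct (Req_dec v 0) as [->|hv]|].
  - now elim H.
  - assert (0 < v ^ 2) by (apply pow2_gt_0; auto). nra.
  - assert (0 < u ^ 2) by (apply pow2_gt_0; auto). nra.
Qed.

(** Positivity is the one property that an added one-form can destroy, so it is assumed for the
    sum. *)
Lemma regular_plus_exact F Fr Fu Fv h :
  regular F Fr Fu Fv -> smooth h ->
  (forall r u v, (u, v) <> (0, 0) -> 0 < F r u v + Derive h r * u) ->
  regular (fun r u v => F r u v + Derive h r * u)
    (fun r u v => Fr r u v + Derive (Derive h) r * u)
    (fun r u v => Fu r u v + Derive h r) Fv.
Proof.
  intros H Hh P. assert (Hh' := smooth_on_Derive _ _ _ Hh).
  constructor; intros.
  - evar_last.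
    + apply @is_derive_plus.
      * apply H; eassumption.
      * apply (is_derive_mult (fun t => Derive h (r t)) u); [| eassumption | intros; apply Rmult_comm].
        apply (is_derive_comp (Derive h) r); [apply smooth_is_derive, Hh'|eassumption].
    + unfold plus, mult, scal; simpl; unfold mult; simpl. ring.
  - rewrite (reg_zero H). ring.
  - auto.
  - rewrite (reg_homog H) by auto. ring.
  - rewrite (reg_homog_r H) by auto. ring.
  - rewrite (reg_homog_u H) by auto. ring.
  - rewrite (reg_homog_v H) by auto. ring.
  - rewrite <- (reg_euler H) by auto. ring.
  - intros n. apply Cn2_plus; auto.
    + apply (reg_smooth H D); auto.
    + apply Cn2_mult; auto. apply (smooth_comp D (Derive h) r); auto.
Qed.

(** * The navigation metric *)

Record navigation (m A : R -> R) (B : R) : Prop := {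
  nav_m : smooth m;
  nav_m_pos : forall r, 0 < m r;
  nav_A : smooth A;
  nav_mild : forall r, A r ^ 2 + B ^ 2 * m r ^ 2 < 1 }.

Arguments nav_m {m A B} _.
Arguments nav_m_pos {m A B} _.
Arguments nav_A {m A B} _.
Arguments nav_mild {m A B} _.

(** Coefficients of the navigation problem at [y = (u, v)]: with [lam = 1 - |W|^2] and
    [wdot = h(W, y)], squaring [|y - N W| = N] gives [lam N^2 + 2 wdot N - |y|^2 = 0]. [zroot] is
    the square root of a quarter of the discriminant, and [zermelo] is the positive root. *)
Definition lam (m A : R -> R) (B r : R) : R := 1 - (A r ^ 2 + B ^ 2 * m r ^ 2).
Definition wdot (m A : R -> R) (B r u v : R) : R := A r * u + B * m r ^ 2 * v.
Definition zroot (m A : R -> R) (B r u v : R) : R :=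
  sqrt (lam m A B r * (u ^ 2 + m r ^ 2 * v ^ 2) + wdot m A B r u v ^ 2).

Definition zermelo (m A : R -> R) (B r u v : R) : R :=
  (zroot m A B r u v - wdot m A B r u v) / lam m A B r.
(** Partial derivatives of [N = zermelo], found by differentiating [|y - N W|^2 = N^2]. The common
    denominator [N + h(W, y - N W)] is [zroot], by [zroot_inner]. *)
Definition zermelo_u (m A : R -> R) (B r u v : R) : R :=
  (u - zermelo m A B r u v * A r) / zroot m A B r u v.
Definition zermelo_v (m A : R -> R) (B r u v : R) : R :=
  m r ^ 2 * (v - zermelo m A B r u v * B) / zroot m A B r u v.
Definition zermelo_r (m A : R -> R) (B r u v : R) : R :=
  (m r * Derive m r * (v - zermelo m A B r u v * B) ^ 2
   - zermelo m A B r u v * Derive A r * (u - zermelo m A B r u v * A r))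
  / zroot m A B r u v.

Section Zermelo.
Context (m A : R -> R) (B : R) (W : navigation m A B).

Lemma lam_pos r : 0 < lam m A B r.
Proof. assert (h := nav_mild W r). unfold lam; lra. Qed.

Lemma warped_pos r u v : (u, v) <> (0, 0) -> 0 < u ^ 2 + m r ^ 2 * v ^ 2.
Proof.
  intros H. apply pair_neq0 in H. assert (h := nav_m_pos W r).
  destruct (Req_dec v 0) as [->|hv]; [nra|].
  assert (0 < v ^ 2) by (apply pow2_gt_0; auto). assert (0 < m r ^ 2) by nra.
  assert (0 <= u ^ 2) by apply pow2_ge_0. nra.
Qed.

Lemma zroot_sqr r u v : zroot m A B r u v ^ 2 =
  lam m A B r * (u ^ 2 + m r ^ 2 * v ^ 2) + wdot m A B r u v ^ 2.
Proof.
  unfold zroot. rewrite pow2_sqrt; auto. assert (h := lam_pos r).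
  assert (0 <= u ^ 2) by apply pow2_ge_0. assert (0 <= (m r * v) ^ 2) by apply pow2_ge_0.
  assert (0 <= wdot m A B r u v ^ 2) by apply pow2_ge_0. nra.
Qed.

Lemma zroot_arg_pos r u v : (u, v) <> (0, 0) ->
  0 < lam m A B r * (u ^ 2 + m r ^ 2 * v ^ 2) + wdot m A B r u v ^ 2.
Proof.
  intros H. apply (warped_pos r) in H. assert (h := lam_pos r).
  assert (0 <= wdot m A B r u v ^ 2) by apply pow2_ge_0. nra.
Qed.

Lemma zroot_pos r u v : (u, v) <> (0, 0) -> 0 < zroot m A B r u v.
Proof. intros H. apply sqrt_lt_R0, zroot_arg_pos, H. Qed.

Lemma zroot_zermelo r u v :
  zroot m A B r u v = lam m A B r * zermelo m A B r u v + wdot m A B r u v.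
Proof. assert (h := lam_pos r). unfold zermelo; field; lra. Qed.

Lemma zermelo_navigation r u v :
  (u - zermelo m A B r u v * A r) ^ 2 + m r ^ 2 * (v - zermelo m A B r u v * B) ^ 2
  = zermelo m A B r u v ^ 2.
Proof.
  assert (h := lam_pos r). assert (s := zroot_sqr r u v). assert (z := zroot_zermelo r u v).
  rewrite z in s. set (N := zermelo m A B r u v) in *.
  apply Rmult_eq_reg_l with (lam m A B r); [|lra].
  unfold lam, wdot in *. lra.
Qed.

Lemma zroot_inner r u v : zroot m A B r u v = zermelo m A B r u v
  + A r * (u - zermelo m A B r u v * A r) + B * m r ^ 2 * (v - zermelo m A B r u v * B).
Proof. rewrite zroot_zermelo. unfold lam, wdot. ring. Qed.

Lemma zermelo_pos r u v : (u, v) <> (0, 0) -> 0 < zermelo m A B r u v.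
Proof.
  intros H. assert (h := lam_pos r). assert (s := zroot_sqr r u v).
  assert (p := zroot_pos r u v H). assert (q := warped_pos r u v H).
  apply Rdiv_lt_0_compat; auto.
  apply Rlt_0_minus. apply Rnot_le_lt. intros c. nra.
Qed.

Lemma zroot_homog k r u v : 0 < k ->
  zroot m A B r (k * u) (k * v) = k * zroot m A B r u v.
Proof.
  intros H. unfold zroot.
  replace (lam m A B r * ((k * u) ^ 2 + m r ^ 2 * (k * v) ^ 2) + wdot m A B r (k * u) (k * v) ^ 2)
    with (k ^ 2 * (lam m A B r * (u ^ 2 + m r ^ 2 * v ^ 2) + wdot m A B r u v ^ 2))
    by (unfold wdot; ring).
  rewrite sqrt_mult_alt by apply pow2_ge_0. rewrite sqrt_pow2; lra.
Qed.

Lemma zermelo_homog k r u v : 0 < k ->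
  zermelo m A B r (k * u) (k * v) = k * zermelo m A B r u v.
Proof.
  intros H. unfold zermelo. rewrite zroot_homog by auto.
  assert (h := lam_pos r). unfold wdot; field; lra.
Qed.

(** The expression equals [w + h(W, n)] with [n = y - w W] of length at most [w], which is positive
    by Cauchy-Schwarz since [|W| < 1]. This sign selects the right root of the quadratic
    equation. *)
Lemma zroot_le_pos r u v w : 0 < w ->
  (u - w * A r) ^ 2 + m r ^ 2 * (v - w * B) ^ 2 <= w ^ 2 -> 0 < lam m A B r * w + wdot m A B r u v.
Proof.
  intros P E.
  replace (lam m A B r * w + wdot m A B r u v)
    with (w + (A r * (u - w * A r) + B * m r ^ 2 * (v - w * B))) by (unfold lam, wdot; ring).
  set (n1 := u - w * A r) in *. set (n2 := v - w * B) in *.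
  assert (CS : (A r * n1 + B * m r ^ 2 * n2) ^ 2
     <= (A r ^ 2 + B ^ 2 * m r ^ 2) * (n1 ^ 2 + m r ^ 2 * n2 ^ 2)).
  { assert (0 <= (m r * (A r * n2 - B * n1)) ^ 2) by apply pow2_ge_0. nra. }
  assert (k := nav_mild W r).
  assert (0 <= A r ^ 2) by apply pow2_ge_0. assert (0 <= (B * m r) ^ 2) by apply pow2_ge_0.
  assert (0 < w ^ 2) by (apply pow_lt; auto).
  assert (CS2 : (A r * n1 + B * m r ^ 2 * n2) ^ 2 < w ^ 2).
  { apply Rle_lt_trans with ((A r ^ 2 + B ^ 2 * m r ^ 2) * w ^ 2); [|nra].
    eapply Rle_trans; [exact CS|]. apply Rmult_le_compat_l; auto. nra. }
  nra.
Qed.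

(** Completing the square turns a comparison of [w] with [zermelo] into a comparison of [w] with the
    length of [y - w W]. *)
Lemma zermelo_square_gap r u v w :
  (lam m A B r * w + wdot m A B r u v) ^ 2 - zroot m A B r u v ^ 2
  = lam m A B r * (w ^ 2 - ((u - w * A r) ^ 2 + m r ^ 2 * (v - w * B) ^ 2)).
Proof. rewrite zroot_sqr. unfold lam, wdot. ring. Qed.

Lemma zermelo_unique r u v N : 0 < N ->
  (u - N * A r) ^ 2 + m r ^ 2 * (v - N * B) ^ 2 = N ^ 2 -> zermelo m A B r u v = N.
Proof.
  intros P E. assert (h := lam_pos r). assert (g := zermelo_square_gap r u v N).
  assert (p := zroot_le_pos r u v N P (Req_le _ _ E)).
  assert (s := sqrt_pos _ : 0 <= zroot m A B r u v).
  assert (S : zroot m A B r u v = lam m A B r * N + wdot m A B r u v) by (rewrite E in g; nra).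
  unfold zermelo. rewrite S. field; lra.
Qed.

Lemma regular_zermelo :
  regular (zermelo m A B) (zermelo_r m A B) (zermelo_u m A B) (zermelo_v m A B).
Proof.
  assert (Hm := nav_m W). assert (HA := nav_A W).
  constructor.
  5, 6, 7: intros k r u v H; unfold zermelo_r, zermelo_u, zermelo_v;
    rewrite zermelo_homog, zroot_homog by auto;
    (* division by zero: both sides vanish when the root does *)
    destruct (Req_dec (zroot m A B r u v) 0) as [e|e];
    [rewrite e, Rmult_0_r; unfold Rdiv; rewrite Rinv_0; ring | field; lra].
  - intros r u v t r' u' v' Dr Du Dv H.
    (* The closed formula only shows that a derivative exists; its value is read off from the two
       expressions [E] and [E2] for the derivative of the navigation equation. *)
    assert (Ex : ex_derive (fun t => zermelo m A B (r t) (u t) (v t)) t).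
    { unfold zermelo, zroot, wdot, lam.
      assert (l := lam_pos (r t)). assert (q := zroot_arg_pos (r t) (u t) (v t) H).
      unfold lam, wdot in *.
      assert (em : ex_derive m (r t)) by (eexists; apply smooth_is_derive, Hm).
      assert (eA : ex_derive A (r t)) by (eexists; apply smooth_is_derive, HA).
      auto_derive. repeat split; auto; try (eexists; eassumption).
      - simpl in *; lra. }
    destruct Ex as [N' HN].
    assert (p := zroot_pos _ _ _ H : 0 < zroot m A B (r t) (u t) (v t)).
    assert (Dm := smooth_is_derive m (r t) Hm). assert (DA := smooth_is_derive A (r t) HA).
    set (N := fun t => zermelo m A B (r t) (u t) (v t)) in *.
    change (is_derive N t N') in HN.
    assert (E : is_derive (fun t => (u t - N t * A (r t)) ^ 2 + m (r t) ^ 2 * (v t - N t * B) ^ 2) t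
       (2 * N t * N')).
    { apply is_derive_ext with (fun t => N t ^ 2).
      - intros s; symmetry; apply zermelo_navigation.
      - auto_derive; [eexists; eassumption|]. change (Derive (fun x => N x) t) with (Derive N t).
        rewrite (is_derive_unique _ _ _ HN). ring. }
    apply is_derive_unique in E.
    assert (E2 : Derive (fun t => (u t - N t * A (r t)) ^ 2 + m (r t) ^ 2 * (v t - N t * B) ^ 2) t
      = 2 * (u t - N t * A (r t)) * (u' - N' * A (r t) - N t * (Derive A (r t) * r'))
        + 2 * m (r t) * (Derive m (r t) * r') * (v t - N t * B) ^ 2
        + 2 * m (r t) ^ 2 * (v t - N t * B) * (v' - N' * B)).
    { apply is_derive_unique. auto_derive.
      - repeat split; auto; eexists; eassumption.
      - change (Derive (fun x => N x) t) with (Derive N t).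
        change (Derive (fun x => r x) t) with (Derive r t).
        change (Derive (fun x => u x) t) with (Derive u t).
        change (Derive (fun x => v x) t) with (Derive v t).
        rewrite (is_derive_unique _ _ _ HN), (is_derive_unique _ _ _ Dr),
          (is_derive_unique _ _ _ Du), (is_derive_unique _ _ _ Dv).
        change (Derive (fun x => A x)) with (Derive A). change (Derive (fun x => m x)) with (Derive m).
        ring. }
    assert (E3 := eq_trans (eq_sym E) E2).
    evar_last; [exact HN|].
    apply Rmult_eq_reg_l with (zroot m A B (r t) (u t) (v t)); [|lra].
    unfold zermelo_r, zermelo_u, zermelo_v. fold (N t).
    transitivity ((N t + A (r t) * (u t - N t * A (r t)) + B * m (r t) ^ 2 * (v t - N t * B)) * N').
    { now rewrite zroot_inner. }
    field_simplify; lra.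
  - intros r. unfold zermelo, zroot, wdot.
    replace (lam m A B r * (0 ^ 2 + m r ^ 2 * 0 ^ 2) + (A r * 0 + B * m r ^ 2 * 0) ^ 2) with 0 by ring.
    rewrite sqrt_0. unfold Rdiv; ring.
  - intros; apply zermelo_pos; auto.
  - intros; apply zermelo_homog; auto.
  - intros r u v H. assert (p := zroot_pos r u v H).
    apply Rmult_eq_reg_l with (zroot m A B r u v); [|lra].
    unfold zermelo_u, zermelo_v.
    assert (E := zermelo_navigation r u v). assert (Z := zroot_inner r u v).
    set (N := zermelo m A B r u v) in *. set (S := zroot m A B r u v) in *.
    field_simplify; [|lra]. rewrite Z. lra.
  - intros D r u v o Hr Hu Hv H n.
    assert (Cm : Cn2_on n D (fun x y => m (r x y))) by (apply (smooth_comp D m r); auto).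
    assert (CA : Cn2_on n D (fun x y => A (r x y))) by (apply (smooth_comp D A r); auto).
    unfold zermelo, zroot, lam, wdot.
    apply Cn2_div; auto.
    + intros x y d. assert (h := lam_pos (r x y)). unfold lam in h. lra.
    + apply Cn2_minus; auto.
      * apply Cn2_sqrt; auto.
        { intros x y d. apply (zroot_arg_pos (r x y) _ _ (H x y d)). }
        Cn2_arith.
      * Cn2_arith.
    + Cn2_arith.
Qed.

End Zermelo.

Lemma warped_norm_eq1 m r th u v : warped_norm m r th u v = 1 <-> u ^ 2 + m r ^ 2 * v ^ 2 = 1.
Proof.
  unfold warped_norm. split; intros H; [|rewrite H; apply sqrt_1].
  rewrite <- (pow2_sqrt (u ^ 2 + m r ^ 2 * v ^ 2)), H; [ring|].
  assert (0 <= u ^ 2) by apply pow2_ge_0. assert (0 <= (m r * v) ^ 2) by apply pow2_ge_0. nra.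
Qed.

Lemma riemannian_homog a k r th u v : is_riemannian_norm a ->
  a r th (k * u) (k * v) = Rabs k * a r th u v.
Proof.
  intros (g11 & g12 & g22 & _ & _ & _ & _ & E). rewrite !E.
  replace (g11 r th * (k * u) ^ 2 + 2 * g12 r th * (k * u) * (k * v) + g22 r th * (k * v) ^ 2)
    with (k ^ 2 * (g11 r th * u ^ 2 + 2 * g12 r th * u * v + g22 r th * v ^ 2)) by ring.
  rewrite sqrt_mult_alt by apply pow2_ge_0. f_equal.
  rewrite <- sqrt_Rsqr_abs. f_equal. unfold Rsqr; ring.
Qed.

(** A Randers metric is positively homogeneous, hence determined by its indicatrix: for
    [N = zermelo] the vector [y / N] minus the wind is an h-unit vector, so [F] is 1 at [y / N]. *)
Lemma zermelo_solution_unique m A B F a b :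
  navigation m A B ->
  zermelo_solution (warped_norm m) (fun r _ => A r) (fun _ _ => B) F a b ->
  F = rotational (zermelo m A B).
Proof.
  intros W [(Ha & (b1 & b2 & _ & _ & Hb) & HF) Hz].
  assert (Hom : forall k r th u v, 0 < k -> F r th (k * u) (k * v) = k * F r th u v).
  { intros k r th u v H. rewrite !HF, !Hb, riemannian_homog, Rabs_pos_eq by (auto; lra). ring. }
  extensionality r; extensionality th; extensionality u; extensionality v.
  unfold rotational.
  destruct (excluded_middle_informative ((u, v) = (0, 0))) as [e|e].
  - injection e; intros -> ->. rewrite (reg_zero (regular_zermelo m A B W)).
    assert (h := Hom 2 r th 0 0 ltac:(lra)). rewrite !Rmult_0_r in h. lra.
  - set (N := zermelo m A B r u v). assert (P : 0 < N) by (apply zermelo_pos; auto).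
    assert (E : F r th (/ N * u) (/ N * v) = 1).
    { apply Hz, warped_norm_eq1. assert (Z := zermelo_navigation m A B W r u v). fold N in Z.
      apply Rmult_eq_reg_l with (N ^ 2); [|apply pow_nonzero; lra].
      transitivity ((u - N * A r) ^ 2 + m r ^ 2 * (v - N * B) ^ 2); [field; lra | lra]. }
    rewrite Hom in E by (apply Rinv_0_lt_compat; auto).
    apply Rmult_eq_reg_l with (/ N); [|apply Rinv_neq_0_compat; lra].
    rewrite E. field; lra.
Qed.

(** A norm is even and a one-form is odd, so the even part of [F] recovers [a], and the splitting of
    [F] is unique. *)
Lemma randers_symmetrize F a b : is_randers F a b ->
  a = fun r th u v => (F r th u v + F r th (- u) (- v)) / 2.
Proof.
  intros (Ha & (b1 & b2 & _ & _ & Hb) & HF).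
  extensionality r; extensionality th; extensionality u; extensionality v.
  rewrite !HF, !Hb.
  replace (a r th (- u) (- v)) with (a r th u v); [field|].
  replace (- u) with (-1 * u) by ring. replace (- v) with (-1 * v) by ring.
  rewrite riemannian_homog by auto. rewrite (Rabs_left (-1)) by lra. ring.
Qed.

(** * Extremals *)

Definition inside (a b : Rbar) (t : R) : Prop := Rbar_lt a t /\ Rbar_lt t b.

Lemma locally_inside a b t : inside a b t -> locally t (inside a b).
Proof. intros [Ha Hb]; exact (locally_open_interval a b t Ha Hb). Qed.

Lemma inside_between a b s t x : inside a b s -> inside a b t -> s <= x <= t -> inside a b x.
Proof.
  intros [h1 _] [_ h2] [l1 l2]; split.
  - exact (Rbar_lt_le_trans a s x h1 l1).
  - exact (Rbar_le_lt_trans x t b l2 h2).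
Qed.

Lemma inside_neighbours a b t : inside a b t ->
  exists e, 0 < e /\ inside a b (t - e) /\ inside a b (t + e).
Proof.
  intros ht. destruct (locally_inside a b t ht) as [e He]. assert (ep := cond_pos e).
  exists (e / 2). split; [lra|]. split; apply He; rewrite ball_Rabs; apply Rabs_def1; lra.
Qed.

Lemma is_derive_inside_ext a b (f g : R -> R) t l : inside a b t ->
  (forall s, inside a b s -> f s = g s) -> is_derive f t l -> is_derive g t l.
Proof.
  intros h E. apply is_derive_ext_loc.
  generalize (locally_inside a b t h); apply filter_imp; auto.
Qed.

Lemma constant_inside a b f :
  (forall t, inside a b t -> is_derive f t 0) ->
  forall s t, inside a b s -> inside a b t -> f s = f t.
Proof.
  intros H. assert (K : forall s t, inside a b s -> inside a b t -> s < t -> f s = f t).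
  { intros s t hs ht lt. apply (eq_is_derive f s t); auto.
    intros x Hx. apply H. exact (inside_between a b s t x hs ht Hx). }
  intros s t hs ht. destruct (Rtotal_order s t) as [l|[->|l]]; auto. symmetry; auto.
Qed.

Definition at_velocity (G : R -> R -> R -> R) (c : curve) (t : R) : R :=
  G (rc c t) (Derive (rc c) t) (Derive (thc c) t).

Definition moving (c : curve) (t : R) : Prop := (Derive (rc c) t, Derive (thc c) t) <> (0, 0).

(* Solutions of the Euler-Lagrange equations of F itself: unlike geodesics, they
   are invariant under orientation preserving reparametrization. *)
Definition extremal (Fr Fu Fv : R -> R -> R -> R) (a b : Rbar) (c : curve) : Prop :=
  smooth_on a b (rc c) /\ smooth_on a b (thc c) /\
  forall t, inside a b t -> moving c t /\
    is_derive (at_velocity Fu c) t (at_velocity Fr c t) /\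
    is_derive (at_velocity Fv c) t 0.

Section Regular.
Context {F Fr Fu Fv : R -> R -> R -> R} (HF : regular F Fr Fu Fv).

Lemma is_derive_id_R (x : R) : is_derive (fun t : R => t) x 1.
Proof. apply @is_derive_id. Qed.

Lemma is_derive_const_R (k x : R) : is_derive (fun _ : R => k) x 0.
Proof. apply @is_derive_const. Qed.

Lemma regular_partials r u v : (u, v) <> (0, 0) ->
  is_derive (fun x => F x u v) r (Fr r u v) /\
  is_derive (fun x => F r x v) u (Fu r u v) /\
  is_derive (fun x => F r u x) v (Fv r u v).
Proof.
  intros H. split; [|split].
  - replace (Fr r u v) with (Fr r u v * 1 + Fu r u v * 0 + Fv r u v * 0) by ring.
    apply (reg_chain HF (fun x => x) (fun _ => u) (fun _ => v) r 1 0 0); auto using is_derive_id_R, is_derive_const_R.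
  - replace (Fu r u v) with (Fr r u v * 0 + Fu r u v * 1 + Fv r u v * 0) by ring.
    apply (reg_chain HF (fun _ => r) (fun x => x) (fun _ => v) u 0 1 0); auto using is_derive_id_R, is_derive_const_R.
  - replace (Fv r u v) with (Fr r u v * 0 + Fu r u v * 0 + Fv r u v * 1) by ring.
    apply (reg_chain HF (fun _ => r) (fun _ => u) (fun x => x) v 0 0 1); auto using is_derive_id_R, is_derive_const_R.
Qed.

Lemma Derive_half_sqr (f : R -> R) x l : is_derive f x l ->
  Derive (fun y => f y ^ 2 / 2) x = f x * l.
Proof.
  intros H. apply is_derive_unique. auto_derive; [eexists; exact H|].
  change (Derive (fun x => f x) x) with (Derive f x).
  rewrite (is_derive_unique _ _ _ H). field.
Qed.

Lemma energy_partials r th u v : (u, v) <> (0, 0) ->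
  D_r (energy (rotational F)) r th u v = F r u v * Fr r u v /\
  D_u (energy (rotational F)) r th u v = F r u v * Fu r u v /\
  D_v (energy (rotational F)) r th u v = F r u v * Fv r u v.
Proof.
  intros H. destruct (regular_partials r u v H) as (h1 & h2 & h3).
  split; [|split].
  - exact (Derive_half_sqr (fun x => F x u v) r _ h1).
  - exact (Derive_half_sqr (fun x => F r x v) u _ h2).
  - exact (Derive_half_sqr (fun x => F r u x) v _ h3).
Qed.

Lemma geodesic_on_moving a b c : (forall t, inside a b t -> moving c t) ->
  (geodesic_on (rotational F) a b c <->
   smooth_on a b (rc c) /\ smooth_on a b (thc c) /\
   forall t, inside a b t ->
     is_derive (fun s => at_velocity F c s * at_velocity Fu c s) t
       (at_velocity F c t * at_velocity Fr c t) /\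
     is_derive (fun s => at_velocity F c s * at_velocity Fv c s) t 0).
Proof.
  intros M.
  assert (Hr : forall t, inside a b t ->
    along (D_r (energy (rotational F))) c t = at_velocity F c t * at_velocity Fr c t).
  { intros t h; apply energy_partials; apply M; auto. }
  assert (Hu : forall t, inside a b t ->
    along (D_u (energy (rotational F))) c t = at_velocity F c t * at_velocity Fu c t).
  { intros t h; apply energy_partials; apply M; auto. }
  assert (Hv : forall t, inside a b t ->
    along (D_v (energy (rotational F))) c t = at_velocity F c t * at_velocity Fv c t).
  { intros t h; apply energy_partials; apply M; auto. }
  assert (Ht : forall t, along (D_th (energy (rotational F))) c t = 0).
  { intros t. unfold along, D_th, energy, rotational. apply Derive_const. }
  split; intros (S1 & S2 & E); split; auto; split; auto.
  - intros t h. destruct (E t (proj1 h) (proj2 h)) as [E1 E2].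
    rewrite Hr in E1 by auto. rewrite Ht in E2. split.
    + refine (is_derive_inside_ext a b _ _ t _ h _ E1); auto.
    + refine (is_derive_inside_ext a b _ _ t _ h _ E2); auto.
  - intros t h1 h2. assert (h : inside a b t) by (split; auto). destruct (E t h) as [E1 E2].
    rewrite Hr, Ht by auto. split.
    + refine (is_derive_inside_ext a b _ _ t _ h _ E1); intros; symmetry; auto.
    + refine (is_derive_inside_ext a b _ _ t _ h _ E2); intros; symmetry; auto.
Qed.

Lemma at_velocity_derive a b c t :
  smooth_on a b (rc c) -> smooth_on a b (thc c) -> inside a b t -> moving c t ->
  is_derive (at_velocity F c) t
    (at_velocity Fr c t * Derive (rc c) t + at_velocity Fu c t * Derive (Derive (rc c)) t
     + at_velocity Fv c t * Derive (Derive (thc c)) t).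
Proof.
  intros S1 S2 [h1 h2] M.
  apply (reg_chain HF (rc c) (Derive (rc c)) (Derive (thc c))); auto.
  - apply smooth_on_is_derive with a b; auto.
  - apply smooth_on_is_derive with a b; auto using smooth_on_Derive.
  - apply smooth_on_is_derive with a b; auto using smooth_on_Derive.
Qed.

(** The speed is constant: by Euler's identity the Euler-Lagrange equations give [(F^2)' = F F'],
    while directly [(F^2)' = 2 F F']. Dividing the equations of the energy by this constant gives
    those of [F]. *)
Lemma geodesic_extremal a b c : (forall t, inside a b t -> moving c t) ->
  geodesic_on (rotational F) a b c ->
  extremal Fr Fu Fv a b c /\
  forall s t, inside a b s -> inside a b t -> at_velocity F c s = at_velocity F c t.
Proof.
  intros M G. apply geodesic_on_moving in G; auto. destruct G as (S1 & S2 & E).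
  assert (P : forall t, inside a b t -> 0 < at_velocity F c t)
    by (intros; apply (reg_pos HF), M; auto).
  assert (DN : forall t, inside a b t -> is_derive (at_velocity F c) t 0).
  { intros t h. destruct (E t h) as [E1 E2].
    assert (D := at_velocity_derive a b c t S1 S2 h (M t h)).
    assert (D1 := smooth_on_is_derive a b (Derive (rc c)) t (smooth_on_Derive _ _ _ S1) (proj1 h) (proj2 h)).
    assert (D2 := smooth_on_is_derive a b (Derive (thc c)) t (smooth_on_Derive _ _ _ S2) (proj1 h) (proj2 h)).
    set (N' := _ + _) in D.
    (* Euler's identity: F^2 = u (F Fu) + v (F Fv). *)
    assert (Q : is_derive (fun s => at_velocity F c s ^ 2) t
      (Derive (Derive (rc c)) t * (at_velocity F c t * at_velocity Fu c t)
       + Derive (rc c) t * (at_velocity F c t * at_velocity Fr c t)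
       + (Derive (Derive (thc c)) t * (at_velocity F c t * at_velocity Fv c t)
       + Derive (thc c) t * 0))).
    { apply is_derive_ext_loc with (fun s => Derive (rc c) s * (at_velocity F c s * at_velocity Fu c s)
        + Derive (thc c) s * (at_velocity F c s * at_velocity Fv c s)).
      - generalize (locally_inside a b t h); apply filter_imp. intros s hs.
        transitivity (at_velocity F c s * (Derive (rc c) s * at_velocity Fu c s
                        + Derive (thc c) s * at_velocity Fv c s)); [simpl; ring|].
        unfold at_velocity. rewrite (reg_euler HF (rc c s) _ _ (M s hs)). simpl; ring.
      - apply @is_derive_plus.
        + apply (is_derive_mult (Derive (rc c)) (fun s => at_velocity F c s * at_velocity Fu c s)); auto.
          intros; apply Rmult_comm.
        + apply (is_derive_mult (Derive (thc c)) (fun s => at_velocity F c s * at_velocity Fv c s)); auto.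
          intros; apply Rmult_comm. }
    assert (Q2 : is_derive (fun s => at_velocity F c s ^ 2) t (2 * at_velocity F c t * N')).
    { auto_derive; [eexists; exact D|].
      change (Derive (fun x => at_velocity F c x) t) with (Derive (at_velocity F c) t).
      rewrite (is_derive_unique _ _ _ D). ring. }
    apply is_derive_unique in Q. apply is_derive_unique in Q2.
    assert (Z := eq_trans (eq_sym Q) Q2).
    replace 0 with N'; auto.
    apply Rmult_eq_reg_l with (at_velocity F c t); [|assert (p := P t h); lra].
    unfold N' in *. lra. }
  assert (K := constant_inside a b _ DN).
  split; auto. split; auto. split; auto. intros t h. split; [auto|].
  destruct (E t h) as [E1 E2]. assert (p := P t h).
  assert (X : forall (f g : R -> R) l, is_derive (fun s => at_velocity F c s * f s) t l ->
     is_derive f t (/ at_velocity F c t * l)).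
  { intros f g l Hf. apply is_derive_ext_loc with
      (fun s => / at_velocity F c t * (at_velocity F c s * f s)).
    - generalize (locally_inside a b t h); apply filter_imp. intros s hs.
      rewrite (K s t hs h). R_eq. field; lra.
    - apply @is_derive_scal; exact Hf. }
  split.
  - apply X in E1; auto. evar_last; [exact E1|]. R_eq. field; lra.
  - apply X in E2; auto. evar_last; [exact E2|]. R_eq. ring.
Qed.

Lemma unit_geodesic_extremal a b c :
  unit_geodesic_on (rotational F) a b c <->
  extremal Fr Fu Fv a b c /\ forall t, inside a b t -> at_velocity F c t = 1.
Proof.
  split.
  - intros [G U].
    assert (U' : forall t, inside a b t -> at_velocity F c t = 1) by (intros t [h1 h2]; apply U; auto).
    split; auto. apply geodesic_extremal; auto.
    intros t h e. injection e; intros e2 e1. assert (k := U' t h). unfold at_velocity in k.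
    rewrite e1, e2, (reg_zero HF) in k. lra.
  - intros [(S1 & S2 & E) U]. split; [|intros t h1 h2; apply U; split; auto].
    apply geodesic_on_moving; [intros t h; apply E; auto|]. split; auto. split; auto.
    intros t h. rewrite U by auto. destruct (E t h) as (M & E1 & E2). rewrite Rmult_1_l. split.
    + refine (is_derive_inside_ext a b _ _ t _ h _ E1). intros s hs; simpl. rewrite U by auto; ring.
    + refine (is_derive_inside_ext a b _ _ t _ h _ E2). intros s hs; simpl. rewrite U by auto; ring.
Qed.

Lemma smooth_on_comp a b c d f psi :
  smooth_on a b f -> smooth_on c d psi -> (forall x, inside c d x -> inside a b (psi x)) ->
  smooth_on c d (fun x => f (psi x)).
Proof.
  intros S1 S2 H. apply Cn2_smooth_on.
  apply (smooth_comp2 (strip c d) a b f (fun _ x => psi x)); auto using open2_strip.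
  intros n; apply smooth_on_Cn2_y, S2.
Qed.

Lemma Derive_comp_inside a b c d f psi x :
  smooth_on a b f -> smooth_on c d psi -> inside c d x -> inside a b (psi x) ->
  Derive (fun x => f (psi x)) x = Derive psi x * Derive f (psi x).
Proof.
  intros S1 S2 [h1 h2] [h3 h4]. apply is_derive_unique.
  apply (is_derive_comp f psi).
  - exact (smooth_on_is_derive a b f (psi x) S1 h3 h4).
  - exact (smooth_on_is_derive c d psi x S2 h1 h2).
Qed.

(** [Fu] and [Fv] are homogeneous of degree 0 and [Fr] of degree 1, so both sides of each equation
    are multiplied by the derivative of [psi]. *)
Lemma extremal_reparam a b c d gam psi :
  extremal Fr Fu Fv a b gam -> smooth_on c d psi ->
  (forall x, inside c d x -> inside a b (psi x) /\ 0 < Derive psi x) ->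
  extremal Fr Fu Fv c d (fun x => gam (psi x)) /\
  forall x, inside c d x ->
    at_velocity F (fun x => gam (psi x)) x = Derive psi x * at_velocity F gam (psi x).
Proof.
  intros (S1 & S2 & E) S H.
  assert (D1 : forall x, inside c d x -> Derive (rc (fun x => gam (psi x))) x
     = Derive psi x * Derive (rc gam) (psi x)).
  { intros x h. apply (Derive_comp_inside a b c d (rc gam) psi x); auto. apply H; auto. }
  assert (D2 : forall x, inside c d x -> Derive (thc (fun x => gam (psi x))) x
     = Derive psi x * Derive (thc gam) (psi x)).
  { intros x h. apply (Derive_comp_inside a b c d (thc gam) psi x); auto. apply H; auto. }
  assert (V : forall G x, inside c d x -> at_velocity G (fun x => gam (psi x)) x =
     G (rc gam (psi x)) (Derive psi x * Derive (rc gam) (psi x)) (Derive psi x * Derive (thc gam) (psi x))).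
  { intros G x h. unfold at_velocity. now rewrite D1, D2 by auto. }
  split.
  - split; [apply (smooth_on_comp a b c d (rc gam)); auto; intros; apply H; auto|].
    split; [apply (smooth_on_comp a b c d (thc gam)); auto; intros; apply H; auto|].
    intros x h. destruct (H x h) as [h1 p]. destruct (E (psi x) h1) as (M & E1 & E2).
    assert (DP := smooth_on_is_derive c d psi x S (proj1 h) (proj2 h)).
    split; [|split].
    + unfold moving. rewrite D1, D2 by auto. intros e. injection e; intros e2 e1.
      apply M. f_equal; [apply Rmult_integral in e1 | apply Rmult_integral in e2]; lra.
    + rewrite V, (reg_homog_r HF) by auto.
      apply is_derive_ext_loc with (fun x => at_velocity Fu gam (psi x)).
      * generalize (locally_inside c d x h); apply filter_imp. intros s hs.
        rewrite V, (reg_homog_u HF) by (auto; apply H; auto). reflexivity.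
      * apply (is_derive_comp (at_velocity Fu gam) psi); auto.
    + replace 0 with (Derive psi x * 0) by ring.
      apply is_derive_ext_loc with (fun x => at_velocity Fv gam (psi x)).
      * generalize (locally_inside c d x h); apply filter_imp. intros s hs.
        rewrite V, (reg_homog_v HF) by (auto; apply H; auto). reflexivity.
      * apply (is_derive_comp (at_velocity Fv gam) psi); auto.
  - intros x h. rewrite V by auto. apply (reg_homog HF), H; auto.
Qed.

(** [dh] is a null Lagrangian: it adds [h'(r)] to the momentum of [r], whose derivative [h''(r) r']
    is exactly the new term on the right. *)
Lemma extremal_plus_exact h a b c : smooth h -> extremal Fr Fu Fv a b c ->
  extremal (fun r u v => Fr r u v + Derive (Derive h) r * u)
    (fun r u v => Fu r u v + Derive h r) Fv a b c.
Proof.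
  intros Hh (S1 & S2 & E). split; auto. split; auto. intros t ht.
  destruct (E t ht) as (M & E1 & E2). split; auto. split; auto.
  unfold at_velocity. apply @is_derive_plus; auto.
  rewrite Rmult_comm. apply (is_derive_comp (Derive h) (rc c)).
  - apply smooth_is_derive, smooth_on_Derive, Hh.
  - apply smooth_on_is_derive with a b; auto; apply ht.
Qed.

End Regular.

(** Both velocities differ from their winds by the same h-unit vector [n]. The partials of either
    metric are the same expressions in [n] divided by [zroot], which at unit speed is [1 + h(W, n)];
    only the ratio of the two roots enters. *)
Lemma unit_geodesic_wind m A B1 B2 a b c :
  navigation m A B1 -> navigation m A B2 ->
  unit_geodesic_on (rotational (zermelo m A B1)) a b c ->
  unit_geodesic_on (rotational (zermelo m A B2)) a b
    (fun t => (rc c t, thc c t + (B2 - B1) * t)).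
Proof.
  intros W1 W2.
  rewrite (unit_geodesic_extremal (regular_zermelo m A B1 W1)).
  rewrite (unit_geodesic_extremal (regular_zermelo m A B2 W2)).
  intros [(S1 & S2 & E) U].
  set (c2 := fun t => (rc c t, thc c t + (B2 - B1) * t)).
  assert (D2 : forall t, inside a b t -> is_derive (thc c2) t (Derive (thc c) t + (B2 - B1))).
  { intros t [h1 h2]. apply @is_derive_plus; [apply smooth_on_is_derive with a b; auto|].
    auto_derive; auto; ring. }
  assert (V : forall G t, inside a b t -> at_velocity G c2 t =
    G (rc c t) (Derive (rc c) t) (Derive (thc c) t + (B2 - B1))).
  { intros G t h. unfold at_velocity. now rewrite (is_derive_unique _ _ _ (D2 t h)). }
  assert (U2 : forall t, inside a b t -> at_velocity (zermelo m A B2) c2 t = 1).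
  { intros t h. rewrite V by auto. assert (u := U t h). unfold at_velocity in u.
    apply zermelo_unique; auto; [lra|].
    assert (n := zermelo_navigation m A B1 W1 (rc c t) (Derive (rc c) t) (Derive (thc c) t)).
    rewrite u in n. rewrite <- n. ring. }
  (* Clairaut: [k], the momentum of theta, is constant, so that the two Legendre
     transforms differ by the constant factor [1 + (B2 - B1) k]. *)
  assert (K : forall t, inside a b t ->
    0 < 1 + (B2 - B1) * at_velocity (zermelo_v m A B1) c t /\
    at_velocity (zermelo_u m A B2) c2 t =
      at_velocity (zermelo_u m A B1) c t / (1 + (B2 - B1) * at_velocity (zermelo_v m A B1) c t) /\
    at_velocity (zermelo_v m A B2) c2 t =
      at_velocity (zermelo_v m A B1) c t / (1 + (B2 - B1) * at_velocity (zermelo_v m A B1) c t) /\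
    at_velocity (zermelo_r m A B2) c2 t =
      at_velocity (zermelo_r m A B1) c t / (1 + (B2 - B1) * at_velocity (zermelo_v m A B1) c t)).
  { intros t h. assert (u := U t h). assert (u2 := U2 t h). destruct (E t h) as (M & _ & _).
    rewrite !V in * by auto. unfold at_velocity in *.
    set (r := rc c t) in *. set (x := Derive (rc c) t) in *. set (y := Derive (thc c) t) in *.
    assert (M2 : (x, y + (B2 - B1)) <> (0, 0)).
    { intros e. injection e; intros e2 e1. rewrite e1, e2, (reg_zero (regular_zermelo m A B2 W2)) in u2. lra. }
    assert (p1 := zroot_pos m A B1 W1 r x y M). assert (p2 := zroot_pos m A B2 W2 r _ _ M2).
    assert (i1 := zroot_inner m A B1 W1 r x y). assert (i2 := zroot_inner m A B2 W2 r x (y + (B2 - B1))).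
    unfold zermelo_u, zermelo_v, zermelo_r. rewrite u, u2 in *.
    set (s1 := zroot m A B1 r x y) in *. set (s2 := zroot m A B2 r x (y + (B2 - B1))) in *.
    assert (R : s2 = s1 * (1 + (B2 - B1) * (m r ^ 2 * (y - 1 * B1) / s1))).
    { field_simplify; [|lra]. rewrite i1, i2. ring. }
    assert (Q : 0 < 1 + (B2 - B1) * (m r ^ 2 * (y - 1 * B1) / s1)).
    { apply Rmult_lt_reg_l with s1; auto. rewrite Rmult_0_r, <- R; auto. }
    set (k := 1 + (B2 - B1) * (m r ^ 2 * (y - 1 * B1) / s1)) in *.
    clearbody k. rewrite R. replace (y + (B2 - B1) - 1 * B2) with (y - 1 * B1) by ring.
    repeat split; auto; field; lra. }
  split; auto. split; [exact S1|]. split.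
  { apply smooth_on_ext with (fun t => thc c t + (B2 - B1) * t); auto.
    smooth_arith. }
  intros t h. destruct (E t h) as (M & E1 & E2).
  assert (C := constant_inside a b (at_velocity (zermelo_v m A B1) c) (fun t h => proj2 (proj2 (E t h)))).
  set (k := 1 + (B2 - B1) * at_velocity (zermelo_v m A B1) c t).
  split; [|split].
  - intros e. assert (u2 := U2 t h). unfold at_velocity in u2. injection e; intros e2 e1.
    rewrite e1, e2, (reg_zero (regular_zermelo m A B2 W2)) in u2. lra.
  - apply is_derive_ext_loc with (fun s => / k * at_velocity (zermelo_u m A B1) c s).
    + generalize (locally_inside a b t h); apply filter_imp. intros s hs.
      destruct (K s hs) as (_ & -> & _). rewrite (C s t) by auto. fold k. R_eq. unfold Rdiv; ring.
    + destruct (K t h) as (_ & _ & _ & ->). fold k. unfold Rdiv; rewrite Rmult_comm.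
      apply @is_derive_scal; exact E1.
  - apply is_derive_ext_loc with (fun s => / k * at_velocity (zermelo_v m A B1) c s).
    + generalize (locally_inside a b t h); apply filter_imp. intros s hs.
      destruct (K s hs) as (_ & _ & -> & _). rewrite (C s t) by auto. fold k. R_eq. unfold Rdiv; ring.
    + replace 0 with (/ k * 0) by ring. apply @is_derive_scal; exact E2.
Qed.

Lemma inside_derive a b f t : smooth_on a b f -> inside a b t -> is_derive f t (Derive f t).
Proof. intros S [h1 h2]; exact (smooth_on_is_derive a b f t S h1 h2). Qed.

Lemma inside_segment a b s t x :
  inside a b s -> inside a b t -> Rmin s t <= x <= Rmax s t -> inside a b x.
Proof.
  intros hs ht h. destruct (Rle_dec s t).
  - rewrite Rmin_left, Rmax_right in h by auto. exact (inside_between a b s t x hs ht h).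
  - rewrite Rmin_right, Rmax_left in h by lra. exact (inside_between a b t s x ht hs h).
Qed.

Lemma RInt_Derive_inside a b (f df : R -> R) s t :
  smooth_on a b f -> (forall x, inside a b x -> is_derive f x (df x)) ->
  inside a b s -> inside a b t -> RInt df s t = f t - f s.
Proof.
  intros S D hs ht. apply is_RInt_unique. apply (is_RInt_derive f df).
  - intros x hx. apply D, (inside_segment a b s t x); auto.
  - intros x hx. assert (h : inside a b x) by exact (inside_segment a b s t x hs ht hx).
    apply continuous_ext_loc with (Derive f).
    + generalize (locally_inside a b x h); apply filter_imp. intros y hy.
      apply is_derive_unique, D, hy.
    + apply (ex_derive_continuous (Derive f)).
      eexists. apply (inside_derive a b _ x (smooth_on_Derive _ _ _ S) h).
Qed.

Lemma Derive_inside_ext a b f g t : (forall s, inside a b s -> f s = g s) -> inside a b t ->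
  Derive f t = Derive g t.
Proof.
  intros H h. apply Derive_ext_loc.
  generalize (locally_inside a b t h); apply filter_imp; auto.
Qed.

Lemma at_velocity_ext a b c1 c2 G t : (forall s, inside a b s -> c1 s = c2 s) ->
  inside a b t -> at_velocity G c1 t = at_velocity G c2 t.
Proof.
  intros H h. unfold at_velocity.
  rewrite (Derive_inside_ext a b (rc c1) (rc c2)), (Derive_inside_ext a b (thc c1) (thc c2));
    auto; unfold rc, thc; intros; rewrite H; auto.
Qed.

Lemma extremal_ext Fr Fu Fv a b c1 c2 : (forall s, inside a b s -> c1 s = c2 s) ->
  extremal Fr Fu Fv a b c1 -> extremal Fr Fu Fv a b c2.
Proof.
  intros H (S1 & S2 & E). split; [|split].
  - apply smooth_on_ext with (2 := S1). intros t h1 h2; unfold rc; rewrite H; auto; split; auto.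
  - apply smooth_on_ext with (2 := S2). intros t h1 h2; unfold thc; rewrite H; auto; split; auto.
  - intros t h. destruct (E t h) as (M & E1 & E2). split; [|split].
    + unfold moving in *. rewrite <- (Derive_inside_ext a b (rc c1) (rc c2)),
        <- (Derive_inside_ext a b (thc c1) (thc c2));
        auto; unfold rc, thc; intros; rewrite H; auto.
    + rewrite <- (at_velocity_ext a b c1 c2) by auto.
      refine (is_derive_inside_ext a b _ _ t _ h _ E1); intros; apply at_velocity_ext with a b; auto.
    + refine (is_derive_inside_ext a b _ _ t _ h _ E2); intros; apply at_velocity_ext with a b; auto.
Qed.

Lemma unit_geodesic_ext F Fr Fu Fv a b c1 c2 : regular F Fr Fu Fv ->
  (forall s, inside a b s -> c1 s = c2 s) ->
  unit_geodesic_on (rotational F) a b c1 -> unit_geodesic_on (rotational F) a b c2.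
Proof.
  intros HF H. rewrite !(unit_geodesic_extremal HF). intros [E U]. split.
  - exact (extremal_ext _ _ _ _ _ _ _ H E).
  - intros t h. rewrite <- (at_velocity_ext a b c1 c2); auto.
Qed.

Lemma unit_geodesic_sub F (a b a' b' : Rbar) c : Rbar_le a a' -> Rbar_le b' b ->
  unit_geodesic_on F a b c -> unit_geodesic_on F a' b' c.
Proof.
  intros Ha Hb [(S1 & S2 & E) U].
  assert (I : forall t : R, Rbar_lt a' t -> Rbar_lt t b' -> Rbar_lt a t /\ Rbar_lt t b).
  { intros t h1 h2; split; [exact (Rbar_le_lt_trans a a' t Ha h1) | exact (Rbar_lt_le_trans t b' b h2 Hb)]. }
  split; [split; [|split]|].
  - exact (smooth_on_subset a b a' b' _ Ha Hb S1).
  - exact (smooth_on_subset a b a' b' _ Ha Hb S2).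
  - intros t h1 h2. destruct (I t h1 h2). apply E; auto.
  - intros t h1 h2. destruct (I t h1 h2). apply U; auto.
Qed.

(** * Adding an exact one-form *)

(** As a relation between two metrics the change is symmetric up to the sign of [h], so that each
    result about it also serves for the way back. *)
Record exact_change (F Fr Fu Fv G Gr Gu Gv : R -> R -> R -> R) (h : R -> R) : Prop := {
  ec_F : regular F Fr Fu Fv;
  ec_G : regular G Gr Gu Gv;
  ec_h : smooth h;
  ec_eq : forall r u v, G r u v = F r u v + Derive h r * u;
  ec_eq_r : forall r u v, Gr r u v = Fr r u v + Derive (Derive h) r * u;
  ec_eq_u : forall r u v, Gu r u v = Fu r u v + Derive h r;
  ec_eq_v : forall r u v, Gv r u v = Fv r u v }.

Arguments ec_F {F Fr Fu Fv G Gr Gu Gv h} _.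
Arguments ec_G {F Fr Fu Fv G Gr Gu Gv h} _.
Arguments ec_h {F Fr Fu Fv G Gr Gu Gv h} _.
Arguments ec_eq {F Fr Fu Fv G Gr Gu Gv h} _.
Arguments ec_eq_r {F Fr Fu Fv G Gr Gu Gv h} _.
Arguments ec_eq_u {F Fr Fu Fv G Gr Gu Gv h} _.
Arguments ec_eq_v {F Fr Fu Fv G Gr Gu Gv h} _.

Lemma smooth_opp h : smooth h -> smooth (fun r => - h r).
Proof. intros H. smooth_arith. Qed.

Lemma exact_change_sym {F Fr Fu Fv G Gr Gu Gv h} :
  exact_change F Fr Fu Fv G Gr Gu Gv h ->
  exact_change G Gr Gu Gv F Fr Fu Fv (fun r => - h r).
Proof.
  intros H.
  assert (D : forall r, Derive (fun r => - h r) r = - Derive h r) by (intros; apply Derive_opp).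
  assert (DD : forall r, Derive (Derive (fun r => - h r)) r = - Derive (Derive h) r).
  { intros r. rewrite <- Derive_opp. apply Derive_ext, D. }
  constructor; try apply H; intros; rewrite ?D, ?DD.
  - apply smooth_opp, H.
  - rewrite (ec_eq H). ring.
  - rewrite (ec_eq_r H). ring.
  - rewrite (ec_eq_u H). ring.
  - rewrite (ec_eq_v H). ring.
Qed.

Section ExactChange.
Context {F Fr Fu Fv G Gr Gu Gv : R -> R -> R -> R} {h : R -> R}
  (H : exact_change F Fr Fu Fv G Gr Gu Gv h).

Lemma smooth_height a b c k : smooth_on a b (rc c) ->
  smooth_on a b (fun t => t + (h (rc c t) - k)).
Proof.
  intros S. apply Cn2_smooth_on. intros n.
  apply Cn2_plus; auto using open2_strip, Cn2_id2.
  apply Cn2_minus; auto using open2_strip, Cn2_const.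
  apply (smooth_comp (strip a b) h (fun _ t => rc c t)); auto using open2_strip.
  - apply H.
  - intros k'; apply smooth_on_Cn2_y, S.
Qed.

(* The G-length parameter of an F-unit speed curve. *)
Lemma height_derive a b c k t : smooth_on a b (rc c) -> inside a b t ->
  at_velocity F c t = 1 ->
  is_derive (fun t => t + (h (rc c t) - k)) t (at_velocity G c t).
Proof.
  intros S ht U. unfold at_velocity in *. rewrite (ec_eq H), U.
  apply @is_derive_plus; [apply is_derive_id_R|].
  replace (Derive h (rc c t) * Derive (rc c) t) with (Derive (rc c) t * Derive h (rc c t) - 0) by ring.
  apply @is_derive_minus; [|apply is_derive_const_R].
  apply (is_derive_comp h (rc c)); [apply smooth_is_derive, H | apply (inside_derive a b); auto].
Qed.

Lemma unit_geodesic_velocity a b c t : unit_geodesic_on (rotational F) a b c -> inside a b t ->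
  at_velocity F c t = 1 /\ 0 < at_velocity G c t.
Proof.
  intros U ht. apply (unit_geodesic_extremal (ec_F H)) in U.
  destruct U as [(_ & _ & E) U]. split; auto.
  apply (reg_pos (ec_G H)), E, ht.
Qed.

Lemma curve_length_exact a b c s t : unit_geodesic_on (rotational F) a b c ->
  inside a b s -> inside a b t ->
  curve_length (rotational G) c s t = t - s + (h (rc c t) - h (rc c s)).
Proof.
  intros U hs ht. unfold curve_length.
  rewrite (RInt_Derive_inside a b (fun t => t + (h (rc c t) - 0)) (along (rotational G) c) s t); auto.
  - ring.
  - apply smooth_height, U.
  - intros x hx. apply height_derive with a b; auto; [apply U|].
    apply (unit_geodesic_velocity a b); auto.
Qed.

(** [psi] inverts the G-arc length of the F-unit speed curve [c], with [k] fixing its origin. [c] is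
    also an extremal of [G], and the new parameter gives it G-speed 1. *)
Lemma unit_geodesic_exact a b c c0 d0 psi k :
  unit_geodesic_on (rotational F) a b c ->
  (forall x, inside c0 d0 x -> inside a b (psi x) /\ psi x + (h (rc c (psi x)) - k) = x) ->
  smooth_on c0 d0 psi /\
  (forall x, inside c0 d0 x -> is_derive psi x (/ at_velocity G c (psi x))) /\
  unit_geodesic_on (rotational G) c0 d0 (fun x => c (psi x)).
Proof.
  intros U Hpsi.
  assert (V := fun t => unit_geodesic_velocity a b c t U).
  set (phi := fun t => t + (h (rc c t) - k)) in *.
  assert (D : forall t, inside a b t -> is_derive phi t (at_velocity G c t)).
  { intros t ht. apply height_derive with a b; auto; [apply U | apply V, ht]. }
  destruct (smooth_inverse1 a b c0 d0 phi psi) as [S DS].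
  - apply smooth_height, U.
  - intros t h1 h2. rewrite (is_derive_unique _ _ _ (D t (conj h1 h2))). apply V; split; auto.
  - intros x h1 h2. destruct (Hpsi x (conj h1 h2)) as [[h3 h4] e]; auto.
  - assert (DS' : forall x, inside c0 d0 x -> is_derive psi x (/ at_velocity G c (psi x))).
    { intros x hx. rewrite <- (is_derive_unique _ _ _ (D (psi x) (proj1 (Hpsi x hx)))).
      apply DS; apply hx. }
    split; auto. split; auto.
    apply (unit_geodesic_extremal (ec_F H)) in U. destruct U as [E U].
    apply (unit_geodesic_extremal (ec_G H)).
    assert (E2 : extremal Gr Gu Gv a b c).
    { replace Gr with (fun r u v => Fr r u v + Derive (Derive h) r * u)
        by (extensionality r; extensionality u; extensionality v; symmetry; apply H).
      replace Gu with (fun r u v => Fu r u v + Derive h r)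
        by (extensionality r; extensionality u; extensionality v; symmetry; apply H).
      replace Gv with Fv
        by (extensionality r; extensionality u; extensionality v; symmetry; apply H).
      apply extremal_plus_exact; auto. apply H. }
    destruct (extremal_reparam (ec_G H) a b c0 d0 c psi E2 S) as [E3 V3].
    { intros x hx. split; [apply Hpsi, hx|]. rewrite (is_derive_unique _ _ _ (DS' x hx)).
      apply Rinv_0_lt_compat, V, Hpsi, hx. }
    split; auto. intros x hx. rewrite V3 by auto.
    rewrite (is_derive_unique _ _ _ (DS' x hx)). apply Rinv_l.
    apply Rgt_not_eq, V, Hpsi, hx.
Qed.

End ExactChange.

(** The image is the open interval between the infimum and the supremum of the values, which may be
    infinite: neither is attained, and everything in between is, by the intermediate value
    theorem. *)
Lemma increasing_inverse (a b : Rbar) (phi dphi : R -> R) :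
  (forall t, inside a b t -> is_derive phi t (dphi t) /\ 0 < dphi t) ->
  (forall s t, inside a b s -> inside a b t -> s < t -> phi s < phi t) /\
  exists (c d : Rbar) (psi : R -> R),
    (forall t, inside a b t -> inside c d (phi t) /\ psi (phi t) = t) /\
    (forall x, inside c d x -> inside a b (psi x) /\ phi (psi x) = x).
Proof.
  intros D.
  assert (M : forall s t, inside a b s -> inside a b t -> s < t -> phi s < phi t).
  { intros s t hs ht lt. apply derive_pos_lt with dphi; auto; intros x hx;
      apply D; exact (inside_between a b s t x hs ht hx). }
  split; auto.
  set (E := fun y => exists t, inside a b t /\ phi t = y).
  destruct (Lub_Rbar_correct E) as [U1 U2]. destruct (Glb_Rbar_correct E) as [L1 L2].
  set (d := Lub_Rbar E) in *. set (c := Glb_Rbar E) in *.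
  assert (I : forall t, inside a b t -> inside c d (phi t)).
  { intros t ht. destruct (inside_neighbours a b t ht) as (e & ep & h1 & h2).
    split.
    - apply Rbar_le_lt_trans with (phi (t - e)); [apply L1; exists (t - e); auto|].
      simpl; apply M; auto; lra.
    - apply Rbar_lt_le_trans with (phi (t + e)); [|apply U1; exists (t + e); auto].
      simpl; apply M; auto; lra. }
  assert (S : forall x, inside c d x -> exists t, inside a b t /\ phi t = x).
  { intros x [h1 h2].
    assert (A1 : exists t1, inside a b t1 /\ phi t1 < x).
    { apply NNPP. intros n. apply (Rbar_lt_not_le _ _ h1). apply L2.
      intros y [t [ht <-]]. simpl. apply Rnot_lt_le. intros l. apply n. eauto. }
    assert (A2 : exists t2, inside a b t2 /\ x < phi t2).
    { apply NNPP. intros n. apply (Rbar_lt_not_le _ _ h2). apply U2.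
      intros y [t [ht <-]]. simpl. apply Rnot_lt_le. intros l. apply n. eauto. }
    destruct A1 as (t1 & i1 & l1), A2 as (t2 & i2 & l2).
    assert (lt : t1 < t2).
    { apply Rnot_le_lt. intros [l|<-]; [assert (k := M _ _ i2 i1 l)|]; lra. }
    destruct (Ranalysis5.f_interv_is_interv phi t1 t2 x lt) as (t & ht & e).
    - lra.
    - intros s hs. apply continuity_pt_filterlim, (ex_derive_continuous phi).
      exists (dphi s). apply D. exact (inside_between a b t1 t2 s i1 i2 hs).
    - exists t; split; auto. exact (inside_between a b t1 t2 t i1 i2 ht). }
  set (psi := fun x => epsilon (inhabits 0) (fun t => inside a b t /\ phi t = x)).
  assert (P : forall x, inside c d x -> inside a b (psi x) /\ phi (psi x) = x).
  { intros x hx. apply (epsilon_spec (inhabits 0) (fun t => inside a b t /\ phi t = x)), S, hx. }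
  exists c, d, psi. split; auto. intros t ht. split; auto.
  destruct (P (phi t) (I t ht)) as [hi e].
  destruct (Rtotal_order (psi (phi t)) t) as [l|[l|l]]; auto;
    [assert (k := M _ _ hi ht l) | assert (k := M _ _ ht hi l)]; lra.
Qed.

(** * The correspondence between unit speed geodesics *)

(* For the wind A(r) d/dr the one-form of the Randers metric is
   [- d (potential m A)]. *)
Definition potential (m A : R -> R) : R -> R := RInt (fun r => A r / lam m A 0 r) 0.

(** This is alpha for the wind A d/dr, written as an exact change of the navigation metric; its
    closed form is [sym_eq]. [sym_r] and [sym_u] are its partials, while the theta-momentum stays
    [zermelo_v]. *)
Definition sym (m A : R -> R) (r u v : R) : R :=
  zermelo m A 0 r u v + Derive (potential m A) r * u.
Definition sym_r (m A : R -> R) (r u v : R) : R :=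
  zermelo_r m A 0 r u v + Derive (Derive (potential m A)) r * u.
Definition sym_u (m A : R -> R) (r u v : R) : R :=
  zermelo_u m A 0 r u v + Derive (potential m A) r.

Section Correspondence.
Context (m A : R -> R) (B : R) (W : navigation m A B).

Lemma navigation_0 : navigation m A 0.
Proof.
  destruct W as [h1 h2 h3 h4]. constructor; auto. intros r. assert (k := h4 r).
  assert (0 <= (B * m r) ^ 2) by apply pow2_ge_0. nra.
Qed.

Lemma lam_0_pos r : 0 < lam m A 0 r.
Proof. apply lam_pos, navigation_0. Qed.

Lemma potential_smooth : smooth (potential m A) /\
  forall r, Derive (potential m A) r = A r / lam m A 0 r.
Proof.
  assert (S : smooth (fun r => A r / lam m A 0 r)).
  { apply Cn2_smooth_on. intros n. unfold lam.
    assert (C1 := smooth_on_Cn2_y _ _ _ n (nav_A W)).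
    assert (C2 := smooth_on_Cn2_y _ _ _ n (nav_m W)).
    apply Cn2_div; auto using open2_strip.
    - intros x y _. assert (k := lam_0_pos y). unfold lam in k. lra.
    - Cn2_arith; auto using open2_strip. }
  destruct (smooth_RInt _ 0 S) as [S1 D]. split; auto.
  intros r; apply is_derive_unique, D.
Qed.

Lemma sym_eq r u v : sym m A r u v = zroot m A 0 r u v / lam m A 0 r.
Proof.
  unfold sym, zermelo. rewrite (proj2 potential_smooth). unfold wdot.
  assert (k := lam_0_pos r). field; lra.
Qed.

Lemma exact_change_sym_zermelo :
  exact_change (zermelo m A 0) (zermelo_r m A 0) (zermelo_u m A 0) (zermelo_v m A 0)
    (sym m A) (sym_r m A) (sym_u m A) (zermelo_v m A 0) (potential m A).
Proof.
  constructor; auto.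
  - apply regular_zermelo, navigation_0.
  - apply regular_plus_exact.
    + apply regular_zermelo, navigation_0.
    + apply potential_smooth.
    + intros r u v n. fold (sym m A r u v). rewrite sym_eq.
      apply Rdiv_lt_0_compat; [apply zroot_pos; auto; apply navigation_0 | apply lam_0_pos].
  - apply potential_smooth.
Qed.

Let E01 := exact_change_sym_zermelo.
Let E10 := exact_change_sym E01.

(** [zroot] is even in the velocity and [wdot] is odd, so symmetrizing [zermelo] leaves
    [zroot / lam]. *)
Lemma randers_part_sym F a b :
  zermelo_solution (warped_norm m) (fun r _ => A r) (fun _ _ => 0) F a b ->
  a = rotational (sym m A).
Proof.
  intros Z. assert (E := zermelo_solution_unique m A 0 F a b navigation_0 Z).
  rewrite (randers_symmetrize F a b (proj1 Z)), E.
  extensionality r; extensionality th; extensionality u; extensionality v.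
  unfold rotational. rewrite sym_eq. unfold zermelo.
  replace (zroot m A 0 r (- u) (- v)) with (zroot m A 0 r u v).
  - unfold wdot. assert (k := lam_0_pos r). field; lra.
  - unfold zroot, wdot. f_equal. ring.
Qed.

(** The F-length, in closed form, of an alpha-unit speed [rho] from parameter 0 to [x]. *)
Definition travel_time (rho : curve) (x : R) : R :=
  x + (- potential m A (rc rho x) - - potential m A (rc rho 0)).

(** Replaces the length integral by its closed form, and the surjectivity of [s] by the statement
    that [s] and [travel_time rho] are mutually inverse. *)
Lemma corresponds_iff (a b : Rbar) P (c d : Rbar) rho s :
  corresponds (rotational (zermelo m A 0)) (rotational (sym m A)) B a b P c d rho s <->
  inside c d 0 /\ unit_geodesic_on (rotational (sym m A)) c d rho /\
  (forall t, inside a b t -> inside c d (s t) /\ travel_time rho (s t) = t /\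
     P t = (rc rho (s t), thc rho (s t) + B * t)) /\
  (forall x, inside c d x -> inside a b (travel_time rho x) /\ s (travel_time rho x) = x).
Proof.
  assert (L : unit_geodesic_on (rotational (sym m A)) c d rho -> inside c d 0 ->
     forall x, inside c d x -> curve_length (rotational (zermelo m A 0)) rho 0 x = travel_time rho x).
  { intros U h0 x hx. rewrite (curve_length_exact E10 c d rho 0 x U h0 hx).
    unfold travel_time. ring. }
  split.
  - intros (h1 & h2 & U & Hs & Hx). assert (h0 : inside c d 0) by (split; auto).
    assert (Hs' : forall t, inside a b t -> inside c d (s t) /\ travel_time rho (s t) = t /\
      P t = (rc rho (s t), thc rho (s t) + B * t)).
    { intros t [k1 k2]. destruct (Hs t k1 k2) as (k3 & k4 & k5 & k6).
      rewrite L in k5 by (auto; split; auto). split; [split|]; auto. }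
    split; [|split; [|split]]; auto.
    intros x hx; destruct (Hx x (proj1 hx) (proj2 hx)) as (t & k1 & k2 & <-).
    destruct (Hs' t (conj k1 k2)) as (k3 & -> & _). split; auto. split; auto.
  - intros ([h1 h2] & U & Hs & Hx). split; [|split; [|split; [|split]]]; auto.
    + intros t k1 k2. destruct (Hs t (conj k1 k2)) as ([k3 k4] & k5 & k6).
      rewrite L by (auto; split; auto). auto.
    + intros x k1 k2. destruct (Hx x (conj k1 k2)) as ([k3 k4] & k5).
      exists (travel_time rho x); auto.
Qed.

Lemma travel_time_0 rho : travel_time rho 0 = 0.
Proof. unfold travel_time. ring. Qed.

Lemma corresponds_geodesic a b P c d rho s :
  corresponds (rotational (zermelo m A 0)) (rotational (sym m A)) B a b P c d rho s ->
  unit_geodesic_on (rotational (zermelo m A B)) a b P.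
Proof.
  intros C. apply corresponds_iff in C. destruct C as (h0 & U & Hs & Hx).
  assert (U0 : unit_geodesic_on (rotational (zermelo m A 0)) a b (fun t => rho (s t))).
  { apply (unit_geodesic_exact E10 c d rho a b s (- potential m A (rc rho 0))); auto.
    intros t ht. destruct (Hs t ht) as (k1 & k2 & _). auto. }
  apply (unit_geodesic_wind m A 0 B a b _ navigation_0 W) in U0.
  apply (unit_geodesic_ext _ _ _ _ a b _ P (regular_zermelo m A B W)) with (2 := U0).
  intros t ht. destruct (Hs t ht) as (_ & _ & ->). rewrite Rminus_0_r. reflexivity.
Qed.

Lemma geodesic_corresponds a b P : inside a b 0 ->
  unit_geodesic_on (rotational (zermelo m A B)) a b P ->
  exists (c d : Rbar) (rho : curve) (s : R -> R),
    corresponds (rotational (zermelo m A 0)) (rotational (sym m A)) B a b P c d rho s.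
Proof.
  intros h0 U. apply (unit_geodesic_wind m A B 0 a b _ W navigation_0) in U.
  set (Q := fun t => (rc P t, thc P t + (0 - B) * t)) in *.
  (* The alpha-length of [Q], which is [P] with the drift removed. It plays the role of [s], and
     [rho] is [Q] reparametrized by its inverse. *)
  set (phi := fun t => t + (potential m A (rc Q t) - potential m A (rc Q 0))).
  destruct (increasing_inverse a b phi (at_velocity (sym m A) Q)) as (M & c & d & psi & I1 & I2).
  { intros t ht. destruct (unit_geodesic_velocity E01 a b Q t U ht) as [V1 V2].
    split; auto. apply (height_derive E01 a b); auto. apply U. }
  assert (P0 : phi 0 = 0) by (unfold phi; ring).
  assert (psi0 : psi 0 = 0) by (rewrite <- P0 at 1; apply I1; auto).
  exists c, d, (fun x => Q (psi x)), phi. apply corresponds_iff.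
  assert (T : forall t, inside a b t -> travel_time (fun x => Q (psi x)) (phi t) = t).
  { intros t ht. unfold travel_time, rc. rewrite psi0, (proj2 (I1 t ht)). unfold phi, rc. ring. }
  split; [|split; [|split]].
  - rewrite <- P0. apply I1; auto.
  - apply (unit_geodesic_exact E01 a b Q c d psi (potential m A (rc Q 0))); auto.
  - intros t ht. destruct (I1 t ht) as [k1 k2]. split; auto. split; auto.
    unfold rc, thc. rewrite k2. unfold Q; simpl. rewrite (surjective_pairing (P t)) at 1.
    unfold rc, thc. f_equal. ring.
  - intros x hx. destruct (I2 x hx) as [k1 k2]. rewrite <- k2, T; auto.
Qed.

Lemma corresponds_geodesic_exists c d rho : inside c d 0 ->
  unit_geodesic_on (rotational (sym m A)) c d rho ->
  exists (a b : Rbar) (P : curve) (s : R -> R), inside a b 0 /\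
    corresponds (rotational (zermelo m A 0)) (rotational (sym m A)) B a b P c d rho s.
Proof.
  intros h0 U.
  destruct (increasing_inverse c d (travel_time rho) (at_velocity (zermelo m A 0) rho))
    as (M & a & b & s & I1 & I2).
  { intros t ht. destruct (unit_geodesic_velocity E10 c d rho t U ht) as [V1 V2].
    split; auto. apply (height_derive E10 c d); auto. apply U. }
  exists a, b, (fun t => (rc rho (s t), thc rho (s t) + B * t)), s. split.
  - rewrite <- (travel_time_0 rho). apply I1; auto.
  - apply corresponds_iff. split; [|split; [|split]]; auto.
    intros t ht. destruct (I2 t ht) as [k1 k2]. auto.
Qed.

End Correspondence.

(** * Distance *)

Lemma same_point_refl p : same_point p p.
Proof. split; auto. exists 0%Z. simpl. ring. Qed.

Lemma same_point_sym p q : same_point p q -> same_point q p.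
Proof.
  intros [e [k E]]. split; auto. exists (- k)%Z. rewrite opp_IZR, E. ring.
Qed.

Lemma same_point_trans p q r : same_point p q -> same_point q r -> same_point p r.
Proof.
  intros [e [k E]] [e' [k' E']]. split; [congruence|]. exists (k + k')%Z.
  rewrite plus_IZR, E, E'. ring.
Qed.

Definition rotate (p : point) (x : R) : point := (fst p, snd p + x).

Lemma same_point_rotate p q x : same_point p q -> same_point (rotate p x) (rotate q x).
Proof. intros [e [k E]]. split; auto. exists k. simpl. rewrite E. ring. Qed.

(* Chains of smooth arcs; the indices are the end points and the length. *)
Inductive reach (F : metric) : point -> point -> R -> Prop :=
| reach_arc e1 e2 x0 x1 p q :
    smooth e1 -> smooth e2 -> x0 < x1 ->
    same_point (e1 x0, e2 x0) p -> same_point (e1 x1, e2 x1) q ->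
    reach F p q (curve_length F (fun x => (e1 x, e2 x)) x0 x1)
| reach_trans p q r L1 L2 : reach F p q L1 -> reach F q r L2 -> reach F p r (L1 + L2).

Lemma reach_same F p q p' q' L : same_point p p' -> same_point q q' ->
  reach F p q L -> reach F p' q' L.
Proof.
  intros hp hq H; revert p' q' hp hq; induction H; intros p' q' hp hq.
  - apply reach_arc; eauto using same_point_trans.
  - apply reach_trans with q; eauto using same_point_refl.
Qed.

(* The continuity includes points of zero velocity. *)
Definition continuous_metric (F : R -> R -> R -> R) : Prop :=
  forall a b c t, smooth_on a b (rc c) -> smooth_on a b (thc c) -> inside a b t ->
    continuous (at_velocity F c) t.

Lemma continuous_arc F e1 e2 x : continuous_metric F -> smooth e1 -> smooth e2 ->
  continuous (at_velocity F (fun x => (e1 x, e2 x))) x.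
Proof. intros CF S1 S2. apply (CF m_infty p_infty); auto. split; exact I. Qed.

Section Distance.
Context (F Fr Fu Fv : R -> R -> R -> R) (HF : regular F Fr Fu Fv) (CF : continuous_metric F).

Lemma reach_rotate p q L x : reach (rotational F) p q L ->
  reach (rotational F) (rotate p x) (rotate q x) L.
Proof.
  intros H; induction H.
  - replace (curve_length (rotational F) (fun x => (e1 x, e2 x)) x0 x1)
      with (curve_length (rotational F) (fun y => (e1 y, e2 y + x)) x0 x1).
    + apply reach_arc with (e2 := fun y => e2 y + x); auto.
      * smooth_arith.
      * apply (same_point_rotate (e1 x0, e2 x0) p x); auto.
      * apply (same_point_rotate (e1 x1, e2 x1) q x); auto.
    + apply RInt_ext. intros y _. unfold along, rotational. f_equal.
      apply is_derive_unique. evar_last.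
      * apply @is_derive_plus; [apply (smooth_is_derive e2); assumption | apply is_derive_const_R].
      * exact (Rplus_0_r _).
  - apply reach_trans with (rotate q x); auto.
Qed.

Lemma reach_pos p q L : reach (rotational F) p q L -> 0 <= L.
Proof.
  intros H; induction H; [|lra].
  unfold curve_length.
  replace 0 with (RInt (fun _ => 0) x0 x1) by (rewrite RInt_const; exact (Rmult_0_r _)).
  apply RInt_le; [lra | apply ex_RInt_const | | ].
  - apply (ex_RInt_continuous (V := R_CompleteNormedModule)). intros; apply continuous_arc; auto.
  - intros x _. unfold along, rotational.
    destruct (excluded_middle_informative ((Derive (rc (fun x => (e1 x, e2 x))) x,
      Derive (thc (fun x => (e1 x, e2 x))) x) = (0, 0))) as [e|e].
    + injection e; intros -> ->. rewrite (reg_zero HF). lra.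
    + left; apply (reg_pos HF); auto.
Qed.

Lemma reach_exists p q : exists L, reach (rotational F) p q L.
Proof.
  eexists. apply (reach_arc _ (fun x => fst p + x * (fst q - fst p))
    (fun x => snd p + x * (snd q - snd p)) 0 1); try lra.
  1, 2: smooth_arith.
  - split; [simpl; ring | exists 0%Z; simpl; ring].
  - split; [simpl; ring | exists 0%Z; simpl; ring].
Qed.

Lemma arc_length c e1 e2 x0 x1 : smooth e1 -> smooth e2 -> x0 < x1 ->
  (forall x, x0 <= x <= x1 -> c x = (e1 x, e2 x)) ->
  ex_RInt (along (rotational F) c) x0 x1 /\
  curve_length (rotational F) c x0 x1 = curve_length (rotational F) (fun x => (e1 x, e2 x)) x0 x1.
Proof.
  intros S1 S2 lt E.
  assert (A : forall x, Rmin x0 x1 < x < Rmax x0 x1 ->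
    at_velocity F (fun x => (e1 x, e2 x)) x = at_velocity F c x).
  { rewrite Rmin_left, Rmax_right by lra. intros x hx. symmetry.
    apply (at_velocity_ext x0 x1); [|exact hx].
    intros s [h1 h2]; simpl in h1, h2. apply E; lra. }
  split.
  - apply ex_RInt_ext with (at_velocity F (fun x => (e1 x, e2 x))); auto.
    apply (ex_RInt_continuous (V := R_CompleteNormedModule)). intros; apply continuous_arc; auto.
  - apply RInt_ext. intros; symmetry; apply A; auto.
Qed.

Lemma piecewise_reach c a b : piecewise_smooth c a b ->
  ex_RInt (along (rotational F) c) a b /\
  reach (rotational F) (c a) (c b) (curve_length (rotational F) c a b).
Proof.
  intros (lt & n & t & <- & <- & H).
  destruct n as [|n]; [lra|]. clear lt.
  induction n as [|n IH].
  - destruct (H 0%nat) as (lt & e1 & e2 & S1 & S2 & E); [lia|].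
    destruct (arc_length c e1 e2 _ _ S1 S2 lt E) as [I ->]. split; auto.
    apply reach_arc; auto; rewrite E by lra; apply same_point_refl.
  - destruct IH as [I1 R1]; [intros; apply H; lia|].
    destruct (H (S n)) as (lt & e1 & e2 & S1 & S2 & E); [lia|].
    destruct (arc_length c e1 e2 _ _ S1 S2 lt E) as [I2 Q].
    split; [exact (ex_RInt_Chasles _ _ _ _ I1 I2)|].
    unfold curve_length. rewrite <- (RInt_Chasles _ _ _ _ I1 I2).
    apply reach_trans with (1 := R1).
    fold (curve_length (rotational F) c (t (S n)) (t (S (S n)))). rewrite Q.
    apply reach_arc; auto; rewrite E by lra; apply same_point_refl.
Qed.

(** End points match only modulo 2 PI, whereas a curve is given by a continuous lift. The new arc is
    therefore shifted by [K] in theta and by [x0 - b] in the parameter; its length is kept, as the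
    metric does not depend on theta. *)
Lemma piecewise_snoc c a b e1 e2 x0 x1 :
  piecewise_smooth c a b -> smooth e1 -> smooth e2 -> x0 < x1 ->
  same_point (c b) (e1 x0, e2 x0) ->
  exists c' b', piecewise_smooth c' a b' /\ c' a = c a /\
    same_point (c' b') (e1 x1, e2 x1) /\
    curve_length (rotational F) c' a b' =
      curve_length (rotational F) c a b + curve_length (rotational F) (fun x => (e1 x, e2 x)) x0 x1.
Proof.
  intros P S1 S2 lt [E1 [k E2]]. simpl in E1, E2. set (K := 2 * PI * IZR k) in *.
  assert (ab := proj1 P). assert (I := proj1 (piecewise_reach c a b P)).
  set (f1 := fun x => e1 (x + (x0 - b))). set (f2 := fun x => e2 (x + (x0 - b)) + K).
  assert (Sh : smooth (fun x => x + (x0 - b))).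
  { smooth_arith. }
  assert (S1' : smooth f1).
  { apply (smooth_on_comp m_infty p_infty m_infty p_infty e1); auto. }
  assert (S2' : smooth f2).
  { smooth_arith.
    apply (smooth_on_comp m_infty p_infty m_infty p_infty e2); auto. }
  set (c' := fun x => if Rle_dec x b then c x else (f1 x, f2 x)).
  assert (C1 : forall x, x <= b -> c' x = c x).
  { intros x h. unfold c'. destruct (Rle_dec x b); [auto | lra]. }
  assert (C2 : forall x, b <= x -> c' x = (f1 x, f2 x)).
  { intros x h. unfold c'. destruct (Rle_dec x b); auto.
    replace x with b by lra. unfold f1, f2. replace (b + (x0 - b)) with x0 by ring.
    rewrite <- E1, <- E2. apply surjective_pairing. }
  set (b' := b + (x1 - x0)).
  exists c', b'.
  destruct P as (_ & n & t & t0 & tn & H).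
  assert (Tb : forall i, (i <= n)%nat -> t i <= b).
  { intros i hi. rewrite <- tn. clear - H hi. induction n as [|n IH].
    - replace i with 0%nat by lia. lra.
    - destruct (Nat.eq_dec i (S n)) as [->|ne]; [lra|].
      apply Rle_trans with (t n); [apply IH; [|lia]; intros; apply H; lia|].
      left; apply H; lia. }
  assert (A2 : ex_RInt (along (rotational F) c') b b' /\
    curve_length (rotational F) c' b b' = curve_length (rotational F) (fun x => (f1 x, f2 x)) b b').
  { apply arc_length; auto; [unfold b'; lra|]. intros x hx; apply C2; lra. }
  assert (A1 : forall x, Rmin a b < x < Rmax a b -> along (rotational F) c x = along (rotational F) c' x).
  { rewrite Rmin_left, Rmax_right by lra. intros x hx.
    apply (at_velocity_ext a b); [|exact hx].
    intros s [h1 h2]; simpl in h1, h2. symmetry; apply C1; lra. }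
  split; [|split; [|split]].
  - split; [unfold b'; lra|].
    exists (S n), (fun i => if le_dec i n then t i else b').
    split; [destruct (le_dec 0 n); [auto | lia]|].
    split; [destruct (le_dec (S n) n); [lia | auto]|].
    intros i hi. destruct (le_dec i n) as [l|l]; [|lia].
    destruct (le_dec (S i) n) as [l2|l2].
    + destruct (H i l2) as (h & g1 & g2 & G1 & G2 & G). split; auto.
      exists g1, g2. split; auto. split; auto. intros x hx. rewrite C1; auto.
      apply Rle_trans with (t (S i)); [lra | apply Tb; auto].
    + replace i with n by lia. rewrite tn. split; [unfold b'; lra|].
      exists f1, f2. split; auto. split; auto. intros x hx; apply C2; lra.
  - apply C1; lra.
  - rewrite C2 by (unfold b'; lra). unfold f1, f2, b'.
    replace (b + (x1 - x0) + (x0 - b)) with x1 by ring.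
    split; auto. exists k; auto.
  - unfold curve_length at 1. rewrite <- (RInt_Chasles _ a b b');
      [| apply ex_RInt_ext with (2 := I); auto | apply A2].
    unfold plus; simpl. f_equal.
    + apply RInt_ext. intros; symmetry; auto.
    + etransitivity; [apply A2|]. unfold curve_length.
      transitivity (RInt (fun x => scal 1 (along (rotational F) (fun x => (e1 x, e2 x)) (1 * x + (x0 - b)))) b b').
      * apply RInt_ext. intros x _. unfold scal; simpl; unfold mult; simpl. rewrite !Rmult_1_l.
        unfold along, rotational, rc, thc; simpl. f_equal.
        -- rewrite (Derive_ext _ f1) by reflexivity. unfold f1.
           apply is_derive_unique.
           replace (Derive (fun t => e1 t) (x + (x0 - b))) with (1 * Derive e1 (x + (x0 - b))) by (rewrite Rmult_1_l; reflexivity).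
           apply (is_derive_comp e1 (fun x => x + (x0 - b))); [apply smooth_is_derive; auto|].
           auto_derive; auto.
        -- unfold f2. apply is_derive_unique.
           replace (Derive (fun t => e2 t) (x + (x0 - b))) with (1 * Derive e2 (x + (x0 - b)) + 0) by (rewrite Rmult_1_l, Rplus_0_r; reflexivity).
           apply @is_derive_plus; [|apply is_derive_const_R].
           apply (is_derive_comp e2 (fun x => x + (x0 - b))); [apply smooth_is_derive; auto|].
           auto_derive; auto.
      * etransitivity; [apply (RInt_comp_lin (along (rotational F) (fun x => (e1 x, e2 x))) 1 (x0 - b) b b')|].
        2: f_equal; unfold b'; ring.
        apply (ex_RInt_continuous (V := R_CompleteNormedModule)). intros; apply continuous_arc; auto.
Qed.

(** Generalized over an initial curve, so that the two halves of a composite chain can be appended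
    one after the other. *)
Lemma reach_extend p q L : reach (rotational F) p q L -> forall c a b,
  piecewise_smooth c a b -> same_point (c b) p ->
  exists c' b', piecewise_smooth c' a b' /\ c' a = c a /\ same_point (c' b') q /\
    curve_length (rotational F) c' a b' = curve_length (rotational F) c a b + L.
Proof.
  intros H; induction H; intros c a b P E.
  - destruct (piecewise_snoc c a b e1 e2 x0 x1) as (c' & b' & P' & h1 & h2 & h3);
      eauto using same_point_trans, same_point_sym.
    exists c', b'; eauto using same_point_trans.
  - destruct (IHreach1 c a b P E) as (c1 & b1 & P1 & i1 & i2 & i3).
    destruct (IHreach2 c1 a b1 P1 i2) as (c2 & b2 & P2 & j1 & j2 & j3).
    exists c2, b2. split; auto. split; [congruence|]. split; auto. lra.
Qed.

Lemma reach_piecewise p q L : reach (rotational F) p q L -> exists c a b,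
  piecewise_smooth c a b /\ same_point (c a) p /\ same_point (c b) q /\
  L = curve_length (rotational F) c a b.
Proof.
  intros H; induction H.
  - exists (fun x => (e1 x, e2 x)), x0, x1. split; auto. split; auto.
    exists 1%nat, (fun i => match i with O => x0 | _ => x1 end). split; auto. split; auto.
    intros i hi. replace i with 0%nat by lia. split; auto. exists e1, e2; auto.
  - destruct IHreach1 as (c & a & b & P & h1 & h2 & ->).
    destruct (reach_extend q r L2 H0 c a b P h2) as (c' & b' & P' & i1 & i2 & i3).
    exists c', a, b'. split; auto. rewrite i1. auto.
Qed.

(** [finsler_dist] takes the real part of an infimum in [Rbar]. The infimum is finite because
    lengths are nonnegative and any two points are joined by an arc. *)
Lemma finsler_dist_glb p q :
  is_glb_Rbar (reach (rotational F) p q) (Finite (finsler_dist (rotational F) p q)).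
Proof.
  unfold finsler_dist.
  set (E := fun L : R => exists (c : curve) (a b : R), _).
  assert (EE : forall L, E L <-> reach (rotational F) p q L).
  { intros L; split; [|apply reach_piecewise].
    intros (c & a & b & P & h1 & h2 & ->). apply reach_same with (c a) (c b); auto.
    apply piecewise_reach, P. }
  rewrite (Glb_Rbar_eqset _ _ EE).
  destruct (Glb_Rbar_correct (reach (rotational F) p q)) as [h1 h2].
  destruct (reach_exists p q) as [L HL].
  assert (lo := h2 (Finite 0) (fun x hx => reach_pos p q x hx)). assert (up := h1 L HL).
  destruct (Glb_Rbar (reach (rotational F) p q)) as [g| |]; simpl in *; try contradiction.
  split; auto.
Qed.

Lemma dist_le p q L : reach (rotational F) p q L -> finsler_dist (rotational F) p q <= L.
Proof. apply (proj1 (finsler_dist_glb p q)). Qed.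

Lemma dist_lt_reach p q l : finsler_dist (rotational F) p q < l ->
  exists L, reach (rotational F) p q L /\ L < l.
Proof.
  intros H. apply NNPP. intros n. apply (Rlt_not_le _ _ H).
  apply (proj2 (finsler_dist_glb p q) (Finite l)).
  intros L HL. simpl. apply Rnot_lt_le. intros c. apply n. eauto.
Qed.

Lemma dist_triangle p q r : finsler_dist (rotational F) p r <=
  finsler_dist (rotational F) p q + finsler_dist (rotational F) q r.
Proof.
  apply le_epsilon. intros e He.
  destruct (dist_lt_reach p q (finsler_dist (rotational F) p q + e / 2)) as (L1 & H1 & l1); [lra|].
  destruct (dist_lt_reach q r (finsler_dist (rotational F) q r + e / 2)) as (L2 & H2 & l2); [lra|].
  assert (k := dist_le _ _ _ (reach_trans _ _ _ _ _ _ H1 H2)). lra.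
Qed.

Lemma dist_same p q p' q' : same_point p p' -> same_point q q' ->
  finsler_dist (rotational F) p q = finsler_dist (rotational F) p' q'.
Proof.
  intros hp hq. unfold finsler_dist. f_equal. apply Glb_Rbar_eqset.
  intros L; split; intros (c & a & b & P & h1 & h2 & ->); exists c, a, b;
    repeat split; try apply P; eauto using same_point_trans, same_point_sym;
    try apply (same_point_trans _ _ _ h1); try apply (same_point_trans _ _ _ h2);
    auto using same_point_sym.
Qed.

(** Serves to correct small displacements of an end point along its parallel. *)
Lemma reach_parallel q x d : 0 < d ->
  reach (rotational F) q (rotate q (x * d)) (F (fst q) 0 x * d).
Proof.
  intros hd.
  replace (F (fst q) 0 x * d) with
    (curve_length (rotational F) (fun t => (fst q, snd q + x * t)) 0 d).
  - apply reach_arc with (e1 := fun _ => fst q) (e2 := fun t => snd q + x * t); auto.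
    + smooth_arith.
    + smooth_arith.
    + split; auto. exists 0%Z; simpl; ring.
    + apply same_point_refl.
  - unfold curve_length. rewrite (RInt_ext _ (fun _ => F (fst q) 0 x)).
    + rewrite RInt_const. unfold scal; simpl; unfold mult; simpl. ring.
    + intros t _. unfold along, rotational, rc, thc; simpl. f_equal.
      * apply Derive_const.
      * apply is_derive_unique. auto_derive; auto. ring.
Qed.

Lemma unit_curve_length a b c s t : unit_geodesic_on (rotational F) a b c ->
  inside a b s -> inside a b t -> curve_length (rotational F) c s t = t - s.
Proof.
  intros [_ U] hs ht. unfold curve_length. rewrite (RInt_ext _ (fun _ => 1)).
  - rewrite RInt_const. unfold scal; simpl; unfold mult; simpl. ring.
  - intros x hx. apply U; apply (inside_segment a b s t x hs ht); lra.
Qed.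

Lemma minimizing_unit a b c t : unit_geodesic_on (rotational F) a b c ->
  inside a b 0 -> inside a b t ->
  (minimizing (rotational F) c t <-> finsler_dist (rotational F) (c 0) (c t) = t).
Proof.
  intros U h0 ht. unfold minimizing. rewrite (unit_curve_length a b) by auto.
  rewrite Rminus_0_r. split; auto.
Qed.

End Distance.

(** * Distances under a change of wind *)

Lemma smooth_on_continuous a b f x : smooth_on a b f -> inside a b x -> continuous f x.
Proof.
  intros S h. apply (ex_derive_continuous f). eexists; apply (inside_derive a b f x S h).
Qed.

Lemma smooth_continuous f x : smooth f -> continuous f x.
Proof. intros S. apply (smooth_on_continuous m_infty p_infty); auto. split; exact I. Qed.

Lemma smooth_velocity a b e n : smooth_on a b e -> Cn2_on n (strip a b) (fun _ t => Derive e t).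
Proof. intros S; apply smooth_on_Cn2_y, smooth_on_Derive, S. Qed.

Section Wind.
Context (m A : R -> R) (B : R) (W : navigation m A B).

(* The metric is not smooth at zero velocity, where the lift of a curve by its length
   would fail to be smooth; this is a smooth upper approximation. *)
Definition zermelo_smooth (eta r u v : R) : R :=
  (sqrt (lam m A B r * (u ^ 2 + m r ^ 2 * v ^ 2) + wdot m A B r u v ^ 2 + (eta * lam m A B r) ^ 2)
   - wdot m A B r u v) / lam m A B r.

Lemma zroot_arg_nonneg r u v :
  wdot m A B r u v ^ 2 <= lam m A B r * (u ^ 2 + m r ^ 2 * v ^ 2) + wdot m A B r u v ^ 2.
Proof.
  assert (h := lam_pos m A B W r).
  assert (0 <= u ^ 2) by apply pow2_ge_0. assert (0 <= (m r * v) ^ 2) by apply pow2_ge_0. nra.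
Qed.

(** The perturbation under the root is scaled by [lam], so that after division by [lam] the error is
    at most [eta], uniformly in the point and the velocity. *)
Lemma zermelo_smooth_bounds eta r u v : 0 < eta ->
  zermelo m A B r u v <= zermelo_smooth eta r u v <= zermelo m A B r u v + eta.
Proof.
  intros he. assert (h := lam_pos m A B W r). assert (n := zroot_arg_nonneg r u v).
  unfold zermelo, zermelo_smooth. fold (zroot m A B r u v).
  set (a := lam m A B r * (u ^ 2 + m r ^ 2 * v ^ 2) + wdot m A B r u v ^ 2) in *.
  assert (a0 : 0 <= a) by (assert (k := pow2_ge_0 (wdot m A B r u v)); lra).
  assert (b0 : 0 <= (eta * lam m A B r) ^ 2) by apply pow2_ge_0.
  assert (L : zroot m A B r u v <= sqrt (a + (eta * lam m A B r) ^ 2)) by (apply (sqrt_le_1 a); lra).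
  assert (U : sqrt (a + (eta * lam m A B r) ^ 2) <= zroot m A B r u v + eta * lam m A B r).
  { assert (s := sqrt_pos a : 0 <= zroot m A B r u v).
    assert (q := pow2_sqrt a a0 : zroot m A B r u v ^ 2 = a).
    assert (el : 0 < eta * lam m A B r) by (apply Rmult_lt_0_compat; auto).
    rewrite <- (sqrt_pow2 (zroot m A B r u v + eta * lam m A B r)) by lra.
    apply sqrt_le_1; [lra | apply pow2_ge_0 | nra]. }
  split.
  - apply Rmult_le_compat_r; [left; apply Rinv_0_lt_compat; auto | lra].
  - apply Rmult_le_reg_r with (lam m A B r); auto. field_simplify; lra.
Qed.

Lemma zermelo_smooth_pos eta r u v : 0 < eta -> 0 < zermelo_smooth eta r u v.
Proof.
  intros he. assert (h := lam_pos m A B W r). assert (n := zroot_arg_nonneg r u v).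
  unfold zermelo_smooth.
  set (a := lam m A B r * (u ^ 2 + m r ^ 2 * v ^ 2) + wdot m A B r u v ^ 2) in *.
  apply Rdiv_lt_0_compat; auto. apply Rlt_0_minus.
  apply Rle_lt_trans with (sqrt (wdot m A B r u v ^ 2)).
  - replace (wdot m A B r u v ^ 2) with (Rsqr (wdot m A B r u v)) by (unfold Rsqr; ring).
    rewrite sqrt_Rsqr_abs. apply Rle_abs.
  - assert (0 < (eta * lam m A B r) ^ 2) by (apply pow_lt, Rmult_lt_0_compat; auto).
    apply sqrt_lt_1; try lra. apply pow2_ge_0. assert (k := pow2_ge_0 (wdot m A B r u v)). lra.
Qed.

Lemma zermelo_smooth_smooth a b eta e1 e2 : 0 < eta -> smooth_on a b e1 -> smooth_on a b e2 ->
  smooth_on a b (fun t => zermelo_smooth eta (e1 t) (Derive e1 t) (Derive e2 t)).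
Proof.
  intros he S1 S2. apply Cn2_smooth_on. intros n.
  assert (o := open2_strip a b).
  assert (C0 := smooth_on_Cn2_y _ _ _ n S1).
  assert (C1 := smooth_velocity a b e1 n S1). assert (C2 := smooth_velocity a b e2 n S2).
  assert (Cm : Cn2_on n (strip a b) (fun _ t => m (e1 t))).
  { apply (smooth_comp (strip a b) m (fun _ t => e1 t)); auto. apply W.
    intros k; apply smooth_on_Cn2_y, S1. }
  assert (CA : Cn2_on n (strip a b) (fun _ t => A (e1 t))).
  { apply (smooth_comp (strip a b) A (fun _ t => e1 t)); auto. apply W.
    intros k; apply smooth_on_Cn2_y, S1. }
  unfold zermelo_smooth. apply Cn2_div; auto.
  - intros x y _. assert (h := lam_pos m A B W (e1 y)). lra.
  - apply Cn2_minus; auto.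
    + apply Cn2_sqrt; auto.
      * intros x y _. assert (h := lam_pos m A B W (e1 y)).
        assert (n' := zroot_arg_nonneg (e1 y) (Derive e1 y) (Derive e2 y)).
        assert (k := pow2_ge_0 (wdot m A B (e1 y) (Derive e1 y) (Derive e2 y))).
        assert (0 < (eta * lam m A B (e1 y)) ^ 2) by (apply pow_lt, Rmult_lt_0_compat; auto). lra.
      * unfold lam, wdot. Cn2_arith.
    + unfold wdot. Cn2_arith.
  - unfold lam. Cn2_arith.
Qed.

(** A uniform limit of the smooth functions [zermelo_smooth], hence continuous even where the
    velocity vanishes. *)
Lemma continuous_zermelo : continuous_metric (zermelo m A B).
Proof.
  intros a b c x S1 S2 hx. unfold at_velocity.
  set (e1 := rc c) in *. set (e2 := thc c) in *.
  assert (Q : forall eps : posreal, locally x (fun t =>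
    Rabs (zermelo m A B (e1 t) (Derive e1 t) (Derive e2 t)
          - zermelo m A B (e1 x) (Derive e1 x) (Derive e2 x)) < eps)).
  { intros eps. assert (ep := cond_pos eps). set (eta := eps / 4).
    assert (he : 0 < eta) by (unfold eta; lra).
    assert (C := smooth_on_continuous a b _ x (zermelo_smooth_smooth a b eta e1 e2 he S1 S2) hx).
    assert (C' := proj1 (filterlim_locally _ _) C (mkposreal eta he)).
    revert C'. apply filter_imp. intros t ht.
    rewrite ball_Rabs in ht. simpl in ht.
    assert (b1 := zermelo_smooth_bounds eta (e1 t) (Derive e1 t) (Derive e2 t) he).
    assert (b2 := zermelo_smooth_bounds eta (e1 x) (Derive e1 x) (Derive e2 x) he).
    apply Rabs_def2 in ht. unfold eta in *. apply Rabs_def1; lra. }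
  apply filterlim_locally. exact Q.
Qed.

(** The sublevel set is the h-disc of radius [w] centred at [w W]. In this form a bound on the speed
    is merely translated when the wind changes. *)
Lemma zermelo_le_iff r u v w : 0 < w ->
  (zermelo m A B r u v <= w <-> (u - w * A r) ^ 2 + m r ^ 2 * (v - w * B) ^ 2 <= w ^ 2).
Proof.
  intros P. assert (h := lam_pos m A B W r). assert (g := zermelo_square_gap m A B W r u v w).
  assert (z := zroot_zermelo m A B W r u v).
  assert (s := sqrt_pos _ : 0 <= zroot m A B r u v).
  split; intros E.
  - assert (zroot m A B r u v <= lam m A B r * w + wdot m A B r u v) by nra.
    assert (0 <= lam m A B r * (w ^ 2 - ((u - w * A r) ^ 2 + m r ^ 2 * (v - w * B) ^ 2))) by nra.
    apply Rnot_lt_le. intros c. nra.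
  - assert (p := zroot_le_pos m A B W r u v w P E).
    assert (0 <= lam m A B r * (w ^ 2 - ((u - w * A r) ^ 2 + m r ^ 2 * (v - w * B) ^ 2)))
      by (apply Rmult_le_pos; lra).
    assert (zroot m A B r u v <= lam m A B r * w + wdot m A B r u v) by nra.
    apply Rmult_le_reg_l with (lam m A B r); auto. lra.
Qed.

Lemma zermelo_lt r u v w : 0 < w ->
  (u - w * A r) ^ 2 + m r ^ 2 * (v - w * B) ^ 2 < w ^ 2 -> zermelo m A B r u v < w.
Proof.
  intros P E. assert (h := lam_pos m A B W r). assert (g := zermelo_square_gap m A B W r u v w).
  assert (z := zroot_zermelo m A B W r u v).
  assert (s := sqrt_pos _ : 0 <= zroot m A B r u v).
  assert (p := zroot_le_pos m A B W r u v w P (Rlt_le _ _ E)).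
  assert (0 < lam m A B r * (w ^ 2 - ((u - w * A r) ^ 2 + m r ^ 2 * (v - w * B) ^ 2)))
      by (apply Rmult_lt_0_compat; lra).
  assert (zroot m A B r u v < lam m A B r * w + wdot m A B r u v) by nra.
  apply Rmult_lt_reg_l with (lam m A B r); auto. lra.
Qed.

End Wind.

Section TwoWinds.
Context (m A : R -> R) (B1 B2 : R) (W1 : navigation m A B1) (W2 : navigation m A B2).

(** The drift minus the second wind is the vector [(- A, - B1)], shorter than 1. The strict
    inequality pays for the approximation errors in [dist_wind_lt]. *)
Lemma drift_cost r : zermelo m A B2 r 0 (B2 - B1) < 1.
Proof.
  apply zermelo_lt; auto; [lra|]. assert (k := nav_mild W1 r).
  replace ((0 - 1 * A r) ^ 2 + m r ^ 2 * (B2 - B1 - 1 * B2) ^ 2)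
    with (A r ^ 2 + B1 ^ 2 * m r ^ 2) by ring. lra.
Qed.

(* A curve of B1-speed at most w, carried by the additional wind B2 - B1 for the
   same time, has B2-speed at most w. *)
Lemma reach_wind p q L : reach (rotational (zermelo m A B1)) p q L -> forall eps, 0 < eps ->
  exists T L', reach (rotational (zermelo m A B2)) p (rotate q ((B2 - B1) * T)) L' /\
    L' <= T /\ T <= L + eps.
Proof.
  intros H; induction H; intros eps Heps.
  (* An excess of [eta] in speed adds [eps] to the time over the whole arc. [w] bounds the B1-speed
     from above, [T] is the time elapsed at that rate, and [f] adds the drift for that time. *)
  - set (eta := eps / (x1 - x0)).
    assert (he : 0 < eta) by (apply Rdiv_lt_0_compat; lra).
    set (w := fun t => zermelo_smooth m A B1 eta (e1 t) (Derive e1 t) (Derive e2 t)).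
    assert (Sw : smooth w) by (apply zermelo_smooth_smooth; auto).
    destruct (smooth_RInt w x0 Sw) as [ST DT]. set (T := RInt w x0) in *.
    set (f := fun x => e2 x + (B2 - B1) * T x).
    assert (Sf : smooth f).
    { smooth_arith. }
    assert (Df : forall x, Derive f x = Derive e2 x + (B2 - B1) * w x).
    { intros x. apply is_derive_unique. apply @is_derive_plus; [apply smooth_is_derive; auto|].
      apply @is_derive_scal. apply DT. }
    assert (I : forall g, smooth g -> ex_RInt g x0 x1).
    { intros g Sg. apply (ex_RInt_continuous (V := R_CompleteNormedModule)).
      intros; apply smooth_continuous; auto. }
    assert (I1 : ex_RInt (along (rotational (zermelo m A B1)) (fun x => (e1 x, e2 x))) x0 x1).
    { apply (ex_RInt_continuous (V := R_CompleteNormedModule)).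
      intros; apply (continuous_arc (zermelo m A B1)); auto; apply continuous_zermelo; auto. }
    assert (I2 : ex_RInt (along (rotational (zermelo m A B2)) (fun x => (e1 x, f x))) x0 x1).
    { apply (ex_RInt_continuous (V := R_CompleteNormedModule)).
      intros; apply (continuous_arc (zermelo m A B2)); auto; apply continuous_zermelo; auto. }
    exists (T x1), (curve_length (rotational (zermelo m A B2)) (fun x => (e1 x, f x)) x0 x1).
    split; [|split].
    + apply reach_arc with (e2 := f); auto.
      * unfold f, T. rewrite RInt_point. unfold zero; simpl. rewrite Rmult_0_r, Rplus_0_r. auto.
      * apply (same_point_rotate (e1 x1, e2 x1) q); auto.
    + apply RInt_le; auto; [lra|]. intros x _. unfold along, rotational, rc, thc; simpl.
      change (Derive (fun t => f t) x) with (Derive f x). rewrite Df.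
      assert (wp : 0 < w x) by (apply zermelo_smooth_pos; auto).
      apply zermelo_le_iff; auto.
      assert (E : zermelo m A B1 (e1 x) (Derive e1 x) (Derive e2 x) <= w x)
        by (apply zermelo_smooth_bounds; auto).
      apply zermelo_le_iff in E; auto.
      change (Derive (fun t => e1 t) x) with (Derive e1 x).
      replace (Derive e2 x + (B2 - B1) * w x - w x * B2) with (Derive e2 x - w x * B1) by ring.
      exact E.
    + apply Rle_trans with (RInt (fun x => along (rotational (zermelo m A B1)) (fun x => (e1 x, e2 x)) x + eta) x0 x1).
      * apply RInt_le; auto; [lra | |].
        -- apply (ex_RInt_plus (V := R_NormedModule)); auto. apply ex_RInt_const.
        -- intros x _. apply (zermelo_smooth_bounds m A B1); auto.
      * right. etransitivity; [apply (RInt_plus (V := R_CompleteNormedModule) (along (rotational (zermelo m A B1)) (fun x => (e1 x, e2 x))) (fun _ => eta)); auto; apply ex_RInt_const|].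
        rewrite RInt_const. unfold plus, scal; simpl; unfold mult; simpl.
        unfold curve_length, eta. f_equal. field; lra.
  - destruct (IHreach1 (eps / 2)) as (T1 & L1' & R1 & h1 & h2); [lra|].
    destruct (IHreach2 (eps / 2)) as (T2 & L2' & R2 & h3 & h4); [lra|].
    exists (T1 + T2), (L1' + L2'). split; [|split; lra].
    apply reach_trans with (1 := R1).
    (* The second chain is rotated by the drift accumulated on the first, which keeps its length. *)
    replace (rotate r ((B2 - B1) * (T1 + T2))) with (rotate (rotate r ((B2 - B1) * T2)) ((B2 - B1) * T1)).
    + apply reach_rotate; auto.
    + unfold rotate; simpl. f_equal. ring.
Qed.

(** The carried chain has length at most some [T < l]; the remaining time is spent drifting along
    the parallel, which by [drift_cost] costs less than [l - T]. *)
Lemma dist_wind_lt p q l :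
  finsler_dist (rotational (zermelo m A B1)) p q < l ->
  finsler_dist (rotational (zermelo m A B2)) p (rotate q ((B2 - B1) * l)) < l.
Proof.
  intros H.
  assert (R1 := regular_zermelo m A B1 W1). assert (R2 := regular_zermelo m A B2 W2).
  assert (C1 := continuous_zermelo m A B1 W1). assert (C2 := continuous_zermelo m A B2 W2).
  destruct (dist_lt_reach _ _ _ _ R1 C1 _ _ _ H) as (L & HL & lt).
  destruct (reach_wind p q L HL ((l - L) / 2)) as (T & L' & HT & h1 & h2); [lra|].
  assert (K := reach_parallel (zermelo m A B2) (rotate q ((B2 - B1) * T)) (B2 - B1) (l - T) ltac:(lra)).
  assert (c := drift_cost (fst q)). simpl in K.
  assert (Z := dist_le _ _ _ _ R2 C2 _ _ _ (reach_trans _ _ _ _ _ _ HT K)).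
  replace (rotate (rotate q ((B2 - B1) * T)) ((B2 - B1) * (l - T))) with (rotate q ((B2 - B1) * l)) in Z
    by (unfold rotate; simpl; f_equal; ring).
  assert (zermelo m A B2 (fst q) 0 (B2 - B1) * (l - T) < 1 * (l - T)) by (apply Rmult_lt_compat_r; lra).
  lra.
Qed.

End TwoWinds.

(** For the upper bound, the strict inequality is applied at [l + d] and the surplus drift is undone
    along the parallel at cost [C d]. The lower bound is the strict inequality with the winds
    exchanged. *)
Lemma dist_wind_eq m A B1 B2 p q l : navigation m A B1 -> navigation m A B2 ->
  finsler_dist (rotational (zermelo m A B1)) p q = l ->
  finsler_dist (rotational (zermelo m A B2)) p (rotate q ((B2 - B1) * l)) = l.
Proof.
  intros W1 W2 H.
  assert (R2 := regular_zermelo m A B2 W2). assert (C2 := continuous_zermelo m A B2 W2).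
  apply Rle_antisym.
  - set (C := zermelo m A B2 (fst q) 0 (- (B2 - B1))).
    assert (Cp : 0 <= C).
    { unfold C. destruct (Req_dec (B2 - B1) 0) as [->|n].
      - rewrite Ropp_0, (reg_zero R2). lra.
      - left. apply (reg_pos R2). intros e; injection e; lra. }
    apply le_epsilon. intros e He. set (d := e / (1 + C)).
    assert (dp : 0 < d) by (apply Rdiv_lt_0_compat; lra).
    assert (K := dist_wind_lt m A B1 B2 W1 W2 p q (l + d) ltac:(lra)).
    assert (P := reach_parallel (zermelo m A B2) (rotate q ((B2 - B1) * (l + d))) (- (B2 - B1)) d dp).
    replace (rotate (rotate q ((B2 - B1) * (l + d))) (- (B2 - B1) * d)) with (rotate q ((B2 - B1) * l)) in P
      by (unfold rotate; simpl; f_equal; ring).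
    simpl in P. fold C in P. apply dist_le with (1 := R2) (2 := C2) in P.
    assert (T := dist_triangle _ _ _ _ R2 C2 p (rotate q ((B2 - B1) * (l + d))) (rotate q ((B2 - B1) * l))).
    assert (d * (1 + C) = e) by (unfold d; field; lra). lra.
  - apply Rnot_lt_le. intros c. apply (dist_wind_lt m A B2 B1 W2 W1) in c.
    replace (rotate (rotate q ((B2 - B1) * l)) ((B1 - B2) * l)) with q in c.
    + lra.
    + unfold rotate; simpl. rewrite (surjective_pairing q) at 1. f_equal. ring.
Qed.

Lemma dist_wind_iff m A B1 B2 p q l : navigation m A B1 -> navigation m A B2 ->
  (finsler_dist (rotational (zermelo m A B1)) p q = l <->
   finsler_dist (rotational (zermelo m A B2)) p (rotate q ((B2 - B1) * l)) = l).
Proof.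
  intros W1 W2. split; intros H; [apply dist_wind_eq; auto|].
  apply (dist_wind_eq m A B2 B1) in H; auto. etransitivity; [|exact H]. f_equal.
  unfold rotate; simpl. rewrite (surjective_pairing q) at 1. f_equal. ring.
Qed.

(** * Distances under an exact change of metric *)

Section DistanceExact.
Context {F Fr Fu Fv G Gr Gu Gv : R -> R -> R -> R} {h : R -> R}
  (H : exact_change F Fr Fu Fv G Gr Gu Gv h) (CF : continuous_metric F).

Lemma exact_continuous : continuous_metric G.
Proof.
  intros a b c x S1 S2 hx.
  apply (continuous_ext (fun t => at_velocity F c t + Derive h (rc c t) * Derive (rc c) t)).
  - intros t. unfold at_velocity. rewrite (ec_eq H). reflexivity.
  - apply @continuous_plus; [apply (CF a b); auto|].
    apply (smooth_on_continuous a b (fun t => Derive h (rc c t) * Derive (rc c) t)); auto.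
    apply Cn2_smooth_on; intros n. apply Cn2_mult; auto using open2_strip, smooth_velocity.
    apply (smooth_comp (strip a b) (Derive h) (fun _ t => rc c t)); auto using open2_strip.
    + apply smooth_on_Derive, H.
    + intros k; apply smooth_on_Cn2_y, S1.
Qed.

Lemma reach_exact p q L : reach (rotational F) p q L ->
  reach (rotational G) p q (L + (h (fst q) - h (fst p))).
Proof.
  intros R; induction R as [e1 e2 x0 x1 p q S1 S2 lt E0 E1|p q r L1 L2 R1 I1 R2 I2].
  - replace (curve_length (rotational F) (fun x => (e1 x, e2 x)) x0 x1 + (h (fst q) - h (fst p)))
      with (curve_length (rotational G) (fun x => (e1 x, e2 x)) x0 x1).
    + apply reach_arc; auto.
    + assert (Shc : forall n, Cn2_on n (strip m_infty p_infty) (fun _ t => h (e1 t))).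
      { apply (smooth_comp (strip m_infty p_infty) h (fun _ t => e1 t)); auto using open2_strip.
        - apply H.
        - intros k; apply smooth_on_Cn2_y, S1. }
      assert (Sh := Cn2_smooth_on _ _ _ Shc : smooth (fun t => h (e1 t))).
      assert (Dh : forall x, is_derive (fun t => h (e1 t)) x (Derive h (e1 x) * Derive e1 x)).
      { intros x. rewrite Rmult_comm. apply (is_derive_comp h e1); apply smooth_is_derive; auto. apply H. }
      unfold curve_length.
      rewrite (RInt_ext _ (fun x => along (rotational F) (fun x => (e1 x, e2 x)) x + Derive h (e1 x) * Derive e1 x)).
      2: { intros x _. unfold along, rotational. apply (ec_eq H). }
      etransitivity.
      * apply (RInt_plus (V := R_CompleteNormedModule) (along (rotational F) (fun x => (e1 x, e2 x)))
          (fun x => Derive h (e1 x) * Derive e1 x));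
          apply (ex_RInt_continuous (V := R_CompleteNormedModule)); intros x _; [apply (continuous_arc F); auto|].
        apply continuous_ext with (Derive (fun t => h (e1 t))).
        -- intros y; apply is_derive_unique, Dh.
        -- apply smooth_continuous, smooth_on_Derive, Sh.
      * rewrite (RInt_Derive_inside m_infty p_infty (fun t => h (e1 t))
          (fun x => Derive h (e1 x) * Derive e1 x)); try (split; exact I); auto.
        destruct E0 as [<- _], E1 as [<- _]. reflexivity.
  - replace (L1 + L2 + (h (fst r) - h (fst p)))
      with (L1 + (h (fst q) - h (fst p)) + (L2 + (h (fst r) - h (fst q)))) by ring.
    apply reach_trans with q; auto.
Qed.

Lemma dist_exact_le p q :
  finsler_dist (rotational G) p q <= finsler_dist (rotational F) p q + (h (fst q) - h (fst p)).
Proof.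
  apply le_epsilon. intros e He.
  destruct (dist_lt_reach F Fr Fu Fv (ec_F H) CF p q
    (finsler_dist (rotational F) p q + e)) as (L & HL & lt); [lra|].
  apply reach_exact in HL.
  apply (dist_le G Gr Gu Gv (ec_G H) exact_continuous) in HL. lra.
Qed.

End DistanceExact.

(** * Minimizing geodesics and cut points *)

Section CutLocus.
Context (m A : R -> R) (B : R) (W : navigation m A B).

Let W0 := navigation_0 m A B W.
Let E01 := exact_change_sym_zermelo m A B W.
Let E10 := exact_change_sym E01.
Let C0 := continuous_zermelo m A 0 W0.
Let Cs := exact_continuous E01 C0.

Lemma dist_sym p q : finsler_dist (rotational (zermelo m A 0)) p q =
  finsler_dist (rotational (sym m A)) p q + (- potential m A (fst q) - - potential m A (fst p)).
Proof.
  assert (k1 := dist_exact_le E01 C0 p q).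
  assert (k2 := dist_exact_le E10 Cs p q).
  apply Rle_antisym; lra.
Qed.

(** At unit speed, minimizing up to a parameter means that the distance equals the parameter. Both
    sides reduce to [d_F(rho 0, rho (s t)) = t]: for [rho] by the exact change, for [P] by the
    change of wind. *)
Lemma corresponds_minimizing (a b : Rbar) (P : curve) (c d : Rbar) (rho : curve) (s : R -> R) (t : R) : inside a b 0 -> inside a b t ->
  corresponds (rotational (zermelo m A 0)) (rotational (sym m A)) B a b P c d rho s ->
  s 0 = 0 /\ P 0 = rho 0 /\ P t = rotate (rho (s t)) (B * t) /\
  (minimizing (rotational (sym m A)) rho (s t) <-> minimizing (rotational (zermelo m A B)) P t) /\
  (minimizing (rotational (zermelo m A B)) P t ->
     finsler_dist (rotational (zermelo m A 0)) (rho 0) (rho (s t)) = t).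
Proof.
  intros h0 ht C. assert (UP := corresponds_geodesic m A B W _ _ _ _ _ _ _ C).
  apply (corresponds_iff m A B W) in C. destruct C as (k0 & U & Hs & Hx).
  assert (s0 : s 0 = 0).
  { destruct (Hx 0 k0) as [_ e]. rewrite travel_time_0 in e. exact e. }
  assert (P0 : P 0 = rho 0).
  { destruct (Hs 0 h0) as (_ & _ & ->). rewrite s0, Rmult_0_r, Rplus_0_r.
    symmetry; apply surjective_pairing. }
  destruct (Hs t ht) as (kt & T & Pt).
  assert (Pt' : P t = rotate (rho (s t)) (B * t)) by exact Pt.
  assert (K : finsler_dist (rotational (zermelo m A 0)) (rho 0) (rho (s t)) = t <->
              finsler_dist (rotational (zermelo m A B)) (P 0) (P t) = t).
  { rewrite P0, Pt', (dist_wind_iff m A 0 B) by auto. rewrite Rminus_0_r. tauto. }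
  split; auto. split; auto. split; auto.
  rewrite (minimizing_unit _ c d) by auto. rewrite (minimizing_unit _ a b) by auto.
  rewrite <- K, dist_sym. unfold travel_time, rc in T. split; [|auto].
  split; intros; lra.
Qed.

Lemma corresponds_monotone a b P c d rho s t t' : inside a b t -> inside a b t' ->
  corresponds (rotational (zermelo m A 0)) (rotational (sym m A)) B a b P c d rho s ->
  (t < t' <-> s t < s t').
Proof.
  intros ht ht' C. apply (corresponds_iff m A B W) in C. destruct C as (k0 & U & Hs & Hx).
  assert (Mono : forall x y, inside c d x -> inside c d y -> x < y ->
     travel_time m A rho x < travel_time m A rho y).
  { apply (increasing_inverse c d (travel_time m A rho) (at_velocity (zermelo m A 0) rho)).
    intros x hx. destruct (unit_geodesic_velocity E10 c d rho x U hx) as [V1 V2].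
    split; auto. apply (height_derive E10 c d); auto. apply U. }
  destruct (Hs t ht) as (k1 & T1 & _). destruct (Hs t' ht') as (k2 & T2 & _).
  split; intros l.
  - apply Rnot_le_lt. intros [g|g]; [apply Mono in g; auto; lra | rewrite g in T2; lra].
  - apply Mono in l; auto. lra.
Qed.

(** By [dist_wind_iff] the implicit equation for [l] has the single solution [d_F(p, qh)]. Geodesics
    correspond over their full intervals of definition, so the parameters beyond the cut point match
    too. *)
Lemma cut_locus (p qh : point) : exists l : R,
  unique (fun x => x = finsler_dist (rotational (zermelo m A B)) p (fst qh, snd qh + B * x)) l /\
  (cut (rotational (sym m A)) p qh <->
   cut (rotational (zermelo m A B)) p (fst qh, snd qh + B * l)).
Proof.
  assert (K : forall x, x = finsler_dist (rotational (zermelo m A B)) p (fst qh, snd qh + B * x) <->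
    finsler_dist (rotational (zermelo m A 0)) p qh = x).
  { intros x. rewrite (dist_wind_iff m A 0 B) by auto. rewrite Rminus_0_r. split; auto. }
  set (l := finsler_dist (rotational (zermelo m A 0)) p qh) in *.
  exists l. split.
  { split; [apply K; reflexivity|]. intros x' hx'. apply K in hx'. exact hx'. }
  change (fst qh, snd qh + B * l) with (rotate qh (B * l)).
  split.
  - intros (c & d & rho & x & h1 & h2 & h3 & U & e0 & e1 & M1 & M2).
    assert (i0 : inside c d 0) by (split; auto; apply Rbar_lt_trans with x; auto).
    destruct (corresponds_geodesic_exists m A B W c d rho i0 U) as (a & b & P & s & j0 & C).
    assert (C' := proj1 (corresponds_iff m A B W _ _ _ _ _ _ _) C).
    destruct C' as (_ & _ & Hs & Hx).
    assert (ix : inside c d x) by (split; auto; apply Rbar_lt_trans with 0; auto).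
    destruct (Hx x ix) as [jt es]. set (t := travel_time m A rho x) in *.
    assert (X := fun t ht => corresponds_minimizing a b P c d rho s t j0 ht C).
    assert (MM : forall t, inside a b t -> (minimizing (rotational (sym m A)) rho (s t) <->
      minimizing (rotational (zermelo m A B)) P t)) by (intros; apply X; auto).
    destruct (X t jt) as (s0 & P0 & Pt & Mt & Dt). rewrite es in *.
    assert (Mon := fun t t' ht ht' => corresponds_monotone a b P c d rho s t t' ht ht' C).
    (* The travel time up to the cut point is [d_F(p, qh)] because [rho] still minimizes there. *)
    assert (tl : t = l).
    { rewrite <- (Dt (proj1 Mt (M1 x ltac:(lra)))). unfold l.
      apply (dist_same _ _ _ _ _ e0 e1). }
    exists a, b, P, t. split; [apply j0|]. split.
    { apply (Mon 0 t j0 jt). rewrite s0, es; auto. }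
    split; [apply jt|]. split; [exact (corresponds_geodesic m A B W _ _ _ _ _ _ _ C)|].
    rewrite P0, Pt, <- tl. split; auto. split; [apply same_point_rotate; auto|]. split.
    + intros t' [l1 l2]. assert (jt' : inside a b t') by exact (inside_between a b 0 t t' j0 jt (conj l1 l2)).
      apply MM; auto. apply M1. split; apply Rnot_lt_le; intros n.
      * rewrite <- s0 in n. apply Mon in n; auto. lra.
      * rewrite <- es in n. apply Mon in n; auto. lra.
    + intros t' l1 l2. assert (jt' : inside a b t').
      { split; auto. apply Rbar_lt_trans with t; auto. apply jt. }
      intros n. apply MM in n; auto. revert n. apply M2.
      * rewrite <- es. apply (Mon t t' jt jt'); auto.
      * apply Hs; auto.
  - intros (a & b & P & t & h1 & h2 & h3 & U & e0 & e1 & M1 & M2).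
    assert (j0 : inside a b 0) by (split; auto; apply Rbar_lt_trans with t; auto).
    destruct (geodesic_corresponds m A B W a b P j0 U) as (c & d & rho & s & C).
    assert (C' := proj1 (corresponds_iff m A B W _ _ _ _ _ _ _) C).
    destruct C' as (i0 & Us & Hs & Hx).
    assert (jt : inside a b t) by (split; auto; apply Rbar_lt_trans with 0; auto).
    assert (X := fun t ht => corresponds_minimizing a b P c d rho s t j0 ht C).
    assert (MM : forall t, inside a b t -> (minimizing (rotational (sym m A)) rho (s t) <->
      minimizing (rotational (zermelo m A B)) P t)) by (intros; apply X; auto).
    destruct (X t jt) as (s0 & P0 & Pt & Mt & Dt).
    assert (Mon := fun t t' ht ht' => corresponds_monotone a b P c d rho s t t' ht ht' C).
    assert (mt := M1 t ltac:(lra)).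
    assert (tl : t = l).
    { apply (minimizing_unit _ a b P t U j0 jt) in mt. rewrite <- mt.
      rewrite (dist_same _ _ _ _ _ e0 e1).
      symmetry; apply K; reflexivity. }
    exists c, d, rho, (s t). split; [apply i0|]. split.
    { rewrite <- s0. apply (Mon 0 t j0 jt); auto. }
    split; [apply Hs, jt|]. split; auto. rewrite <- P0. split; auto. split.
    { rewrite Pt, <- tl in e1. apply (same_point_rotate _ _ (- (B * t))) in e1.
      unfold rotate in e1; simpl in e1.
      replace (snd (rho (s t)) + B * t + - (B * t)) with (snd (rho (s t))) in e1 by ring.
      replace (snd qh + B * t + - (B * t)) with (snd qh) in e1 by ring.
      rewrite (surjective_pairing (rho (s t))), (surjective_pairing qh). exact e1. }
    assert (In : forall x, inside c d x -> exists t', inside a b t' /\ s t' = x).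
    { intros x hx. destruct (Hx x hx); eauto. }
    split.
    + intros x [l1 l2].
      assert (ix : inside c d x) by exact (inside_between c d 0 (s t) x i0 (proj1 (Hs t jt)) (conj l1 l2)).
      destruct (In x ix) as (t' & jt' & <-). apply MM; auto. apply M1.
      split; apply Rnot_lt_le; intros n.
      * apply (Mon t' 0 jt' j0) in n. lra.
      * apply (Mon t t' jt jt') in n. lra.
    + intros x l1 l2.
      assert (ix : inside c d x).
      { split; auto. apply Rbar_lt_trans with (s t); auto. apply Hs, jt. }
      destruct (In x ix) as (t' & jt' & <-). intros n. apply MM in n; auto. revert n.
      apply M2; [apply (Mon t t'); auto | apply jt'].
Qed.

End CutLocus.

(** * Jacobi fields *)

Definition box (d a b : R) : R -> R -> Prop := fun e t => Rabs e < d /\ a < t < b.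

Lemma open2_box d a b : open2 (box d a b).
Proof.
  intros e t [h1 [h2 h3]].
  assert (p : 0 < Rmin (d - Rabs e) (Rmin (t - a) (b - t))) by (repeat apply Rmin_glb_lt; lra).
  exists (mkposreal _ p). intros e' t' He Ht; simpl in He, Ht.
  assert (k1 := Rmin_l (d - Rabs e) (Rmin (t - a) (b - t))).
  assert (k2 := Rmin_r (d - Rabs e) (Rmin (t - a) (b - t))).
  assert (k3 := Rmin_l (t - a) (b - t)). assert (k4 := Rmin_r (t - a) (b - t)).
  split.
  - replace e' with (e' - e + e) by ring. assert (q := Rabs_triang (e' - e) e). lra.
  - assert (q : Rabs (t' - t) < Rmin (t - a) (b - t)) by lra. apply Rabs_def2 in q. lra.
Qed.

Lemma box_0 d a b t : 0 < d -> a < t < b -> box d a b 0 t.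
Proof. intros; split; auto. rewrite Rabs_R0; auto. Qed.

Lemma box_mono d a b d' a' b' e t : d' <= d -> a <= a' -> b' <= b -> box d' a' b' e t -> box d a b e t.
Proof. unfold box; intros; lra. Qed.

Lemma Schwarz_on D f x y : open2 D -> Cn2_on 2 D f -> D x y -> dx (dy f) x y = dy (dx f) x y.
Proof.
  intros o H d. apply Schwarz.
  - apply locally_2d_mono with D; [|apply o, d]. intros u v k.
    destruct (Cn2_is_derive _ _ _ _ _ H k) as [h1 h2].
    destruct (Cn2_is_derive _ _ _ _ _ (Cn2_dx _ _ _ H) k) as [h3 h4].
    destruct (Cn2_is_derive _ _ _ _ _ (Cn2_dy _ _ _ H) k) as [h5 h6].
    split; [|split; [|split]]; eexists; eassumption.
  - apply (Cn2_continuity _ _ _ _ _ (Cn2_dx _ _ _ (Cn2_dy _ _ _ H)) d).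
  - apply (Cn2_continuity _ _ _ _ _ (Cn2_dy _ _ _ (Cn2_dx _ _ _ H)) d).
Qed.

(** The variation runs through unit speed geodesics, for which the change of wind and the exact
    change are stated. *)
Definition unit_jacobi (F : metric) (a b : R) (c : curve) (J1 J2 : R -> R) : Prop :=
  exists (d : R) (G : R -> curve),
    0 < d /\
    smooth2_on (box d a b) (fun e t => fst (G e t)) /\
    smooth2_on (box d a b) (fun e t => snd (G e t)) /\
    (forall t, a < t < b -> G 0 t = c t) /\
    (forall e, Rabs e < d -> unit_geodesic_on F a b (G e)) /\
    (forall t, a < t < b ->
       J1 t = Derive (fun e => fst (G e t)) 0 /\
       J2 t = Derive (fun e => snd (G e t)) 0).

Lemma unit_jacobi_jacobi F a b c J1 J2 :
  unit_jacobi F a b c J1 J2 -> jacobi_field F a b c J1 J2.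
Proof.
  intros (d & G & h1 & h2 & h3 & h4 & h5 & h6). exists d, G.
  split; [|split; [|split; [|split; [|split]]]]; auto. intros e he; apply h5; auto.
Qed.

Lemma unit_jacobi_sub F a b a' b' c c' J1 J2 : a <= a' -> b' <= b ->
  (forall t, a' < t < b' -> c t = c' t) ->
  unit_jacobi F a b c J1 J2 -> unit_jacobi F a' b' c' J1 J2.
Proof.
  intros ha hb E (d & G & h1 & h2 & h3 & h4 & h5 & h6). exists d, G.
  split; [|split; [|split; [|split; [|split]]]]; auto.
  - intros n; apply Cn2_mono with (2 := h2 n). intros x y; apply box_mono; lra.
  - intros n; apply Cn2_mono with (2 := h3 n). intros x y; apply box_mono; lra.
  - intros t ht. rewrite <- E by auto. apply h4; lra.
  - intros e he. apply (unit_geodesic_sub F a b a' b'); simpl; auto.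
  - intros t ht; apply h6; lra.
Qed.

(** ** Unit speed *)

Section Speed.
Context {F Fr Fu Fv : R -> R -> R -> R} (HF : regular F Fr Fu Fv) (CF : continuous_metric F).

Lemma positive_moving c t : 0 < at_velocity F c t -> moving c t.
Proof.
  intros p e. unfold at_velocity in p. injection e; intros e2 e1.
  rewrite e1, e2, (reg_zero HF) in p. lra.
Qed.

(* [max F (1/2)] has derivative 0 along a geodesic, even where the velocity could
   vanish. *)
Lemma geodesic_unit (a b : Rbar) c t0 : geodesic_on (rotational F) a b c ->
  inside a b t0 -> at_velocity F c t0 = 1 -> unit_geodesic_on (rotational F) a b c.
Proof.
  intros G h0 U0. destruct G as (S1 & S2 & E).
  assert (C : forall t, inside a b t -> continuous (at_velocity F c) t)
    by (intros; apply (CF a b); auto).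
  assert (D : forall t, inside a b t -> is_derive (fun s => Rmax (at_velocity F c s) (1 / 2)) t 0).
  (* Where the speed is positive it is locally constant, as [geodesic_extremal] applies nearby;
     where it is not, continuity keeps it below 1/2 nearby. *)
  { intros t ht. destruct (Rlt_le_dec 0 (at_velocity F c t)) as [p|p].
    - assert (L : locally t (fun s => inside a b s /\ 0 < at_velocity F c s)).
      { apply filter_and; [apply locally_inside, ht|].
        apply (C t ht (fun y => 0 < y)). apply locally_pos, p. }
      destruct L as [eps L].
      assert (L' : forall s, inside (t - eps) (t + eps) s -> inside a b s /\ 0 < at_velocity F c s).
      { intros s [k1 k2]; simpl in k1, k2. apply L.
        rewrite ball_Rabs; apply Rabs_def1; lra. }
      assert (ep := cond_pos eps).
      assert (it : inside (t - eps) (t + eps) t) by (split; simpl; lra).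
      destruct (geodesic_extremal HF (t - eps) (t + eps) c) as [_ K].
      { intros s hs; apply positive_moving, L', hs. }
      { split; [|split].
        - intros n s k1 k2. destruct (L' s (conj k1 k2)) as [[l1 l2] _]. apply S1; auto.
        - intros n s k1 k2. destruct (L' s (conj k1 k2)) as [[l1 l2] _]. apply S2; auto.
        - intros s k1 k2. destruct (L' s (conj k1 k2)) as [[l1 l2] _]. apply E; auto. }
      apply is_derive_ext_loc with (fun _ => Rmax (at_velocity F c t) (1 / 2)); [|apply is_derive_const_R].
      generalize (locally_inside _ _ t it); apply filter_imp. intros s hs. now rewrite (K t s).
    - apply is_derive_ext_loc with (fun _ => 1 / 2); [|apply is_derive_const_R].
      assert (L : locally t (fun s => at_velocity F c s < 1 / 2)).
      { apply (C t ht (fun y => y < 1 / 2)). apply (open_lt (1 / 2)). lra. }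
      revert L; apply filter_imp. intros s hs. symmetry; apply Rmax_right; lra. }
  split; [split; auto|]. intros t h1 h2.
  assert (K := constant_inside a b _ D t t0 (conj h1 h2) h0). simpl in K.
  rewrite U0 in K. rewrite (Rmax_left 1) in K by lra.
  change (at_velocity F c t = 1).
  destruct (Rle_dec (1 / 2) (at_velocity F c t)).
  - rewrite Rmax_left in K; lra.
  - rewrite Rmax_right in K; lra.
Qed.

End Speed.

(** Compactness of [[a, b]] turns the local neighbourhoods of positivity into one common width
    [d]. *)
Lemma tube (g : R -> R -> R) a b :
  (forall t, a <= t <= b -> continuity_2d_pt g 0 t /\ 0 < g 0 t) ->
  exists d, 0 < d /\ forall e t, Rabs e < d -> a <= t <= b -> 0 < g e t.
Proof.
  intros H.
  assert (L : forall t, exists del : posreal, a <= t <= b ->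
    forall e s, Rabs e < del -> Rabs (s - t) < del -> 0 < g e s).
  { intros t. destruct (excluded_middle_informative (a <= t <= b)) as [h|h].
    - destruct (H t h) as [C p]. destruct (C (mkposreal _ p)) as [del Hd]. exists del.
      intros _ e s he hs. assert (k := Hd e s). rewrite Rminus_0_r in k.
      specialize (k he hs). simpl in k. apply Rabs_def2 in k. lra.
    - exists (mkposreal 1 Rlt_0_1). intros; contradiction. }
  set (del := fun t => epsilon (inhabits (mkposreal 1 Rlt_0_1)) (fun del : posreal => a <= t <= b ->
    forall e s, Rabs e < del -> Rabs (s - t) < del -> 0 < g e s)).
  assert (Hdel : forall t, a <= t <= b ->
    forall e s, Rabs e < del t -> Rabs (s - t) < del t -> 0 < g e s).
  { intros t. apply (epsilon_spec _ _ (L t)). }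
  destruct (compactness_value_1d a b del) as [d Hd].
  exists d. split; [apply cond_pos|]. intros e t he ht.
  apply Rnot_le_lt. intros n. apply (Hd t ht). intros (s & hs & k1 & k2).
  assert (k := Hdel s hs e t ltac:(lra) k1). lra.
Qed.

(** * Normalizing a variation to unit speed *)

Section Normalize.
Context {F Fr Fu Fv : R -> R -> R -> R} (HF : regular F Fr Fu Fv).

Lemma smooth2_speed D (x y : R -> R -> R) : open2 D -> smooth2_on D x -> smooth2_on D y ->
  (forall e t, D e t -> (dy x e t, dy y e t) <> (0, 0)) ->
  smooth2_on D (fun e t => F (x e t) (dy x e t) (dy y e t)).
Proof.
  intros o Sx Sy M. apply (reg_smooth HF D x (dy x) (dy y)); auto.
  - intros n; apply Cn2_dy, Sx.
  - intros n; apply Cn2_dy, Sy.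
Qed.

(* First variation formula: [k'] is the derivative in t of [Fu * J1 + Fv * J2]. *)
Lemma first_variation d a b (G : R -> curve) (k : R -> R) l :
  0 < d -> smooth2_on (box d a b) (fun e t => fst (G e t)) ->
  smooth2_on (box d a b) (fun e t => snd (G e t)) ->
  extremal Fr Fu Fv a b (G 0) ->
  (forall e t, box d a b e t -> at_velocity F (G e) t = k e) ->
  a < 0 -> 0 < l -> l < b ->
  (forall t, t = 0 \/ t = l -> Derive (fun e => fst (G e t)) 0 = 0 /\ Derive (fun e => snd (G e t)) 0 = 0) ->
  is_derive k 0 0.
Proof.
  intros hd Sx Sy (S1 & S2 & E) K ha hl hb Z.
  set (x := fun e t => fst (G e t)) in *. set (y := fun e t => snd (G e t)) in *.
  assert (o := open2_box d a b).
  assert (Dk : forall t, a < t < b -> is_derive k 0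
    (at_velocity Fr (G 0) t * dx x 0 t + at_velocity Fu (G 0) t * dy (dx x) 0 t
     + at_velocity Fv (G 0) t * dy (dx y) 0 t)).
  { intros t ht. assert (bt := box_0 d a b t hd ht).
    rewrite <- (Schwarz_on (box d a b) x), <- (Schwarz_on (box d a b) y) by auto.
    apply is_derive_ext_loc with (fun e => F (x e t) (dy x e t) (dy y e t)).
    - generalize (open2_locally_x _ _ _ o bt); apply filter_imp. intros e be. exact (K e t be).
    - apply (reg_chain HF (fun e => x e t) (fun e => dy x e t) (fun e => dy y e t)).
      + apply (Cn2_is_derive 0 (box d a b)); auto.
      + apply (Cn2_is_derive 0 (box d a b)); auto. apply Cn2_dy, Sx.
      + apply (Cn2_is_derive 0 (box d a b)); auto. apply Cn2_dy, Sy.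
      + apply E. split; simpl; lra. }
  set (kp := Derive k 0).
  assert (Dk' : forall t, a < t < b -> at_velocity Fr (G 0) t * dx x 0 t
      + at_velocity Fu (G 0) t * dy (dx x) 0 t + at_velocity Fv (G 0) t * dy (dx y) 0 t = kp).
  { intros t ht. symmetry; apply is_derive_unique, Dk, ht. }
  set (w := fun t => at_velocity Fu (G 0) t * dx x 0 t + at_velocity Fv (G 0) t * dx y 0 t).
  assert (DW : forall t, a < t < b -> is_derive w t kp).
  { intros t ht. destruct (E t) as (M & E1 & E2); [split; simpl; lra|].
    assert (bt := box_0 d a b t hd ht).
    rewrite <- (Dk' t ht). evar_last.
    - apply @is_derive_plus.
      + apply (is_derive_mult (at_velocity Fu (G 0)) (fun t => dx x 0 t)); [exact E1 | | intros; apply Rmult_comm].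
        apply (Cn2_is_derive 0 (box d a b) (dx x)); auto. apply Cn2_dx, Sx.
      + apply (is_derive_mult (at_velocity Fv (G 0)) (fun t => dx y 0 t)); [exact E2 | | intros; apply Rmult_comm].
        apply (Cn2_is_derive 0 (box d a b) (dx y)); auto. apply Cn2_dx, Sy.
    - unfold plus, mult; simpl. ring. }
  destruct (Z 0 (or_introl eq_refl)) as [z1 z2]. destruct (Z l (or_intror eq_refl)) as [z3 z4].
  (* [w] vanishes at both ends and has the constant derivative [kp], so [kp * l = 0]. *)
  destruct (MVT_gen w 0 l (fun _ => kp)) as (s & _ & Q).
  - rewrite Rmin_left, Rmax_right by lra. intros t ht. apply DW; lra.
  - rewrite Rmin_left, Rmax_right by lra. intros t ht. apply continuity_pt_filterlim.
    apply (ex_derive_continuous w). eexists. apply DW; lra.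
  - unfold w in Q. change (dx x 0 0) with (Derive (fun e => x e 0) 0) in Q.
    change (dx y 0 0) with (Derive (fun e => y e 0) 0) in Q.
    change (dx x 0 l) with (Derive (fun e => x e l) 0) in Q.
    change (dx y 0 l) with (Derive (fun e => y e l) 0) in Q.
    unfold x, y in Q. rewrite z1, z2, z3, z4 in Q.
    assert (kp = 0) by nra.
    replace 0 with kp at 2. unfold kp. apply Derive_correct. eexists. apply (Dk l); lra.
Qed.

(** The e-th curve has a constant speed [k e] and is reparametrized by [t / k e]. Since [k] is
    stationary at 0 by [first_variation], this has no first-order effect and the field is kept. The
    interval shrinks so that the velocities stay nonzero and [t / k e] stays in the domain. *)
Lemma jacobi_unit_jacobi a b a1 b1 c J1 J2 l :
  jacobi_field (rotational F) a b c J1 J2 -> unit_geodesic_on (rotational F) a b c ->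
  a < a1 -> a1 < 0 -> 0 < l -> l < b1 -> b1 < b ->
  J1 0 = 0 -> J2 0 = 0 -> J1 l = 0 -> J2 l = 0 ->
  unit_jacobi (rotational F) a1 b1 c J1 J2.
Proof.
  intros (d & G & hd & Sx & Sy & G0 & HG & HJ) U ha ha1 hl hb1 hb z1 z2 z3 z4.
  set (x := fun e t => fst (G e t)) in *. set (y := fun e t => snd (G e t)) in *.
  set (a2 := (a + a1) / 2). set (b2 := (b1 + b) / 2).
  assert (h2 : a < a2 < a1 /\ b1 < b2 < b) by (unfold a2, b2; lra).
  assert (U0 : unit_geodesic_on (rotational F) a b (G 0)).
  { apply (unit_geodesic_ext F Fr Fu Fv a b c (G 0) HF) with (2 := U).
    intros t [k1 k2]; simpl in k1, k2. symmetry; apply G0; lra. }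
  assert (V0 := proj2 (proj1 (unit_geodesic_extremal HF a b (G 0)) U0)).
  destruct (tube (fun e t => dy x e t ^ 2 + dy y e t ^ 2) a2 b2) as (d1' & hd1 & T1).
  { intros t ht. assert (bt : box d a b 0 t) by (apply box_0; lra). split.
    - apply (Cn2_continuity 0 (box d a b)); auto.
      apply Cn2_plus; auto using open2_box; apply Cn2_pow; auto using open2_box;
        apply Cn2_dy; [apply Sx | apply Sy].
    - apply pair_neq0. apply (positive_moving HF (G 0) t).
      rewrite V0; [lra | split; simpl; lra]. }
  set (d1 := Rmin d d1').
  assert (hd1p : 0 < d1) by (apply Rmin_glb_lt; auto).
  assert (l1 : d1 <= d) by apply Rmin_l. assert (l2 : d1 <= d1') by apply Rmin_r.
  assert (Sub : forall e t, box d1 a2 b2 e t -> box d a b e t) by (intros e t; apply box_mono; lra).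
  assert (M : forall e t, box d1 a2 b2 e t -> (dy x e t, dy y e t) <> (0, 0)).
  { intros e t [he ht] q. injection q; intros q2 q1. assert (k := T1 e t ltac:(lra) ltac:(lra)).
    simpl in k. rewrite q1, q2 in k. lra. }
  assert (Ext : forall e, Rabs e < d1 -> extremal Fr Fu Fv a2 b2 (G e) /\
     forall s t, inside a2 b2 s -> inside a2 b2 t -> at_velocity F (G e) s = at_velocity F (G e) t).
  { intros e he. apply geodesic_extremal; auto.
    - intros t ht. apply (M e t). split; auto.
    - destruct (HG e ltac:(lra)) as (Q1 & Q2 & Q3). split; [|split].
      + apply smooth_on_subset with (3 := Q1); simpl; lra.
      + apply smooth_on_subset with (3 := Q2); simpl; lra.
      + intros t k1 k2. simpl in k1, k2. apply Q3; simpl; lra. }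
  set (k := fun e => at_velocity F (G e) 0).
  assert (Kc : forall e t, box d1 a2 b2 e t -> at_velocity F (G e) t = k e).
  { intros e t [he ht]. apply (proj2 (Ext e he)); split; simpl; lra. }
  assert (Kp : forall e, Rabs e < d1 -> 0 < k e).
  { intros e he. apply (reg_pos HF). apply (M e 0). split; auto; lra. }
  assert (k0 : k 0 = 1) by (apply V0; split; simpl; lra).
  assert (Sx1 : smooth2_on (box d1 a2 b2) x) by (intros n; apply (Cn2_mono n _ _ _ Sub (Sx n))).
  assert (Sy1 : smooth2_on (box d1 a2 b2) y) by (intros n; apply (Cn2_mono n _ _ _ Sub (Sy n))).
  assert (Dk : is_derive k 0 0).
  { apply (first_variation d1 a2 b2 G k l); auto; try lra.
    - apply Ext. rewrite Rabs_R0; auto.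
    - intros t [->| ->]; [destruct (HJ 0) as [<- <-] | destruct (HJ l) as [<- <-]]; auto; lra. }
  assert (SK : smooth2_on (box d1 a2 b2) (fun e t => F (x e t) (dy x e t) (dy y e t)))
    by (apply smooth2_speed; auto using open2_box).
  assert (Sk : forall a' b', smooth2_on (box d1 a' b') (fun e _ => k e)).
  { intros a' b' n. apply (Cn2_comp n (box d1 a' b') (box d1 a2 b2)
      (fun e t => F (x e t) (dy x e t) (dy y e t)) (fun e _ => e) (fun _ _ => 0));
      auto using open2_box, Cn2_id1, Cn2_const.
    intros e t [he _]. split; auto; lra. }
  (* For [k e > kap], division by [k e] sends [(a1, b1)] into [(a2, b2)]; and [kap < 1 = k 0], so
     this holds for small [e]. *)
  set (kap := Rmax (a1 / a2) (b1 / b2)).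
  assert (kap1 : kap < 1).
  { apply Rmax_lub_lt.
    - apply Rmult_lt_reg_r with (- a2); [lra|].
      replace (a1 / a2 * - a2) with (- a1) by (field; lra). lra.
    - apply Rmult_lt_reg_r with b2; [lra|]. field_simplify; lra. }
  assert (kap2 : 0 < kap).
  { apply Rlt_le_trans with (b1 / b2); [apply Rdiv_lt_0_compat; lra | apply Rmax_r]. }
  assert (Ck : locally 0 (fun e => kap < k e)).
  { apply (ex_derive_continuous k 0); [exists 0; exact Dk|]. apply (open_gt kap). lra. }
  destruct Ck as [d2' Hd2].
  set (d2 := Rmin d1 d2').
  assert (hd2p : 0 < d2) by (apply Rmin_glb_lt; auto; apply cond_pos).
  assert (l3 : d2 <= d1) by apply Rmin_l. assert (l4 : d2 <= d2') by apply Rmin_r.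
  assert (Kk : forall e, Rabs e < d2 -> kap < k e).
  { intros e he. apply Hd2. rewrite ball_Rabs, Rminus_0_r. lra. }
  assert (In : forall e t, box d2 a1 b1 e t -> box d1 a2 b2 e (t / k e)).
  { intros e t [he ht]. assert (q := Kk e he). split; [lra|].
    assert (q1 : a1 / a2 <= kap) by apply Rmax_l. assert (q2 : b1 / b2 <= kap) by apply Rmax_r.
    assert (q3 : a2 * k e < a1).
    { replace a1 with (a2 * (a1 / a2)) by (field; lra). nra. }
    assert (q4 : b1 < b2 * k e).
    { replace b1 with (b2 * (b1 / b2)) by (field; lra). apply Rmult_lt_compat_l; lra. }
    split; apply Rmult_lt_reg_r with (k e); try lra; field_simplify; lra. }
  assert (Sq : smooth2_on (box d2 a1 b1) (fun e t => t / k e)).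
  { intros n. apply Cn2_div; auto using open2_box, Cn2_id2.
    - intros e t [he _]. assert (q := Kp e ltac:(lra)). lra.
    - apply Cn2_mono with (2 := Sk a1 b1 n). intros e t; apply box_mono; lra. }
  assert (Comp : forall f, smooth2_on (box d1 a2 b2) f -> smooth2_on (box d2 a1 b1) (fun e t => f e (t / k e))).
  { intros f Sf n. apply (Cn2_comp n (box d2 a1 b1) (box d1 a2 b2) f (fun e _ => e) (fun e t => t / k e));
      auto using open2_box, Cn2_id1. }
  exists d2, (fun e t => G e (t / k e)).
  split; [|split; [|split; [|split; [|split]]]]; auto.
  - apply (Comp x); auto.
  - apply (Comp y); auto.
  - intros t ht. rewrite k0, Rdiv_1_r. apply G0; lra.
  - intros e he. apply (unit_geodesic_extremal HF).
    assert (Kpe := Kp e ltac:(lra)).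
    assert (Dq : forall t, Derive (fun t => t / k e) t = / k e).
    { intros t. apply is_derive_unique. auto_derive; auto. field; lra. }
    destruct (extremal_reparam HF a2 b2 a1 b1 (G e) (fun t => t / k e)) as [X1 X2].
    + apply Ext; lra.
    + unfold Rdiv. smooth_arith.
    + intros t ht. rewrite Dq. split; [|apply Rinv_0_lt_compat; auto].
      apply (In e t). split; auto.
    + split; auto. intros t ht. rewrite X2, Dq by auto. rewrite (Kc e); [field; lra|].
      apply In. split; auto.
  - intros t ht. destruct (HJ t ltac:(lra)) as [-> ->].
    assert (Q : forall f, smooth2_on (box d1 a2 b2) f ->
      Derive (fun e => f e t) 0 = Derive (fun e => f e (t / k e)) 0).
    { intros f Sf. symmetry. apply is_derive_unique.
      assert (bt : box d1 a2 b2 0 t) by (apply box_0; lra).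
      assert (Df := Cn2_differentiable 0 _ f 0 t (open2_box _ _ _) (Sf 1%nat) bt).
      replace (Derive (fun e => f e t) 0) with (dx f 0 t * 1 + dy f 0 t * 0) by (unfold dx; ring).
      apply is_derive_Reals. apply (derivable_pt_lim_comp_2d f (fun e => e) (fun e => t / k e)).
      - rewrite k0, Rdiv_1_r. exact Df.
      - apply is_derive_Reals, is_derive_id_R.
      - apply is_derive_Reals. auto_derive.
        + split; [exists 0; exact Dk|]. rewrite k0. split; auto; lra.
        + change (Derive (fun x => k x) 0) with (Derive k 0). rewrite (is_derive_unique _ _ _ Dk), k0. field. }
    split; [apply (Q x) | apply (Q y)]; auto.
Qed.

End Normalize.

(** * Jacobi fields under a change of wind and under an exact change *)

Lemma unit_jacobi_wind m A B1 B2 a b c J1 J2 :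
  navigation m A B1 -> navigation m A B2 ->
  unit_jacobi (rotational (zermelo m A B1)) a b c J1 J2 ->
  unit_jacobi (rotational (zermelo m A B2)) a b (fun t => (rc c t, thc c t + (B2 - B1) * t)) J1 J2.
Proof.
  intros W1 W2 (d & G & h1 & h2 & h3 & h4 & h5 & h6).
  exists d, (fun e t => (rc (G e) t, thc (G e) t + (B2 - B1) * t)).
  split; [|split; [|split; [|split; [|split]]]]; auto.
  - intros n. apply Cn2_plus; auto using open2_box.
    apply Cn2_mult; auto using open2_box, Cn2_const, Cn2_id2.
  - intros t ht. unfold rc, thc. now rewrite h4.
  - intros e he. apply (unit_geodesic_wind m A B1 B2); auto.
  (* The drift added to the variation does not depend on [e], so the field is unchanged. *)
  - intros t ht. destruct (h6 t ht) as [-> ->]. split; auto. simpl.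
    symmetry; apply is_derive_unique.
    replace (Derive (fun e => snd (G e t)) 0) with (Derive (fun e => snd (G e t)) 0 + 0) by ring.
    apply @is_derive_plus; [|apply is_derive_const_R].
    apply (Cn2_is_derive 0 (box d a b) (fun e t => snd (G e t))); auto. apply box_0; auto.
Qed.

(** For [G = F + dh], the G-length of an F-unit speed curve measured from parameter 0. *)
Definition height (h : R -> R) (c : curve) (t : R) : R := t + (h (rc c t) - h (rc c 0)).

Section JacobiExact.
Context {F Fr Fu Fv G Gr Gu Gv : R -> R -> R -> R} {h : R -> R}
  (H : exact_change F Fr Fu Fv G Gr Gu Gv h).

(* If [psi e] inverts the change of parameter of the e-th curve, then the new
   variation field differs from J by a multiple of the velocity, which vanishes
   together with J. *)
Lemma unit_jacobi_exact a b a1 b1 c J1 J2 :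
  unit_jacobi (rotational F) a b c J1 J2 -> a < a1 -> a1 < 0 -> 0 < b1 -> b1 < b -> J1 0 = 0 ->
  exists rho J1' J2',
    unit_jacobi (rotational G) (height h c a1) (height h c b1) rho J1' J2' /\
    (forall t t', a < t -> t < t' -> t' < b -> height h c t < height h c t') /\
    forall t, a1 < t < b1 -> rho (height h c t) = c t /\
      ((J1' (height h c t), J2' (height h c t)) = (0, 0) <-> (J1 t, J2 t) = (0, 0)).
Proof.
  intros (d & V & hd & Sx & Sy & V0 & HV & HJ) ha ha1 hb1 hb z.
  set (x := fun e t => fst (V e t)) in *. set (y := fun e t => snd (V e t)) in *.
  assert (Hh := ec_h H).
  set (phi := fun e t => t + (h (x e t) - h (x e 0))).
  assert (o := open2_box d a b).
  assert (Sphi : smooth2_on (box d a b) phi).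
  { intros n. apply Cn2_plus; auto using Cn2_id2. apply Cn2_minus; auto.
    - apply (smooth_comp (box d a b) h x); auto.
    - apply (smooth_comp (box d a b) h (fun e _ => x e 0)); auto.
      intros k. apply (Cn2_comp k (box d a b) (box d a b) x (fun e _ => e) (fun _ _ => 0));
        auto using Cn2_id1, Cn2_const.
      intros e t [he _]. split; auto; lra. }
  assert (Vel : forall e t, box d a b e t -> at_velocity F (V e) t = 1 /\ 0 < at_velocity G (V e) t).
  { intros e t [he ht].
    apply (unit_geodesic_velocity H a b); [apply HV; auto | split; simpl; lra]. }
  assert (Dphi : forall e t, box d a b e t -> is_derive (phi e) t (at_velocity G (V e) t)).
  { intros e t [he ht]. apply (height_derive H a b).
    - apply (HV e he).
    - split; simpl; lra.
    - apply Vel; split; auto. }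
  assert (Mono : forall e t1 t2, Rabs e < d -> a < t1 -> t1 < t2 -> t2 < b -> phi e t1 < phi e t2).
  { intros e t1 t2 he k1 k2 k3. apply derive_pos_lt with (at_velocity G (V e)); auto; intros s hs.
    - apply Dphi; split; auto; lra.
    - apply Vel; split; auto; lra. }
  assert (phi0 : forall t, a < t < b -> phi 0 t = height h c t).
  { intros t ht. unfold phi, height, x, rc. now rewrite !V0 by lra. }
  assert (R0 : Rabs 0 < d) by (rewrite Rabs_R0; auto).
  (* The margin between [a2], [b2] and [a1], [b1] ensures that for small [e] every [phi e] still
     covers the fixed range from [A1] to [B1]. *)
  set (a2 := (a + a1) / 2). set (b2 := (b1 + b) / 2).
  assert (h2 : a < a2 < a1 /\ b1 < b2 < b) by (unfold a2, b2; lra).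
  set (A1 := height h c a1). set (B1 := height h c b1).
  assert (M1 : phi 0 a2 < A1) by (unfold A1; rewrite <- phi0 by lra; apply Mono; auto; lra).
  assert (M2 : B1 < phi 0 b2) by (unfold B1; rewrite <- phi0 by lra; apply Mono; auto; lra).
  assert (Cphi : forall t, a < t < b -> forall eps : posreal,
     exists del : posreal, forall e, Rabs e < del -> Rabs (phi e t - phi 0 t) < eps).
  { intros t ht eps. destruct (Cn2_continuity 0 _ _ _ _ (Sphi 0%nat) (box_0 d a b t hd ht) eps) as [del Hd].
    exists del. intros e he. apply Hd; [rewrite Rminus_0_r; auto | rewrite Rminus_diag, Rabs_R0; apply cond_pos]. }
  destruct (Cphi a2 ltac:(lra) (mkposreal _ (proj2 (Rlt_0_minus _ _) M1))) as [del1 Hd1].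
  destruct (Cphi b2 ltac:(lra) (mkposreal _ (proj2 (Rlt_0_minus _ _) M2))) as [del2 Hd2].
  simpl in Hd1, Hd2.
  set (d' := Rmin d (Rmin del1 del2)).
  assert (hd' : 0 < d') by (repeat apply Rmin_glb_lt; auto; apply cond_pos).
  assert (l0 : d' <= d) by apply Rmin_l.
  assert (l1 : d' <= del1) by (eapply Rle_trans; [apply Rmin_r | apply Rmin_l]).
  assert (l2 : d' <= del2) by (eapply Rle_trans; [apply Rmin_r | apply Rmin_r]).
  assert (Surj : forall e s, box d' A1 B1 e s -> exists t, box d a b e t /\ phi e t = s).
  { intros e s [he hs].
    assert (k1 := Hd1 e ltac:(lra)). assert (k2 := Hd2 e ltac:(lra)).
    apply Rabs_def2 in k1. apply Rabs_def2 in k2.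
    destruct (Ranalysis5.f_interv_is_interv (phi e) a2 b2 s) as (t & ht & E); try lra.
    - intros t ht. apply continuity_pt_filterlim, (ex_derive_continuous (phi e)).
      eexists. apply Dphi; split; lra.
    - exists t; split; auto; split; lra. }
  set (psi := fun e s => epsilon (inhabits 0) (fun t => box d a b e t /\ phi e t = s)).
  assert (Hpsi : forall e s, box d' A1 B1 e s -> box d a b e (psi e s) /\ phi e (psi e s) = s).
  { intros e s hs. apply (epsilon_spec (inhabits 0) (fun t => box d a b e t /\ phi e t = s)), Surj, hs. }
  assert (Inj : forall e t1 t2, box d a b e t1 -> box d a b e t2 -> phi e t1 = phi e t2 -> t1 = t2).
  { intros e t1 t2 [he k1] [_ k2] E. destruct (Rtotal_order t1 t2) as [l|[l|l]]; auto.
    - assert (k := Mono e t1 t2 he ltac:(lra) l ltac:(lra)); lra.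
    - assert (k := Mono e t2 t1 he ltac:(lra) l ltac:(lra)); lra. }
  destruct (smooth_inverse (box d a b) (box d' A1 B1) phi psi) as [Spsi Dpsi]; auto using open2_box.
  { intros e t1 t t2 [he k1] [_ k2] k3. split; auto; lra. }
  { intros e t bt. replace (dy phi e t) with (at_velocity G (V e) t); [apply Vel; auto|].
    symmetry; apply is_derive_unique, Dphi, bt. }
  assert (Comp : forall f, smooth2_on (box d a b) f -> smooth2_on (box d' A1 B1) (fun e s => f e (psi e s))).
  { intros f Sf n. apply (Cn2_comp n (box d' A1 B1) (box d a b) f (fun e _ => e) psi);
      auto using open2_box, Cn2_id1. intros e s hs; apply Hpsi; auto. }
  assert (HA : forall t, a1 < t < b1 -> A1 < height h c t < B1).
  { intros t ht. unfold A1, B1. rewrite <- !phi0 by lra. split; apply Mono; auto; lra. }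
  assert (Hp : forall t, a1 < t < b1 -> psi 0 (height h c t) = t).
  { intros t ht. destruct (Hpsi 0 (height h c t)) as [k1 k2]; [apply box_0; auto|].
    apply (Inj 0); auto; [apply box_0; auto; lra|]. rewrite k2, phi0; auto; lra. }
  exists (fun s => V 0 (psi 0 s)), (fun s => Derive (fun e => fst (V e (psi e s))) 0),
    (fun s => Derive (fun e => snd (V e (psi e s))) 0).
  split; [|split].
  - exists d', (fun e s => V e (psi e s)).
    split; [|split; [|split; [|split; [|split]]]]; auto.
    + apply (Comp x); auto.
    + apply (Comp y); auto.
    + intros e he.
      apply (unit_geodesic_exact H a b (V e) A1 B1 (psi e) (h (x e 0))).
      * apply HV; lra.
      * intros s [k1 k2]; simpl in k1, k2. destruct (Hpsi e s (conj he (conj k1 k2))) as [[_ k3] k4].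
        split; [split; simpl; lra | exact k4].
  - intros t t' k1 k2 k3. rewrite <- !phi0 by lra. apply Mono; auto.
  - intros t ht. rewrite Hp by auto. split; [apply V0; lra|].
    assert (bt : box d a b 0 t) by (apply box_0; auto; lra).
    assert (bs : box d' A1 B1 0 (height h c t)) by (apply box_0; auto).
    destruct (HJ t ltac:(lra)) as [j1 j2]. destruct (HJ 0 ltac:(lra)) as [j0 _].
    rewrite z in j0. change (0 = Derive (fun e => x e 0) 0) in j0.
    change (J1 t = Derive (fun e => x e t) 0) in j1. change (J2 t = Derive (fun e => y e t) 0) in j2.
    destruct (Dpsi 0 (height h c t) bs) as [De _]. rewrite Hp in De by auto.
    assert (Dyp : dy phi 0 t = 1 + Derive h (x 0 t) * dy x 0 t).
    { transitivity (at_velocity G (V 0) t); [apply is_derive_unique, Dphi, bt|].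
      unfold at_velocity. rewrite (ec_eq H).
      destruct (Vel 0 t bt) as [k _]. unfold at_velocity in k. rewrite k. reflexivity. }
    assert (Dyp' : 0 < dy phi 0 t).
    { replace (dy phi 0 t) with (at_velocity G (V 0) t); [apply Vel; auto|].
      symmetry; apply is_derive_unique, Dphi, bt. }
    (* [J1 0 = 0] removes the contribution of the starting point [x e 0]. *)
    assert (Dxp : dx phi 0 t = Derive h (x 0 t) * J1 t).
    { apply is_derive_unique. rewrite j1.
      replace (Derive h (x 0 t) * Derive (fun e => x e t) 0) with
        (0 + (Derive (fun e => x e t) 0 * Derive h (x 0 t) - Derive (fun e => x e 0) 0 * Derive h (x 0 0)))
        by (rewrite <- j0; ring).
      apply @is_derive_plus; [apply is_derive_const_R|].
      apply @is_derive_minus.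
      - apply (is_derive_comp h (fun e => x e t)); [apply smooth_is_derive, Hh|].
        apply (Cn2_is_derive 0 (box d a b) x); auto.
      - apply (is_derive_comp h (fun e => x e 0)); [apply smooth_is_derive, Hh|].
        apply (Cn2_is_derive 0 (box d a b) x); auto. apply box_0; auto; lra. }
    rewrite Dxp in De.
    (* [tau] is the e-derivative of [psi] at a fixed new parameter; by the chain rule [Q] the new
       field is [J] plus [tau] times the velocity. *)
    set (tau := - (Derive h (x 0 t) * J1 t) / dy phi 0 t) in *.
    assert (Q : forall f, smooth2_on (box d a b) f ->
      Derive (fun e => f e (psi e (height h c t))) 0 = dx f 0 t + dy f 0 t * tau).
    { intros f Sf. apply is_derive_unique.
      assert (Df := Cn2_differentiable 0 _ f 0 t o (Sf 1%nat) bt).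
      rewrite <- (Rmult_1_r (dx f 0 t)).
      apply is_derive_Reals. apply (derivable_pt_lim_comp_2d f (fun e => e) (fun e => psi e (height h c t))).
      - rewrite Hp by auto. exact Df.
      - apply is_derive_Reals, is_derive_id_R.
      - apply is_derive_Reals, De. }
    change (Derive (fun e => fst (V e (psi e (height h c t)))) 0)
      with (Derive (fun e => x e (psi e (height h c t))) 0).
    change (Derive (fun e => snd (V e (psi e (height h c t)))) 0)
      with (Derive (fun e => y e (psi e (height h c t))) 0).
    rewrite (Q x Sx), (Q y Sy).
    change (dx x 0 t) with (Derive (fun e => x e t) 0). change (dx y 0 t) with (Derive (fun e => y e t) 0).
    rewrite <- j1, <- j2.
    assert (T : tau * dy phi 0 t = - (Derive h (x 0 t) * J1 t)) by (unfold tau; field; lra).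
    split; intros q; injection q; intros q2 q1.
    (* If [J] is [- tau] times the velocity, then [tau (1 + h' r') = - h' J1 = tau h' r'], so
       [tau = 0]. *)
    + assert (tau = 0).
      { rewrite Dyp in T. replace (J1 t) with (- (dy x 0 t * tau)) in T by lra. nra. }
      f_equal; nra.
    + assert (tau = 0) by (unfold tau; rewrite q1; field; lra).
      f_equal; nra.
Qed.

End JacobiExact.

(** ** Unique continuation *)

(** Gronwall's estimate for [p^2 + q^2], whose derivative is bounded by [k] times itself, applied on
    either side of [t0]. *)
Lemma linear_system_zero (a b : Rbar) (p q : R -> R) (k11 k12 k21 k22 : R -> R) t0 :
  inside a b t0 ->
  (forall t, inside a b t -> is_derive p t (k11 t * p t + k12 t * q t)) ->
  (forall t, inside a b t -> is_derive q t (k21 t * p t + k22 t * q t)) ->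
  (forall t, inside a b t -> continuous k11 t /\ continuous k12 t /\ continuous k21 t /\ continuous k22 t) ->
  p t0 = 0 -> q t0 = 0 ->
  forall t, inside a b t -> p t = 0 /\ q t = 0.
Proof.
  intros i0 Dp Dq C p0 q0.
  set (k := fun s => 2 * (Rabs (k11 s) + Rabs (k12 s) + Rabs (k21 s) + Rabs (k22 s))).
  assert (Ck : forall t, inside a b t -> continuous k t).
  { intros t ht. destruct (C t ht) as (c1 & c2 & c3 & c4). unfold k.
    apply (continuous_scal_r 2 (fun s => Rabs (k11 s) + Rabs (k12 s) + Rabs (k21 s) + Rabs (k22 s))).
    repeat apply @continuous_plus; apply continuous_comp; auto; apply continuous_Rabs. }
  set (E := fun s => p s ^ 2 + q s ^ 2).
  assert (E0 : E t0 = 0) by (unfold E; rewrite p0, q0; ring).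
  assert (DE : forall t, inside a b t -> exists l, is_derive E t l /\ Rabs l <= k t * E t).
  { intros t ht. eexists. split.
    - apply @is_derive_plus.
      + apply (is_derive_pow p 2); apply Dp, ht.
      + apply (is_derive_pow q 2); apply Dq, ht.
    - unfold plus; simpl. unfold k, E.
      set (x := p t). set (y := q t).
      replace ((1 + 1) * (k11 t * x + k12 t * y) * (x * 1) + (1 + 1) * (k21 t * x + k22 t * y) * (y * 1))
        with (2 * (k11 t * x ^ 2) + (2 * ((k12 t + k21 t) * (x * y)) + 2 * (k22 t * y ^ 2))) by ring.
      assert (XY : Rabs (x * y) <= x ^ 2 + y ^ 2).
      { assert (u1 := pow2_ge_0 (x - y)). assert (u2 := pow2_ge_0 (x + y)). apply Rabs_le. nra. }
      eapply Rle_trans; [apply Rabs_triang|].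
      assert (X2 := pow2_ge_0 x). assert (Y2 := pow2_ge_0 y).
      assert (T1 : Rabs (2 * (k11 t * x ^ 2)) = 2 * (Rabs (k11 t) * x ^ 2)).
      { rewrite !Rabs_mult, (Rabs_pos_eq 2), (Rabs_pos_eq (x ^ 2)) by lra. ring. }
      assert (T2 : Rabs (2 * (k22 t * y ^ 2)) = 2 * (Rabs (k22 t) * y ^ 2)).
      { rewrite !Rabs_mult, (Rabs_pos_eq 2), (Rabs_pos_eq (y ^ 2)) by lra. ring. }
      assert (T3 : Rabs (2 * ((k12 t + k21 t) * (x * y))) <= 2 * ((Rabs (k12 t) + Rabs (k21 t)) * (x ^ 2 + y ^ 2))).
      { rewrite !Rabs_mult, (Rabs_pos_eq 2) by lra. apply Rmult_le_compat_l; [lra|].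
        rewrite <- Rabs_mult. apply Rmult_le_compat; try apply Rabs_pos; auto. apply Rabs_triang. }
      assert (T4 := Rabs_triang (2 * ((k12 t + k21 t) * (x * y))) (2 * (k22 t * y ^ 2))).
      assert (z1 := Rabs_pos (k11 t)). assert (z2 := Rabs_pos (k22 t)).
      assert (z3 : 0 <= Rabs (k11 t) * y ^ 2) by (apply Rmult_le_pos; auto).
      assert (z4 : 0 <= Rabs (k22 t) * x ^ 2) by (apply Rmult_le_pos; auto).
      lra. }
  assert (EP : forall t, 0 <= E t).
  { intros t. assert (X2 := pow2_ge_0 (p t)). assert (Y2 := pow2_ge_0 (q t)). unfold E; lra. }
  assert (Z : forall t, inside a b t -> E t = 0).
  { intros t ht.
    destruct (Req_dec t t0) as [->|ne]; auto.
    assert (seg : forall s, Rmin t0 t <= s <= Rmax t0 t -> inside a b s)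
      by (intros s hs; exact (inside_segment a b t0 t s i0 ht hs)).
    destruct (continuity_ab_maj k (Rmin t0 t) (Rmax t0 t)) as (mx & Hmx & _).
    { apply Rmin_Rmax. }
    { intros s hs. apply continuity_pt_filterlim, Ck, seg, hs. }
    set (M := k mx) in *.
    assert (T : forall sg, (sg = 1 /\ t0 < t) \/ (sg = -1 /\ t < t0) -> E t <= 0).
    { intros sg Hsg.
      (* [E exp (-M s)] decreases and [E exp (M s)] increases. *)
      set (W := fun s => E s * exp (- (sg * M * s))).
      assert (DWx : exists dW, (forall s, Rmin t0 t <= s <= Rmax t0 t -> is_derive W s (dW s)) /\
         forall s, Rmin t0 t <= s <= Rmax t0 t -> sg * dW s <= 0).
      { exists (fun s => (Derive E s - sg * M * E s) * exp (- (sg * M * s))). split; intros s hs;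
          destruct (DE s (seg s hs)) as (l & Dl & Bl).
        - unfold W. rewrite (is_derive_unique _ _ _ Dl). evar_last.
          + apply (is_derive_mult E (fun s => exp (- (sg * M * s)))); [exact Dl | | intros; apply Rmult_comm].
            auto_derive; auto.
          + unfold plus, mult; simpl. ring.
        - rewrite (is_derive_unique _ _ _ Dl). rewrite <- Rmult_assoc.
          apply Rmult_le_0_r; [|left; apply exp_pos].
          assert (Bk : k s * E s <= M * E s) by (apply Rmult_le_compat_r; auto).
          apply Rabs_le_between in Bl.
          destruct Hsg as [[-> _]|[-> _]]; nra. }
      destruct DWx as (dW & D1 & D2).
      destruct (MVT_gen W t0 t dW) as (s & hs & Q).
      - intros s hs; apply D1; lra.
      - intros s hs. apply continuity_pt_filterlim, (ex_derive_continuous W). eexists; apply D1; auto.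
      - assert (W0 : W t0 = 0) by (unfold W; rewrite E0; ring).
        rewrite W0 in Q. assert (N := D2 s hs).
        assert (Wt : W t <= 0) by (destruct Hsg as [[-> lt]|[-> lt]]; nra).
        unfold W in Wt. assert (ep := exp_pos (- (sg * M * t))).
        apply Rnot_lt_le. intros n. assert (0 < E t * exp (- (sg * M * t))) by (apply Rmult_lt_0_compat; auto).
        lra. }
    apply Rle_antisym; auto.
    destruct (Rtotal_order t0 t) as [l|[l|l]]; [apply (T 1); auto | congruence | apply (T (-1)); auto]. }
  intros t ht. assert (z := Z t ht). unfold E in z.
  assert (X2 := pow2_ge_0 (p t)). assert (Y2 := pow2_ge_0 (q t)).
  split; apply Rsqr_0_uniq; unfold Rsqr; simpl in *; lra.
Qed.

Lemma dx_mult_comp D g x f e t : open2 D -> smooth g -> smooth2_on D x -> smooth2_on D f ->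
  D e t -> dx (fun e t => g (x e t) * f e t) e t
    = Derive g (x e t) * dx x e t * f e t + g (x e t) * dx f e t.
Proof.
  intros o Sg Sx Sf d. apply is_derive_unique.
  rewrite (Rmult_comm (Derive g (x e t))).
  apply (is_derive_mult (fun e => g (x e t)) (fun e => f e t)); [| |intros; apply Rmult_comm].
  - apply (is_derive_comp g (fun e => x e t)); [apply smooth_is_derive, Sg|].
    apply (Cn2_is_derive 0 D x); auto.
  - apply (Cn2_is_derive 0 D f); auto.
Qed.

Lemma dx_ext D f g e t : open2 D -> (forall e t, D e t -> f e t = g e t) -> D e t ->
  dx f e t = dx g e t.
Proof.
  intros o H d. apply Derive_ext_loc.
  generalize (open2_locally_x D e t o d); apply filter_imp; auto.
Qed.

Section Continuation.
Context (m A : R -> R) (B : R) (W : navigation m A B).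

Let l := lam m A 0.

(** At alpha-unit speed the momenta are linear in the velocity, and [sym_r] is a function of [r] and
    the momenta. The Euler-Lagrange equations thus take Hamiltonian form, a first-order system with
    smooth right-hand side. *)
Lemma sym_unit_partials r u v : (u, v) <> (0, 0) -> sym m A r u v = 1 ->
  sym_u m A r u v = u / l r ^ 2 /\ zermelo_v m A 0 r u v = m r ^ 2 * v / l r /\
  sym_r m A r u v = A r * Derive A r / l r + A r * Derive A r * l r * (u / l r ^ 2) ^ 2
    + Derive m r * l r / m r ^ 3 * (m r ^ 2 * v / l r) ^ 2.
Proof.
  intros n U. assert (lp := lam_0_pos m A B W r). assert (mp := nav_m_pos W r).
  rewrite (sym_eq m A B W) in U.
  assert (S : zroot m A 0 r u v = l r).
  { fold l in U. fold l in lp. replace (zroot m A 0 r u v) with (zroot m A 0 r u v / l r * l r) by (field; lra).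
    rewrite U; ring. }
  assert (Z : zermelo m A 0 r u v = (l r - A r * u) / l r).
  { unfold zermelo. rewrite S. unfold wdot. fold l. f_equal. ring. }
  assert (D1 : Derive (potential m A) r = A r / l r) by (apply (potential_smooth m A B W)).
  assert (D2 : Derive (Derive (potential m A)) r = (Derive A r * l r + 2 * A r ^ 2 * Derive A r) / l r ^ 2).
  { rewrite (Derive_ext (Derive (potential m A)) (fun r => A r / l r)) by apply (potential_smooth m A B W).
    apply is_derive_unique.
    assert (DA := smooth_is_derive A r (nav_A W)). assert (Dm := smooth_is_derive m r (nav_m W)).
    unfold l, lam in *. auto_derive.
    - repeat split; try (eexists; eassumption). lra.
    - change (Derive (fun x => A x) r) with (Derive A r). change (Derive (fun x => m x) r) with (Derive m r).
      field. lra. }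
  unfold sym_u, sym_r, zermelo_u, zermelo_v, zermelo_r. rewrite S, Z, D1, D2.
  assert (A2 : A r ^ 2 = 1 - l r) by (unfold l, lam; ring).
  fold l in lp. set (L := l r) in *. set (a := A r) in *. set (a' := Derive A r).
  split; [|split].
  - apply Rmult_eq_reg_r with (L ^ 2); [|nra]. field_simplify; try lra. nra.
  - field. lra.
  - apply Rmult_eq_reg_r with (L ^ 3 * m r); [|apply Rgt_not_eq, Rmult_lt_0_compat; auto; apply pow_lt; auto].
    replace L with (1 - a ^ 2) in * by lra. field. lra.
Qed.

(** The equations [x' = g1(x) p], [p' = Y], [q' = 0], [y' = g4(x) q] are linearized in [e]. The
    variation of [q] is constant, hence zero; those of [x] and [p] then solve a closed linear system
    with zero data at [t0]; and the variation of [y] is constant. *)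
Lemma sym_jacobi_continuation a b c J1 J2 x1 x2 :
  unit_jacobi (rotational (sym m A)) a b c J1 J2 ->
  a <= x1 -> x1 < x2 -> x2 <= b ->
  (forall t, x1 < t < x2 -> J1 t = 0 /\ J2 t = 0) ->
  forall t, a < t < b -> J1 t = 0 /\ J2 t = 0.
Proof.
  intros (d & G & hd & Sx & Sy & _ & HG & HJ) ax x12 xb Z.
  set (x := fun e t => fst (G e t)) in *. set (y := fun e t => snd (G e t)) in *.
  change (forall t, a < t < b -> J1 t = dx x 0 t /\ J2 t = dx y 0 t) in HJ.
  set (D := box d a b) in *. assert (o : open2 D) by apply open2_box.
  assert (b0 : forall t, a < t < b -> D 0 t) by (intros; apply box_0; auto).
  assert (E01 := exact_change_sym_zermelo m A B W).
  assert (RS := ec_G E01).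
  assert (os := open2_strip m_infty p_infty).
  assert (Sm := fun n => smooth_on_Cn2_y _ _ _ n (nav_m W)).
  assert (SA := fun n => smooth_on_Cn2_y _ _ _ n (nav_A W)).
  assert (Sm' := fun n => smooth_on_Cn2_y _ _ _ n (smooth_on_Derive _ _ _ (nav_m W))).
  assert (SA' := fun n => smooth_on_Cn2_y _ _ _ n (smooth_on_Derive _ _ _ (nav_A W))).
  assert (lp : forall r, 0 < l r) by (intros; apply (lam_0_pos m A B W)).
  assert (mp := nav_m_pos W).
  assert (Sl : forall n, Cn2_on n (strip m_infty p_infty) (fun _ r => l r)).
  { intros n. unfold l, lam. Cn2_arith. }
  assert (lne : forall k r, l r ^ k <> 0) by (intros; apply pow_nonzero, Rgt_not_eq, lp).
  assert (mne : forall k r, m r ^ k <> 0) by (intros; apply pow_nonzero, Rgt_not_eq, mp).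
  assert (lne1 : forall r, l r <> 0) by (intros; apply Rgt_not_eq, lp).
  set (g1 := fun r => l r ^ 2). set (g2 := fun r => / l r ^ 2).
  set (g3 := fun r => m r ^ 2 / l r). set (g4 := fun r => l r / m r ^ 2).
  set (c0 := fun r => A r * Derive A r / l r). set (c2 := fun r => A r * Derive A r * l r).
  set (c3 := fun r => Derive m r * l r / m r ^ 3).
  assert (S1 : smooth g1) by (apply Cn2_smooth_on; intros n; unfold g1; Cn2_arith).
  assert (S2 : smooth g2) by (apply Cn2_smooth_on; intros n; unfold g2; apply Cn2_inv; auto; Cn2_arith).
  assert (S3 : smooth g3) by (apply Cn2_smooth_on; intros n; unfold g3; apply Cn2_div; auto; Cn2_arith).
  assert (S4 : smooth g4) by (apply Cn2_smooth_on; intros n; unfold g4; apply Cn2_div; auto; Cn2_arith).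
  assert (T0 : smooth c0) by (apply Cn2_smooth_on; intros n; unfold c0; apply Cn2_div; auto; Cn2_arith).
  assert (T2 : smooth c2) by (apply Cn2_smooth_on; intros n; unfold c2; Cn2_arith).
  assert (T3 : smooth c3) by (apply Cn2_smooth_on; intros n; unfold c3; apply Cn2_div; auto; Cn2_arith).
  assert (Scomp : forall g, smooth g -> smooth2_on D (fun e t => g (x e t))) by (intros; apply smooth_comp; auto).
  assert (Sxt : smooth2_on D (dy x)) by (intros n; apply Cn2_dy, Sx).
  assert (Syt : smooth2_on D (dy y)) by (intros n; apply Cn2_dy, Sy).
  set (p := fun e t => g2 (x e t) * dy x e t). set (q := fun e t => g3 (x e t) * dy y e t).
  assert (Sp : smooth2_on D p) by (intros n; apply Cn2_mult; auto; apply Scomp; auto).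
  assert (Sq : smooth2_on D q) by (intros n; apply Cn2_mult; auto; apply Scomp; auto).
  assert (Xp : forall e t, D e t -> dy x e t = g1 (x e t) * p e t).
  { intros e t _. unfold p, g1, g2. field. auto. }
  assert (Yq : forall e t, D e t -> dy y e t = g4 (x e t) * q e t).
  { intros e t _. unfold q, g4, g3. field. split; auto. apply Rgt_not_eq, mp. }
  (* The factor 1 gives every summand the shape [g (x e t) * f e t] that [dx_mult_comp]
     differentiates. *)
  set (Y := fun e t => c0 (x e t) * 1 + (c2 (x e t) * p e t ^ 2 + c3 (x e t) * q e t ^ 2)).
  assert (EL : forall e t, D e t -> dy p e t = Y e t /\ dy q e t = 0).
  { intros e t dt. destruct dt as [he ht].
    destruct (proj1 (unit_geodesic_extremal RS a b (G e)) (HG e he)) as [(_ & _ & E) U].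
    assert (Part : forall s, inside a b s ->
       at_velocity (sym_u m A) (G e) s = p e s /\ at_velocity (zermelo_v m A 0) (G e) s = q e s /\
       at_velocity (sym_r m A) (G e) s = Y e s).
    { intros s hs. destruct (sym_unit_partials (rc (G e) s) (Derive (rc (G e)) s) (Derive (thc (G e)) s))
        as (P1 & P2 & P3); [apply E, hs | apply U, hs|].
      unfold at_velocity. rewrite P1, P2, P3. unfold Y, p, q, g2, g3, c0, c2, c3.
      change (rc (G e) s) with (x e s). change (Derive (rc (G e)) s) with (dy x e s).
      change (Derive (thc (G e)) s) with (dy y e s).
      assert (k1 := lne1 (x e s)). assert (k2 := Rgt_not_eq _ _ (mp (x e s))).
      split; [|split]; field; auto. }
    assert (it : inside a b t) by (split; simpl; lra).
    destruct (E t it) as (_ & E1 & E2). split.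
    - rewrite <- (proj2 (proj2 (Part t it))). apply is_derive_unique.
      refine (is_derive_inside_ext a b _ _ t _ it _ E1); intros; apply Part; auto.
    - apply is_derive_unique. refine (is_derive_inside_ext a b _ _ t _ it _ E2); intros; apply Part; auto. }
  (* At an interior time of [(x1, x2)] the field vanishes together with its t-derivative, hence so
     do the variations of the momenta. *)
  set (t0 := (x1 + x2) / 2). assert (h0 : x1 < t0 < x2) by (unfold t0; lra).
  assert (JZ : forall z J, (forall t, a < t < b -> J t = dx z 0 t) -> (forall t, x1 < t < x2 -> J t = 0) ->
     dx z 0 t0 = 0 /\ dy (dx z) 0 t0 = 0).
  { intros z J Hz HZ. split; [rewrite <- Hz, HZ by lra; auto|].
    assert (it : inside x1 x2 t0) by (split; simpl; lra).
    unfold dy. rewrite (Derive_ext_loc _ (fun _ => 0)); [apply Derive_const|].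
    generalize (locally_inside x1 x2 t0 it); apply filter_imp. intros s [k1 k2]; simpl in k1, k2.
    rewrite <- Hz, HZ by lra; auto. }
  destruct (JZ x J1) as [xe0 xte0]; [intros; apply HJ; auto | intros; apply Z; auto|].
  destruct (JZ y J2) as [ye0 yte0]; [intros; apply HJ; auto | intros; apply Z; auto|].
  assert (d0 : D 0 t0) by (apply b0; lra).
  assert (pe0 : dx p 0 t0 = 0).
  { unfold p. rewrite (dx_mult_comp D) by auto. rewrite (Schwarz_on D) by auto.
    rewrite xe0, xte0. ring. }
  assert (qe0 : dx q 0 t0 = 0).
  { unfold q. rewrite (dx_mult_comp D) by auto. rewrite (Schwarz_on D) by auto.
    rewrite xe0, yte0. ring. }
  assert (Dt : forall f t, smooth2_on D f -> a < t < b -> is_derive (fun t => dx f 0 t) t (dx (dy f) 0 t)).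
  { intros f t Sf ht. rewrite (Schwarz_on D) by auto.
    apply (Cn2_is_derive 0 D (dx f)); auto. apply Cn2_dx, Sf. }
  assert (qe : forall t, a < t < b -> dx q 0 t = 0).
  { intros t ht. transitivity (dx q 0 t0); [|exact qe0]. apply (constant_inside a b (fun t => dx q 0 t)); try (split; simpl; lra).
    intros s [k1 k2]; simpl in k1, k2. evar_last; [apply Dt; auto|].
    rewrite (dx_ext D (dy q) (fun _ _ => 0)); [exact (Derive_const 0 0) | auto | intros; apply EL; auto | auto]. }
  assert (Cont : forall f t, smooth2_on D f -> a < t < b -> continuous (fun t => f 0 t) t).
  { intros f t Sf ht. apply (smooth_on_continuous a b (fun t => f 0 t)); [|split; simpl; lra].
    apply (smooth2_slice D a b f 0); auto. }
  assert (Main : forall t, inside a b t -> dx x 0 t = 0 /\ dx p 0 t = 0).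
  { apply (linear_system_zero a b (fun t => dx x 0 t) (fun t => dx p 0 t)
      (fun t => Derive g1 (x 0 t) * p 0 t) (fun t => g1 (x 0 t))
      (fun t => Derive c0 (x 0 t) + (Derive c2 (x 0 t) * p 0 t ^ 2 + Derive c3 (x 0 t) * q 0 t ^ 2))
      (fun t => 2 * c2 (x 0 t) * p 0 t) t0); auto.
    - split; simpl; lra.
    - intros t [k1 k2]; simpl in k1, k2. evar_last; [apply Dt; auto|].
      rewrite (dx_ext D (dy x) (fun e t => g1 (x e t) * p e t)), (dx_mult_comp D) by auto. ring.
    - intros t [k1 k2]; simpl in k1, k2. evar_last; [apply Dt; auto|].
      rewrite (dx_ext D (dy p) Y); [ | auto | intros; apply EL; auto | auto].
      assert (Dsqr : forall f, smooth2_on D f -> dx (fun e t => f e t ^ 2) 0 t = 2 * f 0 t * dx f 0 t).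
      { intros f Sf. apply is_derive_unique.
        destruct (Cn2_is_derive 0 D f 0 t (Sf 1%nat)) as [Df _]; auto.
        auto_derive; [eexists; exact Df|].
        change (Derive (fun e => f e t) 0) with (dx f 0 t). ring. }
      assert (S1' : smooth2_on D (fun _ _ => 1)) by (apply smooth2_const; auto).
      assert (Sp2 : smooth2_on D (fun e t => p e t ^ 2)) by (intros n; apply Cn2_pow; auto).
      assert (Sq2 : smooth2_on D (fun e t => q e t ^ 2)) by (intros n; apply Cn2_pow; auto).
      assert (Dpl : forall f g, smooth2_on D f -> smooth2_on D g ->
        dx (fun e t => f e t + g e t) 0 t = dx f 0 t + dx g 0 t).
      { intros f g Sf Sg. apply is_derive_unique. apply @is_derive_plus.
        - apply (Cn2_is_derive 0 D f 0 t (Sf 1%nat)); auto.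
        - apply (Cn2_is_derive 0 D g 0 t (Sg 1%nat)); auto. }
      assert (SM : forall g f, smooth g -> smooth2_on D f -> smooth2_on D (fun e t => g (x e t) * f e t))
        by (intros g f Sg Sf n; apply Cn2_mult; auto; apply Scomp; auto).
      assert (SPl : forall f g, smooth2_on D f -> smooth2_on D g -> smooth2_on D (fun e t => f e t + g e t))
        by (intros f g Sf Sg n; apply Cn2_plus; auto).
      unfold Y. rewrite (Dpl (fun e t => c0 (x e t) * 1)), Dpl by auto.
      rewrite !(dx_mult_comp D) by auto. rewrite !Dsqr, qe by auto.
      assert (D1 : dx (fun _ _ => 1) 0 t = 0) by exact (Derive_const 1 0).
      rewrite D1. R_eq. ring.
    - intros t [k1 k2]; simpl in k1, k2.
      assert (Sd : forall g, smooth g -> smooth2_on D (fun e t => Derive g (x e t)))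
        by (intros; apply Scomp, smooth_on_Derive; auto).
      split; [|split; [|split]].
      + apply (Cont (fun e t => Derive g1 (x e t) * p e t)); auto.
        intros n; apply Cn2_mult; auto; apply Sd; auto.
      + apply (Cont (fun e t => g1 (x e t))); auto.
      + apply (Cont (fun e t => Derive c0 (x e t) + (Derive c2 (x e t) * p e t ^ 2 + Derive c3 (x e t) * q e t ^ 2))); auto.
        intros n. assert (U0 := Sd c0 T0 n). assert (U2 := Sd c2 T2 n). assert (U3 := Sd c3 T3 n).
        assert (U4 := Sp n). assert (U5 := Sq n). Cn2_arith.
      + apply (Cont (fun e t => 2 * c2 (x e t) * p e t)); auto.
        intros n. assert (U2 := Scomp c2 T2 n). assert (U4 := Sp n). Cn2_arith. }
  intros t ht. destruct (HJ t ht) as [-> ->].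
  assert (it : inside a b t) by (split; simpl; lra).
  split; [apply Main; auto|].
  transitivity (dx y 0 t0); [|exact ye0]. apply (constant_inside a b (fun t => dx y 0 t)); auto; [|split; simpl; lra].
  intros s is. assert (hs : a < s < b) by (destruct is; auto). evar_last; [apply Dt; auto|].
  rewrite (dx_ext D (dy y) (fun e t => g4 (x e t) * q e t)), (dx_mult_comp D) by auto.
  rewrite qe by auto. rewrite (proj1 (Main s is)). ring.
Qed.

End Continuation.

(** * Conjugate points *)

(** The interval of the Jacobi field may exceed the one on which [c] is given as a unit speed
    geodesic. On all of it [c] is the central curve of the variation, hence a geodesic, and its
    speed at one time fixes it everywhere. *)
Lemma jacobi_unit_geodesic F Fr Fu Fv a b c J1 J2 t0 : regular F Fr Fu Fv -> continuous_metric F ->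
  jacobi_field (rotational F) a b c J1 J2 -> a < t0 < b -> at_velocity F c t0 = 1 ->
  unit_geodesic_on (rotational F) a b c.
Proof.
  intros HF CF (d & G & hd & _ & _ & G0 & HG & _) h0 U.
  assert (E : forall s, inside a b s -> G 0 s = c s) by (intros s [k1 k2]; simpl in k1, k2; auto).
  assert (i0 : inside a b t0) by (split; simpl; lra).
  apply (unit_geodesic_ext F Fr Fu Fv a b (G 0) c HF E).
  apply (geodesic_unit HF CF a b (G 0) t0); auto.
  - apply HG. rewrite Rabs_R0; auto.
  - rewrite (at_velocity_ext a b (G 0) c); auto.
Qed.

Section Conjugate.
Context (m A : R -> R) (B : R) (W : navigation m A B).

Let W0 := navigation_0 m A B W.
Let E01 := exact_change_sym_zermelo m A B W.
Let E10 := exact_change_sym E01.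
Let Cs := exact_continuous E01 (continuous_zermelo m A 0 W0).
Let Rs := ec_G E01.
Let RB := regular_zermelo m A B W.
Let CB := continuous_zermelo m A B W.

(** Contrapositive of unique continuation: a time of nonvanishing can be moved into a prescribed
    subinterval. *)
Lemma sym_jacobi_nonzero a b c J1 J2 x1 x2 t :
  unit_jacobi (rotational (sym m A)) a b c J1 J2 ->
  a <= x1 -> x1 < x2 -> x2 <= b -> a < t < b -> (J1 t, J2 t) <> (0, 0) ->
  exists t', x1 < t' < x2 /\ (J1 t', J2 t') <> (0, 0).
Proof.
  intros U h1 h2 h3 ht n. apply NNPP. intros N. apply n.
  destruct (sym_jacobi_continuation m A B W a b c J1 J2 x1 x2 U h1 h2 h3) with (t := t) as [-> ->]; auto.
  intros s hs. destruct (excluded_middle_informative ((J1 s, J2 s) = (0, 0))) as [e|e].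
  - injection e; auto.
  - elim N. eauto.
Qed.

Section Pair.
Context (a b : Rbar) (P : curve) (c d : Rbar) (rho : curve) (s : R -> R) (l : R)
  (h0 : inside a b 0) (hl : inside a b l) (l0 : 0 < l)
  (C : corresponds (rotational (zermelo m A 0)) (rotational (sym m A)) B a b P c d rho s).

Let UP : unit_geodesic_on (rotational (zermelo m A B)) a b P :=
  corresponds_geodesic m A B W _ _ _ _ _ _ _ C.

Lemma conjugate_zermelo_sym a' b' J1 J2 : a' < 0 -> l < b' ->
  jacobi_field (rotational (zermelo m A B)) a' b' P J1 J2 ->
  (J1 0, J2 0) = (0, 0) -> (J1 l, J2 l) = (0, 0) ->
  (exists t, a' < t < b' /\ (J1 t, J2 t) <> (0, 0)) ->
  exists a'' b'' K1 K2, a'' < 0 /\ s l < b'' /\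
    jacobi_field (rotational (sym m A)) a'' b'' rho K1 K2 /\
    (K1 0, K2 0) = (0, 0) /\ (K1 (s l), K2 (s l)) = (0, 0) /\
    exists t, a'' < t < b'' /\ (K1 t, K2 t) <> (0, 0).
Proof.
  intros ha hb J z0 zl (ts & hts & nz).
  injection z0; intros z2 z1. injection zl; intros z4 z3.
  assert (U1 : unit_geodesic_on (rotational (zermelo m A B)) a' b' P).
  { apply (jacobi_unit_geodesic _ _ _ _ a' b' P J1 J2 0 RB CB J); [lra|].
    exact (proj2 (proj1 (unit_geodesic_extremal RB a b P) UP) 0 h0). }
  (* [lo] and [hi] keep the witness [ts], besides 0 and [l], inside the two successively smaller
     intervals left by the normalization and the exact change. *)
  set (lo := Rmin 0 ts). set (hi := Rmax l ts).
  assert (lo1 : lo <= 0) by apply Rmin_l. assert (lo2 : lo <= ts) by apply Rmin_r.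
  assert (lo3 : a' < lo) by (apply Rmin_glb_lt; lra).
  assert (hi1 : l <= hi) by apply Rmax_l. assert (hi2 : ts <= hi) by apply Rmax_r.
  assert (hi3 : hi < b') by (apply Rmax_lub_lt; lra).
  set (a1 := (2 * a' + lo) / 3). set (a2 := (a' + 2 * lo) / 3).
  set (b1 := (2 * b' + hi) / 3). set (b2 := (b' + 2 * hi) / 3).
  assert (as_ : a' < a1 < a2 /\ a2 < lo) by (unfold a1, a2; lra).
  assert (bs_ : hi < b2 < b1 /\ b1 < b') by (unfold b1, b2; lra).
  assert (UJ : unit_jacobi (rotational (zermelo m A B)) a1 b1 P J1 J2).
  { apply (jacobi_unit_jacobi RB a' b' a1 b1 P J1 J2 l); auto; lra. }
  apply (unit_jacobi_wind m A B 0) in UJ; auto.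
  set (Q := fun t => (rc P t, thc P t + (0 - B) * t)) in *.
  destruct (unit_jacobi_exact E01 a1 b1 a2 b2 Q J1 J2 UJ)
    as (rh & K1 & K2 & UK & Mono & HK); try lra.
  set (ht := height (potential m A) Q) in *.
  destruct (proj1 (corresponds_iff m A B W _ _ _ _ _ _ _) C) as (i0 & Us & Hs & Hx).
  assert (P0 : P 0 = rho 0) by (apply (corresponds_minimizing m A B W a b P c d rho s 0 h0 h0 C)).
  assert (Qs : forall t, inside a b t -> Q t = rho (s t) /\ s t = ht t).
  { intros t it. destruct (Hs t it) as (k1 & k2 & k3).
    assert (Qt : Q t = rho (s t)).
    { unfold Q, rc, thc. rewrite k3. simpl. rewrite (surjective_pairing (rho (s t))).
      unfold rc, thc. f_equal. ring. }
    split; auto. unfold ht, height, rc. rewrite Qt. unfold Q, rc; simpl. rewrite P0.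
    unfold travel_time, rc in k2. lra. }
  assert (ht0 : ht 0 = 0) by (unfold ht, height; ring).
  destruct (inside_neighbours a b 0 h0) as (e0 & e0p & n1 & _).
  destruct (inside_neighbours a b l hl) as (el & elp & _ & n2).
  (* Within these bounds the given correspondence is defined, and there [rh] coincides with
     [rho]. *)
  set (a3 := Rmax a2 (0 - e0)). set (b3 := Rmin b2 (l + el)).
  assert (a3a : a2 <= a3) by apply Rmax_l. assert (a3b : 0 - e0 <= a3) by apply Rmax_r.
  assert (a3c : a3 < 0) by (apply Rmax_lub_lt; lra).
  assert (b3a : b3 <= b2) by apply Rmin_l. assert (b3b : b3 <= l + el) by apply Rmin_r.
  assert (b3c : l < b3) by (apply Rmin_glb_lt; lra).
  assert (i3 : inside a b a3) by (apply (inside_between a b (0 - e0) 0); auto; lra).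
  assert (i4 : inside a b b3) by (apply (inside_between a b l (l + el)); auto; lra).
  assert (Mono' : forall t t', a1 < t -> t <= t' -> t' < b1 -> ht t <= ht t').
  { intros t t' k1 [k2|<-] k3; [left; apply Mono; auto | lra]. }
  assert (UR : unit_jacobi (rotational (sym m A)) (ht a3) (ht b3) rho K1 K2).
  { apply (unit_jacobi_sub _ (ht a2) (ht b2) _ _ rh); auto; try (apply Mono'; lra).
    intros x hx. destruct (Qs a3 i3) as [_ e3]. destruct (Qs b3 i4) as [_ e4].
    assert (ix : inside c d x).
    { apply (inside_between c d (s a3) (s b3)); [apply Hs, i3 | apply Hs, i4 | lra]. }
    destruct (Hx x ix) as [it es]. set (t := travel_time m A rho x) in *.
    assert (k1 := corresponds_monotone m A B W a b P c d rho s a3 t i3 it C).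
    assert (k2 := corresponds_monotone m A B W a b P c d rho s t b3 it i4 C).
    rewrite es in *. assert (a3 < t) by (apply k1; lra). assert (t < b3) by (apply k2; lra).
    destruct (Qs t it) as [q1 q2]. rewrite <- es, <- q1, q2. apply HK; lra. }
  (* The restriction to [a3], [b3] may have cut off [ts]; unique continuation along [rh] on the
     larger interval supplies another witness. *)
  destruct (sym_jacobi_nonzero (ht a2) (ht b2) rh K1 K2 (ht a3) (ht b3) (ht ts)) as (t' & ht' & nz'); auto.
  - apply Mono'; lra.
  - apply Mono; lra.
  - apply Mono'; lra.
  - split; apply Mono; lra.
  - intros e. apply nz. apply (HK ts); auto; lra.
  - exists (ht a3), (ht b3), K1, K2. destruct (Qs l hl) as [_ el'].
    split; [rewrite <- ht0; apply Mono; lra|].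
    split; [rewrite el'; apply Mono; lra|].
    split; [apply unit_jacobi_jacobi, UR|].
    split; [rewrite <- (f_equal K1 ht0), <- (f_equal K2 ht0); apply (HK 0); auto; lra|].
    split; [rewrite el'; apply (HK l); auto; lra|].
    exists t'; auto.
Qed.

(** Unique continuation is proved for alpha only, so in this direction the witness is moved into the
    smaller interval before the metric is changed. *)
Lemma conjugate_sym_zermelo a' b' J1 J2 : a' < 0 -> s l < b' ->
  jacobi_field (rotational (sym m A)) a' b' rho J1 J2 ->
  (J1 0, J2 0) = (0, 0) -> (J1 (s l), J2 (s l)) = (0, 0) ->
  (exists t, a' < t < b' /\ (J1 t, J2 t) <> (0, 0)) ->
  exists a'' b'' K1 K2, a'' < 0 /\ l < b'' /\
    jacobi_field (rotational (zermelo m A B)) a'' b'' P K1 K2 /\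
    (K1 0, K2 0) = (0, 0) /\ (K1 l, K2 l) = (0, 0) /\
    exists t, a'' < t < b'' /\ (K1 t, K2 t) <> (0, 0).
Proof.
  intros ha hb J z0 zl (ts & hts & nz).
  injection z0; intros z2 z1. injection zl; intros z4 z3.
  destruct (proj1 (corresponds_iff m A B W _ _ _ _ _ _ _) C) as (i0 & Us & Hs & Hx).
  assert (s0 : s 0 = 0) by (apply (corresponds_minimizing m A B W a b P c d rho s 0 h0 h0 C)).
  assert (Mon := fun t t' i i' => corresponds_monotone m A B W a b P c d rho s t t' i i' C).
  assert (sl : 0 < s l) by (rewrite <- s0; apply (Mon 0 l); auto).
  destruct (Hs l hl) as (il & Tl & _).
  assert (U1 : unit_geodesic_on (rotational (sym m A)) a' b' rho).
  { apply (jacobi_unit_geodesic _ _ _ _ a' b' rho J1 J2 0 Rs Cs J); [lra|].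
    exact (proj2 (proj1 (unit_geodesic_extremal Rs c d rho) Us) 0 i0). }
  set (lo := Rmin 0 ts). set (hi := Rmax (s l) ts).
  assert (lo1 : lo <= 0) by apply Rmin_l. assert (lo2 : lo <= ts) by apply Rmin_r.
  assert (lo3 : a' < lo) by (apply Rmin_glb_lt; lra).
  assert (hi1 : s l <= hi) by apply Rmax_l. assert (hi2 : ts <= hi) by apply Rmax_r.
  assert (hi3 : hi < b') by (apply Rmax_lub_lt; lra).
  set (a1 := (a' + lo) / 2). set (b1 := (b' + hi) / 2).
  assert (as_ : a' < a1 < lo) by (unfold a1; lra).
  assert (bs_ : hi < b1 < b') by (unfold b1; lra).
  assert (UJ : unit_jacobi (rotational (sym m A)) a1 b1 rho J1 J2).
  { apply (jacobi_unit_jacobi Rs a' b' a1 b1 rho J1 J2 (s l)); auto; lra. }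
  destruct (inside_neighbours c d 0 i0) as (e0 & e0p & n1 & _).
  destruct (inside_neighbours c d (s l) il) as (el & elp & _ & n2).
  set (a3 := Rmax a1 (0 - e0)). set (b3 := Rmin b1 (s l + el)).
  assert (a3a : a1 <= a3) by apply Rmax_l. assert (a3b : 0 - e0 <= a3) by apply Rmax_r.
  assert (a3c : a3 < 0) by (apply Rmax_lub_lt; lra).
  assert (b3a : b3 <= b1) by apply Rmin_l. assert (b3b : b3 <= s l + el) by apply Rmin_r.
  assert (b3c : s l < b3) by (apply Rmin_glb_lt; lra).
  set (a4 := a3 / 2). set (b4 := (s l + b3) / 2).
  assert (h4 : a3 < a4 < 0 /\ s l < b4 < b3) by (unfold a4, b4; lra).
  assert (i3 : inside c d a4) by (apply (inside_between c d (0 - e0) 0); auto; lra).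
  assert (i4 : inside c d b4) by (apply (inside_between c d (s l) (s l + el)); auto; lra).
  destruct (sym_jacobi_nonzero a1 b1 rho J1 J2 a4 b4 ts UJ) as (t' & ht' & nz'); auto; try lra.
  assert (UJ3 : unit_jacobi (rotational (sym m A)) a3 b3 rho J1 J2)
    by (apply (unit_jacobi_sub _ a1 b1 _ _ rho); auto).
  destruct (unit_jacobi_exact E10 a3 b3 a4 b4 rho J1 J2 UJ3)
    as (rh & K1 & K2 & UK & Mono & HK); try lra.
  change (height (fun r => - potential m A r) rho) with (travel_time m A rho) in *.
  set (T := travel_time m A rho) in *.
  assert (T0 : T 0 = 0) by apply travel_time_0.
  apply (unit_jacobi_wind m A 0 B) in UK; auto.
  assert (UR : unit_jacobi (rotational (zermelo m A B)) (T a4) (T b4) P K1 K2).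
  { apply (unit_jacobi_sub _ _ _ _ _ _ P) with (4 := UK); try lra.
    intros t ht. destruct (Hx a4 i3) as [j3 e3]. destruct (Hx b4 i4) as [j4 e4].
    assert (it : inside a b t) by (apply (inside_between a b (T a4) (T b4)); auto; lra).
    destruct (Hs t it) as (k1 & k2 & ->).
    assert (q1 := proj1 (Mon (T a4) t j3 it)). assert (q2 := proj1 (Mon t (T b4) it j4)).
    rewrite Rminus_0_r. rewrite e3 in q1. rewrite e4 in q2.
    rewrite <- k2 at 1 2. unfold rc, thc. rewrite (proj1 (HK (s t) ltac:(split; [apply q1 | apply q2]; lra))).
    reflexivity. }
  exists (T a4), (T b4), K1, K2.
  split; [rewrite <- T0; apply Mono; lra|].
  split; [rewrite <- Tl; apply Mono; lra|].
  split; [apply unit_jacobi_jacobi, UR|].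
  split; [rewrite <- (f_equal K1 T0), <- (f_equal K2 T0); apply (HK 0); auto; lra|].
  split; [rewrite <- Tl; apply (HK (s l)); auto; lra|].
  exists (T t'). split; [split; apply Mono; lra|].
  intros e. apply nz'. apply (HK t'); auto.
Qed.

Lemma conjugate_iff :
  conjugate_along (rotational (zermelo m A B)) P l (P 0) (P l) <->
  conjugate_along (rotational (sym m A)) rho (s l) (P 0) (fst (P l), snd (P l) - B * l).
Proof.
  destruct (corresponds_minimizing m A B W a b P c d rho s l h0 hl C) as (s0 & P0 & Pl & _).
  split; intros (_ & _ & a' & b' & J1 & J2 & h1 & h2 & h3 & h4 & h5 & h6).
  - split; [rewrite P0; apply same_point_refl|]. split.
    + rewrite Pl. unfold rotate; simpl. replace (snd (rho (s l)) + B * l - B * l) with (snd (rho (s l))) by ring.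
      rewrite <- surjective_pairing. apply same_point_refl.
    + exact (conjugate_zermelo_sym a' b' J1 J2 h1 h2 h3 h4 h5 h6).
  - split; [apply same_point_refl|]. split; [apply same_point_refl|].
    exact (conjugate_sym_zermelo a' b' J1 J2 h1 h2 h3 h4 h5 h6).
Qed.

End Pair.

End Conjugate.

Theorem theorem4p3 :
  forall (m A : R -> R) (B : R),
    smooth m -> (forall r, 0 < m r) -> (forall r, m (- r) = m r) ->
    ~ (exists k0 k1 : R, forall r, m r = k1 * r + k0) ->
    smooth A ->
    (forall r, (A r) ^ 2 + B ^ 2 * (m r) ^ 2 < 1) ->
  forall Ft alphat betat F alpha beta : metric,
    zermelo_solution (warped_norm m) (fun r _ => A r) (fun _ _ => B)
      Ft alphat betat ->
    zermelo_solution (warped_norm m) (fun r _ => A r) (fun _ _ => 0)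
      F alpha beta ->
  (* (i) *)
  (forall (a b : Rbar) (P : curve), Rbar_lt a 0 -> Rbar_lt 0 b ->
     (unit_geodesic_on Ft a b P <->
      exists (c d : Rbar) (rho : curve) (s : R -> R),
        corresponds F alpha B a b P c d rho s)) /\
  (* (ii) *)
  (forall (a b : Rbar) (P : curve) (c d : Rbar) (rho : curve) (s : R -> R)
          (l : R),
     Rbar_lt a 0 -> 0 < l -> Rbar_lt l b ->
     corresponds F alpha B a b P c d rho s ->
     (conjugate_along Ft P l (P 0) (P l) <->
      conjugate_along alpha rho (s l) (P 0) (fst (P l), snd (P l) - B * l))) /\
  (* (iii): the condition l = d(p, q), in which q itself depends on l,
     determines l uniquely *)
  (forall p qh : point,
     exists l : R,
       unique (fun x => x = finsler_dist Ft p (fst qh, snd qh + B * x)) l /\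
       (cut alpha p qh <-> cut Ft p (fst qh, snd qh + B * l))).
Proof.
  intros m A B Hm Hpos _ _ HA Hlt Ft alphat betat F alpha beta ZB Z0.
  assert (W : navigation m A B) by (constructor; auto).
  rewrite (zermelo_solution_unique m A B Ft alphat betat W ZB).
  rewrite (randers_part_sym m A B W F alpha beta Z0).
  rewrite (zermelo_solution_unique m A 0 F alpha beta (navigation_0 m A B W) Z0).
  split; [|split].
  - intros a b P ha hb. split.
    + apply geodesic_corresponds; auto. split; auto.
    + intros (c & d & rho & s & C). exact (corresponds_geodesic m A B W _ _ _ _ _ _ _ C).
  - intros a b P c d rho s l ha hl hb C. apply (conjugate_iff m A B W a b P c d rho s l); auto.
    + split; auto. apply Rbar_lt_trans with l; auto.
    + split; auto. apply Rbar_lt_trans with 0; auto.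
  - apply cut_locus; auto.
Qed.
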